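(* Let $n\ge 4$ and let $$N_n=\frac1{12}(n-2)(n-3)(3n^2-7n-2).$$ Then (the geometric realization of) the simplicial complex $D_{n,n-2}$ has the homotopy type of $\bigvee_{N_n}S^2$, a wedge of $N_n$ spheres of dimension $2$.
   Context: For an integer $n\ge2$, $\mathcal{G}_n$ is the set of simple undirected graphs on the vertex set $\overline{n}=\{1,2,\ldots,n\}$; each graph is identified with its edge set. A set $D\subseteq\overline{n}$ dominates $\sigma\in\mathcal{G}_n$ if every vertex in $\overline{n}\setminus D$ is adjacent in $\sigma$ to some vertex of $D$. The domination number $\gamma(\sigma)$ is the minimal cardinality of a dominating set of $\sigma$. For $1\le k\le n$, $D_{n,k}$ is the abstract simplicial complex whose $d$-dimensional simplices ($d\ge 0$) are the graphs $\sigma\in\mathcal{G}_n$ (viewed as edge sets) having exactly $d+1$ edges and satisfying $\gamma(\sigma)\ge k$. *)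

(* Defs.v *)
From HB Require Import structures.
From mathcomp Require Import all_boot all_order all_algebra.
From mathcomp Require Import all_classical all_reals all_analysis.
From mathcomp Require Import wedge_sigT.

Set Implicit Arguments.
Unset Strict Implicit.
Unset Printing Implicit Defensive.

Import Order.TTheory GRing.Theory Num.Theory.
Import numFieldNormedType.Exports.

Local Open Scope classical_set_scope.
Local Open Scope ring_scope.

Definition edge (n : nat) := {e : {set 'I_n} | #|e| == 2%N}.

(* The vertex set {1, ..., n} is encoded as 'I_n, and a simple graph as its
   set of edges. *)
Definition graph (n : nat) := {set edge n}.

Definition adjacent_in (n : nat) (s : graph n) (u v : 'I_n) : bool :=
  [exists e in s, val e == [set u; v]%SET].

Definition dominates (n : nat) (D : {set 'I_n}) (s : graph n) : bool :=
  [forall (v | v \notin D), [exists u in D, adjacent_in s v u]].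

(* The full vertex set, used as default by [arg min], is always dominating. *)
Definition domination_number (n : nat) (s : graph n) : nat :=
  #|[arg min_(D < [set: 'I_n]%SET | dominates D s) #|D|]|.

Record simplicial_complex (V : finType) := SimplicialComplex {
  simplices :> {set {set V}};
  simplices_neq0 : finset.set0 \notin simplices;
  simplices_closed : forall s t : {set V},
    s \in simplices -> t != finset.set0 -> t \subset s -> t \in simplices }.

(* Points are barycentric coordinates.  As V is finite, the usual topology of
   the realization is the one induced by the product topology on V -> R. *)
Definition barycentric_points (R : realType) (V : finType)
    (K : simplicial_complex V) : set (prod_topology (fun _ : V => R)) :=
  [set x | [/\ forall v, 0 <= x v, \sum_v x v = 1
             & [set v | x v != 0]%SET \in simplices K]].
Arguments barycentric_points R {V} K.

Definition realization (R : realType) (V : finType)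
    (K : simplicial_complex V) : topologicalType :=
  set_type (barycentric_points R K).

Lemma dominates_setT (n : nat) (s : graph n) : dominates [set: 'I_n]%SET s.
Proof. by apply/forall_inP => v; rewrite finset.inE. Qed.

Lemma domination_numberS (n : nat) (s t : graph n) : t \subset s ->
  (domination_number s <= domination_number t)%N.
Proof.
move=> /fintype.subsetP ts; rewrite /domination_number.
case: arg_minnP => [|D _ Dmin]; first exact: dominates_setT.
case: arg_minnP => [|D' D't _]; first exact: dominates_setT.
apply: Dmin; apply/forall_inP => v vD'.
have /exists_inP[u uD' /exists_inP[e et evu]] := forall_inP D't _ vD'.
by apply/exists_inP; exists u => //; apply/exists_inP; exists e => //; exact: ts.
Qed.

Definition domination_simplices (n k : nat) : {set graph n} :=
  [set s : graph n | (0 < #|s|)%N && (k <= domination_number s)%N]%SET.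

Lemma domination_simplices_neq0 (n k : nat) :
  finset.set0 \notin domination_simplices n k.
Proof. by rewrite finset.inE cards0. Qed.

Lemma domination_simplices_closed (n k : nat) (s t : graph n) :
  s \in domination_simplices n k -> t != finset.set0 -> t \subset s ->
  t \in domination_simplices n k.
Proof.
rewrite !finset.inE => /andP[_ ks] t0 ts; rewrite card_gt0 t0 /=.
exact: leq_trans ks (domination_numberS ts).
Qed.

Definition domination_complex (n k : nat) : simplicial_complex (edge n) :=
  SimplicialComplex (domination_simplices_neq0 n k)
    (@domination_simplices_closed n k).

(* The library norm on 'rV[R]_d.+1 is the sup norm, hence the explicit sum of
   squares. *)
Definition sphere (R : realType) (d : nat) : set 'rV[R]_d.+1 :=
  [set x | \sum_i x ord0 i ^+ 2 = 1].
Arguments sphere : clear implicits.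

Lemma sphere_base_subproof (R : realType) (d : nat) :
  delta_mx ord0 ord0 \in sphere R d.
Proof.
rewrite inE /sphere /= (bigD1 ord0) //= big1 => [|i /negbTE i0].
  by rewrite mxE !eqxx addr0 expr1n.
by rewrite mxE i0 andbF expr0n.
Qed.

Definition sphere_base (R : realType) (d : nat) : sphere R d :=
  exist _ (delta_mx ord0 ord0) (sphere_base_subproof R d).

(* Intended for 0 < N: an empty library wedge has no points at all. *)
Definition sphere_wedge (R : realType) (d N : nat) : topologicalType :=
  wedge (fun _ : 'I_N => sphere_base R d).

(* The values of H outside X x [0, 1] are irrelevant. *)
Definition homotopic (R : realType) (X Y : topologicalType) (f g : X -> Y) :
    Prop :=
  exists H : X * R -> Y,
    [/\ {within [set: X] `*` `[0, 1], continuous H},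
        forall x, H (x, 0) = f x & forall x, H (x, 1) = g x].

Definition homotopy_equivalent (R : realType) (X Y : topologicalType) : Prop :=
  exists (f : X -> Y) (g : Y -> X),
    [/\ continuous f, continuous g,
        homotopic R (g \o f) idfun & homotopic R (f \o g) idfun].

(* Main.v *)
(** Only cycles on four vertices are cells of dimension 3, and each has a path
    with three edges as a free face, so they collapse away.  Order the vertices
    and let T be the subcomplex of all edges and pairs of edges, all triangles
    of the graph, and some three-edge paths, chosen so that in the link of each
    edge {i, k} with i < k the cells below k form a tree; then T collapses to a
    point, one edge {i, k} at a time.  Hence attaching a cone over T does not
    change the homotopy type.  Only 2-cells are left outside T, so the result
    is a contractible cone with finitely many 2-simplices glued on along their
    boundaries, and explicit maps in barycentric coordinates identify it up to
    homotopy with a wedge of spheres. *)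

(* The condition on the domination number excludes one pattern only: three vertices, each with a
   neighbour outside the three. So a cell with more than two edges is a triangle, a path on four
   vertices or a 4-cycle.

   No quotient by T is formed. The matching that collapses T also pairs the empty set with the edge
   {0, 1}, so joining all pairs with the apex gives a perfect matching of the cells that contain the
   apex. Along it the complex with the cone attached collapses back to the original one; along the
   pairs of a path and its 4-cycle it collapses to the cone plus the critical paths. One lemma on
   acyclic matchings serves both.

   A critical path and the apex span a simplex on four vertices whose boundary is the 2-sphere
   contributed by the path. Nonconstant functions on the vertices of a simplex, modulo constants and
   positive factors, are the points of its boundary; so the maps to and from the wedge are formulas,
   and the homotopies come from segments that only have to avoid the constants or zero.

   With largest vertex k there are C(k, 2) (k - 2) + k C(k - 2, 2) = k (k - 2)^2 critical paths. *)
Require Import Defs.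
From mathcomp Require Import all_boot all_order all_algebra.
From mathcomp Require Import all_classical all_reals all_analysis.
From mathcomp Require Import wedge_sigT ring lra zify.

Set Implicit Arguments.
Unset Strict Implicit.
Unset Printing Implicit Defensive.

Import Order.TTheory GRing.Theory Num.Theory.
Import numFieldNormedType.Exports.

Local Open Scope classical_set_scope.
Local Open Scope ring_scope.

(** * Continuity and homotopies *)

Section RealContinuity.
Variables (R : realType) (X : topologicalType).
Implicit Types (f g : X -> R) (x : X).

Lemma continuous_at_cst (c : R) x : {for x, continuous (fun _ : X => c)}.
Proof. exact: cvg_cst. Qed.

Lemma continuous_at_add f g x : {for x, continuous f} ->
  {for x, continuous g} -> {for x, continuous (fun z => f z + g z)}.
Proof. exact: cvgD. Qed.

Lemma continuous_at_opp f x : {for x, continuous f} ->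
  {for x, continuous (fun z => - f z)}.
Proof. exact: cvgN. Qed.

Lemma continuous_at_mul f g x : {for x, continuous f} ->
  {for x, continuous g} -> {for x, continuous (fun z => f z * g z)}.
Proof. exact: cvgM. Qed.

Lemma continuous_at_inv f x : f x != 0 -> {for x, continuous f} ->
  {for x, continuous (fun z => (f z)^-1)}.
Proof. exact: cvgV. Qed.

Lemma continuous_at_sqrt f x : {for x, continuous f} ->
  {for x, continuous (fun z => Num.sqrt (f z))}.
Proof.
by move=> cf; apply: (@continuous_comp _ _ _ f Num.sqrt) => //; exact: sqrt_continuous.
Qed.

Lemma continuous_at_sum (I : Type) (r : seq I) (P : pred I) (F : I -> X -> R) x :
  (forall i, P i -> {for x, continuous (F i)}) ->
  {for x, continuous (fun z => \sum_(i <- r | P i) F i z)}.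
Proof.
move=> cF; apply: cvg_big => //; apply: add_continuous.
Qed.

Lemma continuous_at_prod (I : Type) (r : seq I) (P : pred I) (F : I -> X -> R) x :
  (forall i, P i -> {for x, continuous (F i)}) ->
  {for x, continuous (fun z => \prod_(i <- r | P i) F i z)}.
Proof.
move=> cF; apply: cvg_big => //; apply: mul_continuous.
Qed.

Lemma continuous_at_bigmin (I : Type) (r : seq I) (P : pred I) f (F : I -> X -> R) x :
  {for x, continuous f} -> (forall i, P i -> {for x, continuous (F i)}) ->
  {for x, continuous (fun z => \big[Num.min/f z]_(i <- r | P i) F i z)}.
Proof.
move=> cf cF; elim: r => [|i r IH].
  have -> : (fun z => \big[Num.min/f z]_(i <- [::] | P i) F i z) = f.
    apply: funext => z; exact: big_nil.
  exact: cf.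
have -> : (fun z => \big[Num.min/f z]_(j <- i :: r | P j) F j z) =
    (fun z => if P i then Num.min (F i z) (\big[Num.min/f z]_(j <- r | P j) F j z)
              else \big[Num.min/f z]_(j <- r | P j) F j z).
  apply: funext => z; exact: big_cons.
by case: (P i) (cF i) => // /(_ isT) cFi; exact: continuous_min.
Qed.

End RealContinuity.

(** Descends through the syntax of a real function. The nonvanishing of an inverted function is left
    to the caller; leaves are closed by hypotheses when possible. *)
Ltac cont_real :=
  try (lazymatch goal with
       | |- continuous_at ?x ?f => change {for x, continuous f} end);
  lazymatch goal with
  | |- {for _, continuous (fun _ => ?c)} => exact: continuous_at_cst
  | |- {for _, continuous (fun z => @?f z + @?g z)} =>
    apply: continuous_at_add; cont_real
  | |- {for _, continuous (fun z => - @?f z)} => apply: continuous_at_opp; cont_real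
  | |- {for _, continuous (fun z => @?f z * @?g z)} =>
    apply: continuous_at_mul; cont_real
  | |- {for _, continuous (fun z => (@?f z)^-1)} =>
    apply: continuous_at_inv; [|cont_real]
  | |- {for _, continuous (fun z => Num.sqrt (@?f z))} =>
    apply: continuous_at_sqrt; cont_real
  | |- {for _, continuous (fun z => \sum_(i <- _ | _) (@?f z i))} =>
    apply: continuous_at_sum => ? ?; cont_real
  | |- {for _, continuous (fun z => \prod_(i <- _ | _) (@?f z i))} =>
    apply: continuous_at_prod => ? ?; cont_real
  | |- {for _, continuous (fun z => \big[Num.min/@?g z]_(i <- _ | _) (@?f z i))} =>
    apply: continuous_at_bigmin => [|? ?]; cont_real
  | |- {for _, continuous (fun z => if ?b then _ else _)} => case: b; cont_real
  | _ => try match goal with H : _ |- _ => exact: H end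
  end.

(** The pasting lemma. Near x the pieces that miss x are avoided, since they are closed and finite
    in number. Each [G i] is defined on all of X and continuous at the points of its piece, so no
    subspace topology enters. *)
Lemma closed_cover_continuous (X Y : topologicalType) (I : finType)
    (B : I -> set X) (F : X -> Y) (G : I -> X -> Y) :
  (forall i, closed (B i)) -> (forall x, exists i, B i x) ->
  (forall i x, B i x -> {for x, continuous (G i)}) ->
  (forall i x, B i x -> F x = G i x) -> continuous F.
Proof.
move=> clB covB cG FG x U nU.
have : \forall y \near x, forall i, B i y -> U (F y).
  apply: filter_forall => i.
  have [Bx|nBx] := pselect (B i x).
    have : nbhs x (G i @^-1` U) by apply: cG => //; rewrite -FG.
    by apply: filterS => y GU By; rewrite (FG i).
  have : nbhs x (~` B i) by apply: open_nbhs_nbhs; split => //; exact: closed_openC.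
  by apply: filterS => y nBy /nBy.
by apply: filterS => y; have [i Bi] := covB y; move=> /(_ i Bi).

Qed.

Section Realization.
Variables (R : realType) (V : finType) (K : simplicial_complex V).

Definition bary_coord (x : realization R K) : V -> R := val x.

Definition supp (x : V -> R) : {set V} := [set v | x v != 0]%SET.

Lemma bary_coord_ge0 x v : 0 <= bary_coord x v.
Proof. by have [] := set_mem (valP x). Qed.

Lemma bary_coord_supp x : supp (bary_coord x) \in simplices K.
Proof. by have [] := set_mem (valP x). Qed.

Lemma bary_coord_inj : injective bary_coord.
Proof. exact: val_inj. Qed.

Lemma bary_coord_continuous v : continuous (fun x => bary_coord x v).
Proof.
move=> x; apply: (@continuous_comp _ _ _ (@set_val _ (barycentric_points R K)) (@proj _ _ v)).
  exact: initial_continuous.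
exact: (@proj_continuous _ (fun _ : V => R)).
Qed.

Lemma realization_continuous (X : topologicalType) (F : X -> realization R K) :
  (forall v, continuous (fun x => bary_coord (F x) v)) -> continuous F.
Proof.
(* The product topology is the supremum of the topologies pulled back along the coordinates. *)
move=> cF; apply: continuous_comp_initial => x.
apply/cvg_sup => v; apply/cvg_image; first by rewrite eqEsubset; split=> // y _;
   exists (fun=> y).
move=> A nA.
have /= := cF v x A nA.
rewrite /nbhs /= => H.
exists (fun f : V -> R => A (f v)); first exact: H.
rewrite eqEsubset; split => [y [f Af <-] //|y Ay].
by exists (fun=> y).
Qed.

Definition realize (x : V -> R) (h : barycentric_points R K x) : realization R K :=
  exist _ x (mem_set h).

Lemma realizeK x (h : barycentric_points R K x) : bary_coord (realize h) = x.
Proof. by []. Qed.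

End Realization.

Lemma continuous_at_pair (X Y Z : topologicalType) (f : X -> Y) (g : X -> Z)
    (x : X) : {for x, continuous f} -> {for x, continuous g} ->
  {for x, continuous (fun z => (f z, g z))}.
Proof.
move=> cf cg.
exact: (@cvg_pair _ _ _ (nbhs x) (nbhs (f x)) (nbhs (g x)) _ _ _ f g cf cg).
Qed.

Section Homotopy.
Variable R : realType.

Definition clamp (t : R) := Num.max 0 (Num.min t 1).

Lemma clamp_ge0 t : 0 <= clamp t.
Proof. by rewrite le_max lexx. Qed.

Lemma clamp_le1 t : clamp t <= 1.
Proof. by rewrite ge_max ler01 ge_min lexx orbT. Qed.

Lemma clamp_id t : 0 <= t <= 1 -> clamp t = t.
Proof. by move=> /andP[t0 t1]; rewrite /clamp min_l // max_r. Qed.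

Lemma clamp0 : clamp 0 = 0. Proof. by rewrite clamp_id // lexx ler01. Qed.
Lemma clamp1 : clamp 1 = 1. Proof. by rewrite clamp_id // lexx ler01. Qed.

Lemma clamp_continuous : continuous clamp.
Proof.
move=> t; have cmin : {for t, continuous ((@id R) \min (fun=> 1))}.
  by apply: continuous_min; [exact: cvg_id|exact: cvg_cst].
have : {for t, continuous ((fun=> 0 : R) \max ((@id R) \min (fun=> 1)))}.
  by apply: continuous_max => //; exact: cvg_cst.
exact.
Qed.

(** Composing with [clamp] in the time variable extends a homotopy to all times, so later homotopies
    are plain continuous maps on X x R. *)
Lemma homotopic_global (X Y : topologicalType) (f g : X -> Y) :
  (exists H : X * R -> Y, [/\ continuous H, forall x, H (x, 0) = f x
     & forall x, H (x, 1) = g x]) <-> homotopic R f g.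
Proof.
split=> -[H [cH H0 H1]].
  by exists H; split=> //; exact: continuous_subspaceT.
exists (fun z => H (z.1, clamp z.2)); split; last 2 first.
- by move=> x; rewrite clamp0.
- by move=> x; rewrite clamp1.
pose k (z : X * R) := (z.1, clamp z.2).
have kA z : ([set: X] `*` `[0, 1]) (k z).
  by split=> //=; rewrite in_itv /= clamp_ge0 clamp_le1.
move=> z; have ck : {for z, continuous k}.
  apply: (@continuous_at_pair _ _ _ fst (clamp \o snd)); first exact: cvg_fst.
  by apply: continuous_comp; [exact: cvg_snd|exact: clamp_continuous].
move=> U nU; have := cH (k z) U nU.
rewrite /nbhs /= -(nbhs_subspace_in (kA z)) /within /= => nH.
have {}nH := ck _ nH; rewrite /nbhs /= in nH.
by apply: filterS nH => y /= /(_ (kA y)).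
Qed.

End Homotopy.
Lemma closed_le_fun (R : realType) (X : topologicalType) (f g : X -> R) :
  continuous f -> continuous g -> closed [set x | f x <= g x].
Proof.
move=> cf cg.
have -> : [set x | f x <= g x] = (fun x => g x - f x) @^-1` [set t | 0 <= t].
  by apply/seteqP; split=> x /=; rewrite subr_ge0.
apply: closed_comp; last exact: closed_ge.
by move=> x _; cont_real.
Qed.

Section HomotopyAlgebra.
Variable R : realType.
Implicit Types X Y Z W : topologicalType.

Lemma homotopic_eq X Y (f g : X -> Y) :
  continuous f -> f =1 g -> homotopic R f g.
Proof.
move=> cf fg; apply/homotopic_global; exists (f \o fst); split=> //.
by move=> z; apply: continuous_comp; [exact: cvg_fst|exact: cf].
Qed.

Lemma homotopic_trans X Y (f g h : X -> Y) :
  homotopic R f g -> homotopic R g h -> homotopic R f h.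
Proof.
move=> /homotopic_global[H [cH H0 H1]] /homotopic_global[J [cJ J0 J1]].
apply/homotopic_global.
exists (fun z => if z.2 <= 2^-1 then H (z.1, 2 * z.2) else J (z.1, 2 * z.2 - 1)).
split=> [|x|x] /=; last 2 first.
- by rewrite invr_ge0 ler0n mulr0.
- rewrite leNgt invf_lt1 ?ltr1n ?ltr0n //= mulr1.
  by have -> : 2 - 1 = 1 :> R by lra.
have cs (a b : R) (z : X * R) : {for z, continuous (fun y : X * R => (y.1, a * y.2 - b))}.
  apply: (@continuous_at_pair _ _ _ fst (fun y : X * R => a * y.2 - b)).
    exact: cvg_fst.
  by cont_real; exact: cvg_snd.
pose B (b : bool) : set (X * R) :=
  if b then [set z | z.2 <= 2^-1] else [set z | 2^-1 <= z.2].
pose G (b : bool) (z : X * R) :=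
  if b then H (z.1, 2 * z.2 - 0) else J (z.1, 2 * z.2 - 1).
apply: (@closed_cover_continuous _ _ _ B _ G).
- by case; apply: closed_le_fun => z; do ?[exact: cvg_cst|exact: cvg_snd].
- move=> z; have /orP[?|?] := le_total z.2 2^-1; first by exists true.
  by exists false.
- case=> z _; first by apply: (@continuous_comp _ _ _ _ H); [exact: cs|exact: cH].
  by apply: (@continuous_comp _ _ _ _ J); [exact: cs|exact: cJ].
- case=> z /= hz; rewrite ?subr0; first by rewrite hz.
  case: ifP => // hz'; have -> : z.2 = 2^-1 by apply: le_anti; rewrite hz hz'.
  by rewrite mulfV ?pnatr_eq0 // subrr H1 J0.
Qed.

Lemma homotopic_comp W X Y Z (k : W -> X) (f g : X -> Y) (h : Y -> Z) :
  continuous k -> continuous h -> homotopic R f g ->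
  homotopic R (h \o f \o k) (h \o g \o k).
Proof.
move=> ck ch /homotopic_global[H [cH H0 H1]]; apply/homotopic_global.
exists (fun z => h (H (k z.1, z.2))); split=> [z|x|x] /=; last 2 first.
- by rewrite H0.
- by rewrite H1.
apply: (@continuous_comp _ _ _ (fun z => H (k z.1, z.2)) h); last exact: ch.
apply: (@continuous_comp _ _ _ (fun z => (k z.1, z.2)) H); last exact: cH.
apply: (@continuous_at_pair _ _ _ (k \o fst) snd); last exact: cvg_snd.
by apply: continuous_comp; [exact: cvg_fst|exact: ck].
Qed.

Lemma homotopy_equivalent_sym X Y :
  homotopy_equivalent R X Y -> homotopy_equivalent R Y X.
Proof. by move=> [f [g [cf cg gf fg]]]; exists g, f. Qed.

Lemma homotopy_equivalent_trans X Y Z : homotopy_equivalent R X Y ->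
  homotopy_equivalent R Y Z -> homotopy_equivalent R X Z.
Proof.
move=> [f [g [cf cg gf fg]]] [f' [g' [cf' cg' gf' fg']]].
exists (f' \o f), (g \o g'); split.
- by move=> x; apply: continuous_comp; [exact: cf|exact: cf'].
- by move=> x; apply: continuous_comp; [exact: cg'|exact: cg].
- exact: homotopic_trans (homotopic_comp cf cg gf') gf.
- exact: homotopic_trans (homotopic_comp cg' cf' fg) fg'.
Qed.

End HomotopyAlgebra.

(** * Simplicial collapses *)

Section MinimumOnSet.
Variables (R : realType) (V : finType).
Implicit Types (x : V -> R) (s : {set V}).

Definition min_on s (v0 : V) x := \big[Num.min/x v0]_(v in s) x v.

Lemma min_on_le s v0 x v : v \in s -> min_on s v0 x <= x v.
Proof. by move=> vs; exact: bigmin_le_cond. Qed.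

Lemma min_on_attained s v0 x : v0 \in s -> exists2 v, v \in s & min_on s v0 x = x v.
Proof.
move=> v0s; rewrite /min_on.
elim/big_ind : _ => [|a b [v vs ->] [w ws ->]|v vs]; [by exists v0| |by exists v].
by rewrite /Order.min; case: ifP => _; [exists v|exists w].
Qed.

Lemma min_on_eq s v0 x (c : R) : v0 \in s -> (forall v, v \in s -> c <= x v) ->
  (exists2 v, v \in s & x v = c) -> min_on s v0 x = c.
Proof.
move=> v0s cx [v vs vc]; apply: le_anti; rewrite -{1}vc min_on_le //=.
by have [w ws ->] := min_on_attained x v0s; exact: cx.
Qed.

Lemma continuous_at_min_on (X : topologicalType) s v0 (f : X -> V -> R) a :
  (forall v, {for a, continuous (fun y => f y v)}) ->
  {for a, continuous (fun y => min_on s v0 (f y))}.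
Proof. by move=> cf; rewrite /min_on; cont_real. Qed.

End MinimumOnSet.

Section ElementaryCollapse.
Variables (R : realType) (V : finType) (K L : simplicial_complex V).
Variables (s : {set V}) (w v0 : V).
Hypotheses (v0s : v0 \in s) (ws : w \notin s).
Hypotheses (sL : s \notin simplices L) (wsL : w |: s \notin simplices L).
Hypothesis KE : forall t,
  (t \in simplices K) = [|| t \in simplices L, t == s | t == w |: s].

(** The deformation away from the free face [s]: each vertex of [s] gives up the same amount, c
    times the smallest coordinate on [s], and [w] receives the total. On [L] that smallest
    coordinate is 0, so nothing moves. *)
Definition push (c : R) (x : V -> R) (v : V) : R :=
  x v - (if v \in s then c * min_on s v0 x else 0)
      + (if v == w then c * (min_on s v0 x * #|s|%:R) else 0).

Lemma push0 x : push 0 x = x.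
Proof. by apply/funext => v; rewrite /push !mul0r !if_same subr0 addr0. Qed.

Lemma push_sum c x : \sum_v push c x v = \sum_v x v.
Proof.
rewrite /push !big_split /= -addrA [X in _ + X](_ : _ = 0) ?addr0 //.
rewrite sumrN -!big_mkcond /= big_pred1_eq sumr_const mulrA.
by rewrite mulr_natr addNr.
Qed.

Lemma push_L c x : (forall v, 0 <= x v) -> supp x \in simplices L -> push c x = x.
Proof.
move=> x0 xL; rewrite -[RHS](push0 x); apply/funext => v; rewrite /push.
have -> : min_on s v0 x = 0; last by rewrite !(mul0r,mulr0).
apply: min_on_eq => //.
have [/existsP[v1 /andP[v1s /eqP v10]]|] := boolP [exists v1, (v1 \in s) && (x v1 == 0)].
  by exists v1.
rewrite negb_exists => /forallP h; exfalso; move/negP: sL; apply.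
apply: (simplices_closed xL); first by apply/set0Pn; exists v0.
by apply/fintype.subsetP => v1 v1s; rewrite inE; move: (h v1); rewrite v1s.
Qed.

Lemma push_ge0 (c : R) x v : (forall v, 0 <= x v) -> 0 <= c <= 1 -> 0 <= push c x v.
Proof.
move=> x0 /andP[c0 c1]; have m0 : 0 <= min_on s v0 x.
  by have [u _ ->] := min_on_attained x v0s.
apply: addr_ge0; last by case: ifP => // _; rewrite !mulr_ge0.
case: ifP => [vs|_]; last by rewrite subr0.
rewrite subr_ge0; apply: le_trans (min_on_le v0 x vs).
by rewrite ler_piMl.
Qed.

Lemma push_supp c x v : v \notin w |: s -> push c x v = x v.
Proof.
rewrite !inE negb_or => /andP[/negbTE vw /negbTE vs].
by rewrite /push vs vw subr0 addr0.
Qed.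

Lemma push_K (c : R) x : barycentric_points R K x -> 0 <= c <= 1 ->
  barycentric_points R K (push c x).
Proof.
move=> [x0 x1 xK] c01; split.
- by move=> v; exact: push_ge0.
- by rewrite push_sum.
have [xL|xL] := boolP (supp x \in simplices L); first by rewrite push_L.
have wsK : w |: s \in simplices K by rewrite KE eqxx !orbT.
apply: (simplices_closed wsK).
  apply/negP => /eqP p0; have : \sum_v push c x v = 0.
    apply: big1 => v _; apply/eqP; move/setP/(_ v): p0.
    by rewrite !inE; move/negbFE.
  by rewrite push_sum x1; apply/eqP/oner_neq0.
apply/fintype.subsetP => v; rewrite inE; apply: contraR => vws.
rewrite push_supp //; move: xK; rewrite KE (negbTE xL) /= => h.
have : supp x \subset w |: s.
  by rewrite /supp; case/orP: h => /eqP ->; rewrite // finset.subsetUr.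
move=> /fintype.subsetP sub; apply/negP => xv; move/negP: vws; apply.
by apply: sub; rewrite inE; apply/negP.
Qed.

(** A vertex of [s] attaining the minimum leaves the support, so the support can no longer be [s] or
    [w |: s]. *)
Lemma push_retract x : barycentric_points R K x -> barycentric_points R L (push 1 x).
Proof.
move=> xK; have c01 : (0 <= 1 :> R) && (1 <= 1 :> R) by rewrite ler01 lexx.
have [p0 p1 pK] := push_K xK c01; split=> //.
have [x0 x1 {}xK] := xK.
have [xL|xL] := boolP (supp x \in simplices L); first by rewrite push_L.
move: pK; rewrite KE => /orP[//|pE]; exfalso.
have [v vs mv] := min_on_attained x v0s.
have : v \in supp (push 1 x).
  by rewrite /supp; case/orP: pE => /eqP ->; rewrite // inE vs orbT.
rewrite inE /push vs !mul1r mv subrr add0r; case: ifP => [/eqP vw|_].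
  by move: ws; rewrite -vw vs.
by rewrite eqxx.
Qed.

Lemma continuous_at_push (X : topologicalType) (c : X -> R) (f : X -> V -> R) a v :
  {for a, continuous c} -> (forall v, {for a, continuous (fun y => f y v)}) ->
  {for a, continuous (fun y => push (c y) (f y) v)}.
Proof.
move=> cc cf; have cm := @continuous_at_min_on R V X s v0 f a cf.
by rewrite /push; cont_real.
Qed.

Lemma collapse_homotopy_equivalent :
  homotopy_equivalent R (realization R K) (realization R L).
Proof.
have LK x : barycentric_points R L x -> barycentric_points R K x.
  by move=> [x0 x1 xL]; split => //; rewrite KE xL.
have valP' (M : simplicial_complex V) (x : realization R M) :
  barycentric_points R M (bary_coord x) by exact: set_mem (valP x).
pose f (x : realization R K) := realize (push_retract (valP' _ x)).
pose g (x : realization R L) := realize (LK _ (valP' _ x)).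
have cf : continuous f.
  apply: realization_continuous => v x; rewrite /continuous_at /=.
  apply: (@continuous_at_push _ (fun=> 1) (@bary_coord R V K)).
    exact: continuous_at_cst.
  by move=> u; exact: bary_coord_continuous.
have cg : continuous g.
  by apply: realization_continuous => v; exact: bary_coord_continuous.
exists f, g; split=> //.
  have c01 (t : R) : 0 <= 1 - clamp t <= 1.
    by rewrite subr_ge0 clamp_le1 gerBl clamp_ge0.
  apply/homotopic_global.
  exists (fun z => realize (push_K (valP' _ z.1) (c01 z.2))); split.
  - apply: realization_continuous => v z; rewrite /continuous_at /=.
    apply: (@continuous_at_push _ (fun z : _ * R => 1 - clamp z.2) (fun z => bary_coord z.1)).
      cont_real; apply: (@continuous_comp _ _ _ snd (@clamp R)); first exact: cvg_snd.
      exact: clamp_continuous.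
    move=> u; apply: (@continuous_comp _ _ _ fst (fun x => @bary_coord R V K x u)).
      exact: cvg_fst.
    exact: bary_coord_continuous.
  - move=> x; apply: bary_coord_inj; rewrite /= !realizeK /=.
    by rewrite clamp0 subr0.
  - move=> x; apply: bary_coord_inj; rewrite /= !realizeK /=.
    by rewrite clamp1 subrr push0.
apply: homotopic_eq.
  by move=> x; apply: continuous_comp; [exact: cg|exact: cf].
move=> x; apply: bary_coord_inj; rewrite /= !realizeK push_L //; first exact: bary_coord_ge0.
exact: bary_coord_supp.
Qed.

End ElementaryCollapse.

Section Matching.
Variables (R : realType) (V J : finType) (L : simplicial_complex V).
Variables (low : J -> {set V}) (w : J -> V) (rk : J -> nat).
Local Notation up j := (w j |: low j).

(* Cells are removed pair by pair in order of decreasing rank: the last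
   hypothesis but one makes the lower cell of a pair of maximal rank a free
   face. *)
Lemma matching_homotopy_equivalent (P : {set J}) (K : simplicial_complex V) :
  {in P, forall j, low j != finset.set0} ->
  {in P, forall j, w j \notin low j} ->
  {in P, forall j, low j \notin simplices L} ->
  {in P &, forall i j, up i != low j} ->
  {in P &, forall i j, i != j -> low i \subset up j -> (rk i < rk j)%N} ->
  (forall t, (t \in simplices K) = (t \in simplices L) ||
     [exists j in P, (t == low j) || (t == up j)]) ->
  homotopy_equivalent R (realization R K) (realization R L).
Proof.
move: {2}#|P| (erefl #|P|) => k; elim: k P K => [|k IH] P K.
  move=> /eqP; rewrite cards_eq0 => /eqP -> _ _ _ _ _ KE.
  have {KE} KL : simplices K = simplices L.
    apply/setP => t; rewrite KE; case: (t \in simplices L) => //=.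
    by apply/existsP => -[j]; rewrite inE.
  have -> : K = L.
    case: K L KL => [K K0 Kc] [M M0 Mc] /= KM; subst M.
    by congr SimplicialComplex; exact: Prop_irrelevance.
  exists id, id; split; try exact: (fun x => cvg_id).
    by apply: homotopic_eq => // x; exact: cvg_id.
  by apply: homotopic_eq => // x; exact: cvg_id.
move=> Pk low0 wlow lowL uplow acyc KE.
have /card_gt0P[j1 j1P] : (0 < #|P|)%N by rewrite Pk.
pose j0 := [arg max_(j > j1 | j \in P) rk j].
have [j0P j0max] : j0 \in P /\ forall j, j \in P -> (rk j <= rk j0)%N.
  by rewrite /j0; case: arg_maxnP.
have free t : t \in simplices K -> low j0 \subset t ->
    t = low j0 \/ t = up j0.
  rewrite KE => /orP[tL|/exists_inP[j jP tj]] st.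
    move/negP: (lowL _ j0P); case.
    exact: simplices_closed tL (low0 _ j0P) st.
  have [<-|jj0] := eqVneq j j0; first by case/orP: tj => /eqP ->; [left|right].
  have /(acyc _ _ j0P jP) : low j0 \subset up j.
    apply: (fintype.subset_trans st).
    by case/orP: tj => /eqP -> //; exact: finset.subsetUr.
  by rewrite eq_sym => /(_ jj0); rewrite ltnNge j0max.
pose K' := [set t in simplices K | (t != low j0) && (t != up j0)]%SET.
have K'0 : finset.set0 \notin K'.
  by rewrite inE (negbTE (simplices_neq0 K)).
have K'c s t : s \in K' -> t != finset.set0 -> t \subset s -> t \in K'.
  rewrite !inE => /andP[sK /andP[s1 s2]] t0 ts.
  rewrite (simplices_closed sK t0 ts) /= -negb_or; apply/negP => tE.
  have : low j0 \subset s.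
    apply: fintype.subset_trans ts.
    by case/orP: tE => /eqP -> //; exact: finset.subsetUr.
  by move/(free _ sK) => -[] sE; move: s1 s2; rewrite sE eqxx.
pose KK := SimplicialComplex K'0 K'c.
have [v0 v0s] : exists v, v \in low j0 by apply/set0Pn; exact: low0.
apply: (@homotopy_equivalent_trans _ _ (realization R KK)).
  apply: (@collapse_homotopy_equivalent R V K KK (low j0) (w j0) v0) => //.
  - exact: wlow.
  - by rewrite inE eqxx andbF.
  - have lowK : low j0 \in simplices K.
      by rewrite KE; apply/orP; right; apply/exists_inP; exists j0; rewrite ?eqxx.
    have upK : up j0 \in simplices K.
      rewrite KE; apply/orP; right; apply/exists_inP; exists j0 => //.
      by rewrite eqxx orbT.
    move=> t; rewrite inE.
    have [->|t1] := eqVneq t (low j0); first by rewrite lowK orbT.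
    have [->|t2] := eqVneq t (up j0); first by rewrite upK !orbT.
    by rewrite !orbF andbT.
apply: (IH (P :\ j0)).
- by move: Pk; rewrite (cardsD1 j0) j0P => -[].
- by move=> j; rewrite inE => /andP[_]; exact: low0.
- by move=> j; rewrite inE => /andP[_]; exact: wlow.
- by move=> j; rewrite inE => /andP[_]; exact: lowL.
- by move=> i j; rewrite !inE => /andP[_ iP] /andP[_ jP]; exact: uplow.
- by move=> i j; rewrite !inE => /andP[_ iP] /andP[_ jP]; exact: acyc.
move=> t; rewrite inE KE.
apply/andP/orP => [[/orP[tL|/exists_inP[j jP tj]] /andP[t1 t2]]|[tL|]].
- by left.
- right; apply/exists_inP; exists j => //; rewrite !inE jP andbT.
  by apply/eqP => jj; subst j; move: tj; rewrite (negbTE t1) (negbTE t2).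
- rewrite tL; split=> //; apply/andP; split.
    by apply: contraNneq (lowL _ j0P) => <-.
  apply: contraNneq (lowL _ j0P) => tE.
  by apply: (simplices_closed tL (low0 _ j0P)); rewrite tE finset.subsetUr.
move=> /exists_inP[j]; rewrite !inE => /andP[jj0 jP] tj; split.
  by apply/orP; right; apply/exists_inP; exists j.
(* The remaining pairs share no cell with [j0]: equal lower or equal upper cells contradict the
   maximality of the rank, mixed equalities contradict [uplow]. *)
case/orP: tj => /eqP ->; apply/andP; split.
- apply/eqP => jE; have := acyc _ _ j0P jP; rewrite eq_sym jj0 -jE.
  by rewrite finset.subsetUr => /(_ isT isT); rewrite ltnNge j0max.
- by rewrite eq_sym uplow.
- by rewrite uplow.
- apply/eqP => jE; have := acyc _ _ j0P jP; rewrite eq_sym jj0 jE.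
  by rewrite finset.subsetUr => /(_ isT isT); rewrite ltnNge j0max.
Qed.

End Matching.

Section ExtraVertex.
Variables (R : realType) (V : finType) (K : simplicial_complex V).
Variable K' : simplicial_complex (option V).

Definition base (s : {set option V}) : {set V} := [set v | Some v \in s]%SET.

Hypothesis K'E : forall s,
  (s \in simplices K') = (None \notin s) && (base s \in simplices K).

Definition add_vertex (x : V -> R) (u : option V) := if u is Some v then x v else 0.

Lemma sum_option (f : option V -> R) : \sum_u f u = f None + \sum_v f (Some v).
Proof.
rewrite (bigD1 None) //=; congr (_ + _).
rewrite (reindex_omap (Some : V -> option V) id); last by case.
by apply: eq_bigl => v; rewrite /= eqxx.
Qed.

Lemma add_vertex_in x :
  barycentric_points R K x -> barycentric_points R K' (add_vertex x).
Proof.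
move=> [x0 x1 xK]; split; first by case.
  by rewrite sum_option add0r.
rewrite K'E inE eqxx /=.
by have -> : base [set v | add_vertex x v != 0]%SET = [set v | x v != 0]%SET
  by apply/setP => v; rewrite !inE.
Qed.

Lemma drop_vertex_in x :
  barycentric_points R K' x -> x None = 0 /\ barycentric_points R K (x \o Some).
Proof.
move=> [x0 x1]; rewrite K'E inE negbK => /andP[/eqP xN xK]; split=> //; split.
- by move=> v; exact: x0.
- by rewrite -x1 sum_option xN add0r.
- have <- // : base [set v | x v != 0]%SET = [set v | (x \o Some) v != 0]%SET.
  by apply/setP => v; rewrite !inE.
Qed.

(** Only the vertex type changes: [None] occurs in no simplex of [K'] and is reserved for the apex
    of a cone. *)
Lemma extra_vertex_homotopy_equivalent :
  homotopy_equivalent R (realization R K) (realization R K').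
Proof.
pose f (x : realization R K) := realize (add_vertex_in (set_mem (valP x))).
pose g (x : realization R K') := realize (drop_vertex_in (set_mem (valP x))).2.
have cf : continuous f.
  apply: realization_continuous => -[v|]; first exact: bary_coord_continuous.
  by move=> x; exact: (@continuous_at_cst R _ 0 x).
have cg : continuous g.
  by apply: realization_continuous => v; exact: (@bary_coord_continuous _ _ K').
exists f, g; split=> //; apply: homotopic_eq.
- by move=> x; apply: continuous_comp; [exact: cf|exact: cg].
- by move=> x; apply: bary_coord_inj; apply/funext.
- by move=> x; apply: continuous_comp; [exact: cg|exact: cf].
- move=> x; apply: bary_coord_inj; apply/funext => -[v|] //=.
  exact/esym/(drop_vertex_in (set_mem (valP x))).1.
Qed.

End ExtraVertex.

(** * Cones with additional facets *)

Section Sphere.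
Variables (R : realType) (d : nat).
Local Notation vec := 'rV[R]_d.+1.

Definition pole : vec := delta_mx ord0 ord0.

Definition normalize (y : vec) : vec := (Num.sqrt (\sum_k y ord0 k ^+ 2))^-1 *: y.

Lemma sum_sqr_gt0 (y : vec) : y != 0 -> 0 < \sum_k y ord0 k ^+ 2.
Proof.
move=> y0; rewrite lt_def sumr_ge0 ?andbT; last by move=> k _; exact: sqr_ge0.
apply: contra_neq y0 => /eqP; rewrite psumr_eq0 => [/allP h|k _]; last exact: sqr_ge0.
apply/rowP => k; rewrite mxE; apply/eqP; rewrite -sqrf_eq0.
by apply: h; rewrite mem_index_enum.
Qed.

Lemma normalize_sphere (y : vec) : y != 0 -> normalize y \in sphere R d.
Proof.
move=> /sum_sqr_gt0 s0; apply/mem_set; rewrite /sphere /= /normalize.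
under eq_bigr do rewrite mxE exprMn.
rewrite -mulr_sumr exprVn sqr_sqrtr; last exact: ltW.
by rewrite mulVf // gt_eqF.
Qed.

Lemma normalize_id (y : vec) : sphere R d y -> normalize y = y.
Proof. by rewrite /sphere /= /normalize => ->; rewrite sqrtr1 invr1 scale1r. Qed.

Lemma sphere_neq0 (y : vec) : sphere R d y -> y != 0.
Proof.
rewrite /sphere /= => y1; apply/eqP => y0; move/eqP: y1.
rewrite y0 big1 => [|k _]; last by rewrite mxE expr0n.
by rewrite eq_sym oner_eq0.
Qed.

Definition to_sphere (y : vec) : sphere R d := insubd (sphere_base R d) (normalize y).

Lemma to_sphereE (y : vec) : y != 0 -> val (to_sphere y) = normalize y.
Proof. by move=> y0; rewrite val_insubd normalize_sphere. Qed.

Lemma to_sphereK (y : sphere R d) : to_sphere (val y) = y.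
Proof.
have yS := set_mem (valP y).
by apply: val_inj; rewrite to_sphereE ?normalize_id ?sphere_neq0.
Qed.

Lemma to_sphere_pole : to_sphere pole = sphere_base R d.
Proof. by rewrite -[RHS]to_sphereK. Qed.

Lemma row_continuous (X : topologicalType) (u : X -> vec) (x : X) :
  (forall k, {for x, continuous (fun z => u z ord0 k)}) -> {for x, continuous u}.
Proof.
move=> cu A [P nP PA].
have : \forall z \near x, forall k, P ord0 k (u z ord0 k).
  by apply: filter_forall => k; apply: cu; exact: nP.
by apply: filterS => z hz; apply: PA => i k; rewrite ord1; exact: hz.
Qed.

Lemma to_sphere_continuous (X : topologicalType) (u : X -> vec) :
  (forall x, u x != 0) -> (forall k, continuous (fun x => u x ord0 k)) ->
  continuous (fun x => to_sphere (u x)).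
Proof.
move=> u0 cu; apply: continuous_comp_initial => x.
have -> : set_val \o (fun z => to_sphere (u z)) = (fun z => normalize (u z)).
  by apply: funext => z; exact: to_sphereE.
apply: row_continuous => k; rewrite /normalize.
rewrite [F in {for x, continuous F}](_ : _ =
   fun z => (Num.sqrt (\sum_j u z ord0 j * u z ord0 j))^-1 * u z ord0 k); last first.
  by apply: funext => z; rewrite mxE; congr ((Num.sqrt _)^-1 * _).
cont_real.
by under eq_bigr do rewrite -expr2; rewrite gt_eqF // sqrtr_gt0 sum_sqr_gt0.
Qed.

Lemma sphere_coord_continuous k : continuous (fun y : sphere R d => val y ord0 k).
Proof.
move=> y; apply: (@continuous_comp _ _ _ (@set_val _ (sphere R d))
  (fun z : vec => z ord0 k)); first exact: initial_continuous.
exact: matrix_normedtype.coord_continuous.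
Qed.

End Sphere.

Section ConeWedge.
Variables (R : realType) (V : finType) (d N : nat).
Variables (T : {set {set V}}) (e : 'I_N -> 'I_d.+1 -> V).
Variable K : simplicial_complex (option V).
Local Notation vec := 'rV[R]_d.+1.

Definition facet (i : 'I_N) : {set V} := [set e i k | k in 'I_d.+1]%SET.

Hypothesis e_inj : forall i, injective (e i).
Hypothesis facet_inj : injective facet.
Hypothesis T_closed : forall s t : {set V}, s \in T -> t \subset s -> t \in T.
Hypothesis facetT : forall i, facet i \notin T.
Hypothesis facet_properT : forall i (t : {set V}), t \proper facet i -> t \in T.
Hypothesis KE : forall s, (s \in simplices K) = (s != finset.set0) &&
  ((base s \in T) || (None \notin s) && [exists i, base s == facet i]).

Definition center : R := d.+1%:R^-1.

(** A bump function: among the points of [K] it is nonzero exactly in the interior of the i-th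
    facet. *)
Definition facet_weight (i : 'I_N) (x : option V -> R) : R := \prod_k x (Some (e i k)).

(* The factor makes the first coordinate equal to -1 at the barycenter of the
   i-th facet; on the boundary of the facet the vector is the pole. *)
Definition squash (i : 'I_N) (x : option V -> R) : vec :=
  \row_k (if k == ord0 then 1 - 2 / center ^+ d.+1 * facet_weight i x
          else facet_weight i x * (x (Some (e i k)) - center)).

(** Coordinate 0 of y is reserved for the apex, so the facet vertex of index 0 takes the value that
    makes the facet values sum to zero. *)
Definition sum_zero (y : vec) (k : 'I_d.+1) : R :=
  if k == ord0 then - \sum_(j | j != ord0) y ord0 j else y ord0 k.

(** A linear isomorphism from vectors onto the functions on [cone_facet i] with facet sum zero.
    These form a complement of the constant functions, so unit vectors correspond to the boundary
    points of this simplex through [to_boundary]. *)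
Definition spread (i : 'I_N) (y : vec) (u : option V) : R :=
  if u is Some v then \sum_(k | e i k == v) sum_zero y k else y ord0 ord0.

Definition cone_facet (i : 'I_N) : {set option V} :=
  [set u | if u is Some v then v \in facet i else true]%SET.

Definition low_value (i : 'I_N) (z : option V -> R) : R :=
  min_on (cone_facet i) None z.

Definition excess (i : 'I_N) (z : option V -> R) (u : option V) : R :=
  z u - (if u \in cone_facet i then low_value i z else 0).

(* Central projection of the simplex [cone_facet i], in homogeneous
   coordinates, onto its boundary. *)
Definition to_boundary (i : 'I_N) (z : option V -> R) (u : option V) : R :=
  excess i z u / \sum_v excess i z v.

Lemma None_cone i : None \in cone_facet i.
Proof. by rewrite inE. Qed.

Lemma Some_cone i k : Some (e i k) \in cone_facet i.
Proof. by rewrite inE; apply/imsetP; exists k. Qed.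

Lemma cone_facetP i u : reflect (u = None \/ exists k, u = Some (e i k))
  (u \in cone_facet i).
Proof.
apply: (iffP idP) => [|[->|[k ->]]]; rewrite ?None_cone ?Some_cone //.
case: u => [v|]; last by left.
by rewrite inE => /imsetP[k _ ->]; right; exists k.
Qed.

Lemma sum_cone_facet i (z : option V -> R) : (forall u, u \notin cone_facet i -> z u = 0) ->
  \sum_u z u = z None + \sum_k z (Some (e i k)).
Proof.
move=> z0; rewrite sum_option; congr (_ + _).
rewrite (bigID (fun v => v \in facet i)) /= [X in _ + X]big1 ?addr0; last first.
  by move=> v vi; apply: z0; rewrite inE.
rewrite big_imset /=; last by move=> a b _ _; exact: e_inj.
by apply: eq_bigl.
Qed.

Lemma excess_ge0 i z u : (forall u, u \notin cone_facet i -> 0 <= z u) ->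
  0 <= excess i z u.
Proof.
move=> z0; rewrite /excess; case: ifP => [ui|/negbT/z0]; last by rewrite subr0.
by rewrite subr_ge0 min_on_le.
Qed.

(** The denominator of [to_boundary] could vanish only if z were constant on [cone_facet i]. *)
Lemma excess_sum_gt0 i z u1 u2 : (forall u, u \notin cone_facet i -> 0 <= z u) ->
  u1 \in cone_facet i -> u2 \in cone_facet i -> z u1 != z u2 ->
  0 < \sum_u excess i z u.
Proof.
move=> z0 u1i u2i zu.
have ge0 u : 0 <= excess i z u by exact: excess_ge0.
rewrite lt_def sumr_ge0 // andbT psumr_eq0 //; apply/allP => h.
have eqm u : u \in cone_facet i -> z u = low_value i z.
  move=> ui; have := h u; rewrite mem_index_enum => /(_ isT) /= /eqP.
  by rewrite /excess ui => /eqP; rewrite subr_eq0 => /eqP.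
by move: zu; rewrite !eqm // eqxx.
Qed.

(** The subtracted minimum is 0. The support of z may leave [cone_facet i]; this lets the formula
    for facet i be used at points of other simplices. *)
Lemma to_boundary_id i z u : (forall u, 0 <= z u) -> \sum_u z u = 1 ->
  (exists2 u, u \in cone_facet i & z u = 0) -> to_boundary i z u = z u.
Proof.
move=> z0 z1 zi; have m0 : low_value i z = 0.
  by apply: min_on_eq => //; exact: None_cone.
have ez v : excess i z v = z v by rewrite /excess m0 if_same subr0.
rewrite /to_boundary ez; under eq_bigr do rewrite ez.
by rewrite z1 divr1.
Qed.

Lemma to_boundary_scale i z (a : R) u : 0 < a ->
  to_boundary i (fun v => a * z v) u = to_boundary i z u.
Proof.
move=> a0; have ma : low_value i (fun v => a * z v) = a * low_value i z.
  apply: min_on_eq; first exact: None_cone.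
    by move=> v vi; rewrite ler_pM2l // min_on_le.
  have [v vi mv] := min_on_attained z (None_cone i).
  by exists v => //; rewrite /low_value mv.
have ea v : excess i (fun v => a * z v) v = a * excess i z v.
  by rewrite /excess ma mulrBr; case: ifP; rewrite ?mulr0.
rewrite /to_boundary ea; under eq_bigr do rewrite ea.
rewrite -mulr_sumr invfM mulrACA mulfV ?mul1r //; exact: lt0r_neq0.
Qed.

(** A vertex attaining the minimum drops out of the support. Either it is the apex and the support
    lies in the facet, or the trace of the support is a proper face of the facet, hence in [T]. *)
Lemma to_boundary_in i z u1 u2 : (forall u, u \notin cone_facet i -> z u = 0) ->
  u1 \in cone_facet i -> u2 \in cone_facet i -> z u1 != z u2 ->
  barycentric_points R K (to_boundary i z).
Proof.
move=> z0 u1i u2i zu.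
have z0' u : u \notin cone_facet i -> 0 <= z u by move=> /z0 ->.
have D0 := excess_sum_gt0 z0' u1i u2i zu.
have sum1 : \sum_u to_boundary i z u = 1.
  by rewrite /to_boundary -mulr_suml mulfV // gt_eqF.
split=> //.
  by move=> u; apply: divr_ge0; [exact: excess_ge0|exact: ltW].
have [u ui mu] := min_on_attained z (None_cone i).
set s := [set u | _]%SET.
have us : u \notin s.
  by rewrite inE negbK /to_boundary /excess ui -mu subrr mul0r.
have si : s \subset cone_facet i.
  apply/fintype.subsetP => v; rewrite inE; apply: contraR => vi.
  by rewrite /to_boundary /excess (negbTE vi) subr0 z0 // mul0r.
have bs : base s \subset facet i.
  apply/fintype.subsetP => v; rewrite inE => /(fintype.subsetP si).
  by rewrite inE.
rewrite KE; apply/andP; split.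
  apply/negP => /eqP s0; move/eqP: sum1; rewrite big1 => [|v _].
    by rewrite eq_sym oner_eq0.
  by apply/eqP; move/setP/(_ v): s0; rewrite !inE => /negbFE.
have [bsi|bsi] := eqVneq (base s) (facet i).
  apply/orP; right; rewrite andbC; apply/andP; split.
    by apply/existsP; exists i; rewrite bsi.
  case: u ui mu us => // v; rewrite inE => vi _ /negP[].
  by move: vi; rewrite -bsi inE.
by rewrite (@facet_properT i) // finset.properEneq bsi.
Qed.

Lemma spread_facet i y k : spread i y (Some (e i k)) = sum_zero y k.
Proof.
by rewrite /= (big_pred1 k) // => j; rewrite /= (inj_eq (@e_inj i)).
Qed.

Lemma spread_off i y u : u \notin cone_facet i -> spread i y u = 0.
Proof.
case: u => [v|]; last by rewrite None_cone.
rewrite inE => vi; rewrite /= big_pred0 // => k; apply/eqP => kv.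
by move/negP: vi; apply; rewrite -kv; apply/imsetP; exists k.
Qed.

Lemma sum_sum_zero y : \sum_k sum_zero y k = 0.
Proof.
rewrite (bigD1 ord0) //= {1}/sum_zero eqxx.
rewrite (eq_bigr (fun k => y ord0 k)) ?addNr // => k k0.
by rewrite /sum_zero (negbTE k0).
Qed.

(** A constant value would be zero because the facet values sum to zero. *)
Lemma spread_nonconstant i y : y != 0 -> exists k, spread i y (Some (e i k)) != spread i y None.
Proof.
move=> y0; apply/existsP; apply: contraR y0; rewrite negb_exists => /forallP h.
have yE k : sum_zero y k = y ord0 ord0.
  by have := h k; rewrite negbK spread_facet => /eqP.
have y00 : y ord0 ord0 = 0.
  have := sum_sum_zero y; rewrite (eq_bigr _ (fun k _ => yE k)) sumr_const card_ord.
  by move/eqP; rewrite mulrn_eq0 /= => /eqP.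
apply/eqP/rowP => k; rewrite mxE; have [->|k0] := eqVneq k ord0; first exact: y00.
by rewrite -y00 -(yE k) /sum_zero (negbTE k0).
Qed.

Lemma spread_scale i (a : R) y u : spread i (a *: y) u = a * spread i y u.
Proof.
case: u => [v|]; last by rewrite /= mxE.
rewrite /= mulr_sumr; apply: eq_bigr => k _; rewrite /sum_zero; case: ifP.
  by rewrite mulrN mulr_sumr; under eq_bigr do rewrite mxE.
by rewrite mxE.
Qed.

Lemma spread_pole i u : spread i (pole R d) u = (u == None)%:R.
Proof.
case: u => [v|]; last by rewrite /= mxE.
rewrite /= big1 // => k _; rewrite /sum_zero; case: eqVneq => k0.
  by rewrite big1 ?oppr0 // => j /negbTE j0; rewrite mxE j0 andbF.
by rewrite mxE (negbTE k0) andbF.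
Qed.

Lemma center_gt0 : 0 < center.
Proof. by rewrite invr_gt0 ltr0n. Qed.

Definition on_facet i (x : option V -> R) :=
  x None = 0 /\ forall u, u \notin cone_facet i -> x u = 0.

Lemma card_facet i : #|facet i| = d.+1.
Proof. by rewrite card_imset ?card_ord //; exact: e_inj. Qed.

Lemma on_facet_sum i x : on_facet i x -> \sum_u x u = \sum_k x (Some (e i k)).
Proof. by move=> [xN xi]; rewrite (sum_cone_facet xi) xN add0r. Qed.

Lemma facet_weight_ge0 i x : (forall u, 0 <= x u) -> 0 <= facet_weight i x.
Proof. by move=> x0; apply: prodr_ge0. Qed.

Lemma facet_weight_facet_sub i x : facet_weight i x != 0 -> facet i \subset base (supp x).
Proof.
move=> /prodf_neq0 xi; apply/fintype.subsetP => _ /imsetP[k _ ->].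
by rewrite !inE; exact: xi.
Qed.

Lemma facet_subE i j : facet i \subset facet j -> i = j.
Proof.
move=> ij; apply: facet_inj; apply/eqP.
by rewrite eqEcard ij !card_facet /=.
Qed.

(** The support contains the facet, and the only simplex of [K] containing it is the facet itself: a
    larger trace in [T] would put the facet in [T]. *)
Lemma facet_weight_on_facet i x : barycentric_points R K x -> facet_weight i x != 0 -> on_facet i x.
Proof.
move=> [_ _ xK] xi; have sub := facet_weight_facet_sub xi.
move: xK; rewrite -/(supp x) KE => /andP[_ /orP[bT|]].
  by move/negP: (facetT i); case; exact: T_closed bT sub.
move=> /andP[Nx /existsP[j /eqP bj]].
have ij : i = j by apply: facet_subE; rewrite -bj.
subst j; split; first by apply/eqP; move: Nx; rewrite inE negbK.
move=> [v|]; last by rewrite None_cone.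
by rewrite inE -bj !inE negbK => /eqP.
Qed.

Lemma on_facet_facet_weight i j x : on_facet i x -> facet_weight j x != 0 -> j = i.
Proof.
move=> [_ xi] xj; apply: facet_subE.
apply: fintype.subset_trans (facet_weight_facet_sub xj) _.
apply/fintype.subsetP => v; rewrite !inE; apply: contraR => vi.
by rewrite xi // inE.
Qed.

Lemma squash_pole i x : facet_weight i x = 0 -> squash i x = pole R d.
Proof.
move=> x0; apply/rowP => k; rewrite !mxE x0 mulr0 subr0 mul0r eqxx /=.
by case: ifP.
Qed.

Lemma squash_barycenter i x : barycentric_points R K x -> on_facet i x ->
  (forall k, k != ord0 -> x (Some (e i k)) = center) -> squash i x ord0 ord0 = -1.
Proof.
move=> [_ x1 _] xi xc; have x0c : x (Some (e i ord0)) = center.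
  have : \sum_k x (Some (e i k)) = \sum_(k < d.+1) center.
    by rewrite -on_facet_sum // x1 sumr_const card_ord -mulr_natr mulVf.
  rewrite (bigD1 ord0) //= [RHS](bigD1 ord0) //=.
  by rewrite (eq_bigr (fun=> center)) => [/addIr|].
have bc : facet_weight i x = center ^+ d.+1.
  rewrite /facet_weight (eq_bigr (fun=> center)) ?prodr_const ?card_ord //.
  by move=> k _; have [->//|] := eqVneq k ord0; exact: xc.
rewrite mxE eqxx bc divfK; first lra.
by rewrite expf_neq0 // gt_eqF // center_gt0.
Qed.

(** In the interior of the facet, the coordinates other than the first vanish only at the
    barycenter, where the first one is -1. *)
Lemma squash_neq0 i x : barycentric_points R K x -> squash i x != 0.
Proof.
move=> xK; have [x0|xi] := eqVneq (facet_weight i x) 0.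
  rewrite squash_pole //; apply/eqP => /rowP/(_ ord0).
  by rewrite !mxE eqxx /=; apply/eqP/oner_neq0.
apply/eqP => s0; have fi := facet_weight_on_facet xK xi.
have : squash i x ord0 ord0 = -1.
  apply: squash_barycenter => // k k0; move/rowP/(_ k): s0.
  rewrite !mxE (negbTE k0) => /eqP; rewrite mulf_eq0 (negbTE xi) /=.
  by rewrite subr_eq0 => /eqP.
by rewrite s0 mxE => /eqP; rewrite eq_sym oppr_eq0 oner_eq0.
Qed.

(** The formula holds at index 0 too, because the differences from [center] sum to zero over the
    facet. *)
Lemma spread_squash i x k : barycentric_points R K x -> on_facet i x ->
  spread i (squash i x) (Some (e i k)) = facet_weight i x * (x (Some (e i k)) - center).
Proof.
move=> [_ x1 _] xi; rewrite spread_facet /sum_zero; case: eqVneq => [->|k0]; last first.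
  by rewrite mxE (negbTE k0).
under eq_bigr => j j0 do rewrite mxE (negbTE j0).
rewrite -mulr_sumr -mulrN; congr (_ * _).
have : \sum_k (x (Some (e i k)) - center) = 0.
  rewrite big_split /= -on_facet_sum // x1 sumr_const card_ord -mulr_natr mulNr.
  by rewrite mulVf ?subrr.
by rewrite (bigD1 ord0) //= => /eqP; rewrite addr_eq0 => /eqP ->.
Qed.

Definition interp i x (t : R) (u : option V) : R :=
  (1 - t) * x u + t * spread i (squash i x) u.

Lemma interp_off i x t u : on_facet i x -> u \notin cone_facet i -> interp i x t u = 0.
Proof.
by move=> [_ xi] ui; rewrite /interp xi // spread_off // !mulr0 addr0.
Qed.

(** The segment from x to its image avoids the constants, so it can be projected. Equal values force
    x to be the barycenter unless t = 1 and x is on the boundary of the facet. At the barycenter the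
    apex value is - t while the facet values are (1 - t) * [center]; on the boundary with t = 1 they
    are 1 and 0. *)
Lemma interp_nonconstant i x t : barycentric_points R K x -> on_facet i x ->
  0 <= t -> t <= 1 -> exists k, interp i x t (Some (e i k)) != interp i x t None.
Proof.
move=> xK xi t0 t1; apply/existsP; apply: contraT; rewrite negb_exists => /forallP h; exfalso.
have [x0 x1 _] := xK; have [xN _] := xi.
have p0 := facet_weight_ge0 i x0; have c0 := center_gt0.
have q k : (1 - t + t * facet_weight i x) * x (Some (e i k)) =
    t * squash i x ord0 ord0 + t * facet_weight i x * center.
  have := h k; rewrite negbK /interp spread_squash // xN => /eqP e1.
  by rewrite mulr0 add0r in e1; rewrite -[t * squash i x _ _]e1; ring.
have [q0|q0] := eqVneq (1 - t + t * facet_weight i x) 0.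
  have tp : 0 <= t * facet_weight i x by rewrite mulr_ge0.
  have tE : t = 1 by lra.
  have b0 : facet_weight i x = 0 by move: q0; rewrite tE; lra.
  have := q ord0; rewrite q0 b0 squash_pole // tE mxE eqxx /=.
  by rewrite mul0r mulr0 mul0r addr0 mulr1 => /eqP; rewrite eq_sym oner_eq0.
have xc k : x (Some (e i k)) = center.
  have xx j : x (Some (e i j)) = x (Some (e i k)).
    by apply: (mulfI q0); rewrite !q.
  have := on_facet_sum xi; rewrite x1 (eq_bigr _ (fun j _ => xx j)).
  rewrite sumr_const card_ord -mulr_natr => xE; rewrite /center.
  by apply: (mulIf (_ : d.+1%:R != 0)); rewrite ?pnatr_eq0 // -xE mulVf // pnatr_eq0.
have := q ord0; rewrite xc squash_barycenter // => hq.
have : (1 - t) * center + t = 0 by lra.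
have : 0 <= (1 - t) * center by apply: mulr_ge0; [rewrite subr_ge0|exact: ltW].
move=> ge0 e0; have tE : t = 0 by lra.
by move: e0; rewrite tE; lra.
Qed.

Lemma interp_pole i x t u : facet_weight i x = 0 ->
  interp i x t u = (1 - t) * x u + t * (u == None)%:R.
Proof. by move=> x0; rewrite /interp squash_pole // spread_pole. Qed.

(** For a point of [K] this is the only facet whose interior contains it. *)
Definition active x : option 'I_N := [pick i | facet_weight i x != 0].

(** The homotopy from the identity at t = 0 to the composite through the wedge at t = 1: inside a
    facet the projected segment, elsewhere a segment to the apex, which is the image of the base
    point. *)
Definition track (x : option V -> R) (t : R) (u : option V) : R :=
  if active x is Some i then to_boundary i (interp i x t) u
  else (1 - t) * x u + t * (u == None)%:R.

Lemma sum_toward_apex (x : option V -> R) t : \sum_u x u = 1 ->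
  \sum_u ((1 - t) * x u + t * (u == None)%:R) = 1.
Proof.
move=> x1; rewrite big_split /= -!mulr_sumr x1 sum_option /= big1 //.
by rewrite addr0 !mulr1 subrK.
Qed.

Lemma toward_apex_ge0 (x : option V -> R) t u : (forall u, 0 <= x u) -> 0 <= t -> t <= 1 ->
  0 <= (1 - t) * x u + t * (u == None)%:R.
Proof. by move=> x0 t0 t1; rewrite addr_ge0 ?mulr_ge0 // subr_ge0. Qed.

(** These conditions are closed and cover [K], and on each of them the case split of [active]
    becomes a single formula. *)
Definition only i x := forall j, facet_weight j x != 0 -> j = i.

Lemma facet_weight_eq0 i x : facet_weight i x = 0 ->
  exists2 k, x (Some (e i k)) = 0 & Some (e i k) \in cone_facet i.
Proof.
by move=> /eqP/prodf_eq0[k _ /eqP xk]; exists k => //; exact: Some_cone.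
Qed.

Lemma interp_ge0 i x t u : barycentric_points R K x -> facet_weight i x = 0 ->
  0 <= t -> t <= 1 -> 0 <= interp i x t u.
Proof. by move=> [x0 _ _] bi t0 t1; rewrite interp_pole // toward_apex_ge0. Qed.

(** The two branches of [track] agree here: the squashed vector is the pole, so the segment runs
    towards the apex and keeps a zero coordinate on the facet, and the projection does nothing. *)
Lemma interp_boundary i x t u : barycentric_points R K x -> facet_weight i x = 0 ->
  0 <= t -> t <= 1 ->
  to_boundary i (interp i x t) u = (1 - t) * x u + t * (u == None)%:R.
Proof.
move=> xK bi t0 t1; have [x0 x1 _] := xK.
rewrite to_boundary_id ?interp_pole //; first by move=> v; exact: interp_ge0.
  by under eq_bigr do rewrite interp_pole //; exact: sum_toward_apex.
have [k xk ki] := facet_weight_eq0 bi.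
by exists (Some (e i k)); rewrite ?interp_pole // xk !mulr0 addr0.
Qed.

Lemma track_only i x t u : barycentric_points R K x -> only i x ->
  0 <= t -> t <= 1 -> track x t u = to_boundary i (interp i x t) u.
Proof.
move=> xK xi t0 t1; rewrite /track /active; case: pickP => [j /xi -> //|b0].
by rewrite interp_boundary //; exact/eqP/(negbFE (b0 i)).
Qed.

Lemma excess_interp_gt0 i x t : barycentric_points R K x -> 0 <= t -> t <= 1 ->
  0 < \sum_u excess i (interp i x t) u.
Proof.
move=> xK t0 t1; have [bi|bi] := eqVneq (facet_weight i x) 0; last first.
  have xi := facet_weight_on_facet xK bi.
  have [k kP] := interp_nonconstant xK xi t0 t1.
  apply: (excess_sum_gt0 _ (Some_cone i k) (None_cone i) kP) => u ui.
  by rewrite interp_off.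
have m0 : low_value i (interp i x t) = 0.
  apply: min_on_eq; first exact: None_cone.
    by move=> v _; exact: interp_ge0.
  have [k xk ki] := facet_weight_eq0 bi.
  by exists (Some (e i k)); rewrite ?interp_pole // xk !mulr0 addr0.
have [_ x1 _] := xK.
under eq_bigr do rewrite /excess m0 if_same subr0 interp_pole //.
by rewrite sum_toward_apex.
Qed.

Lemma activeP x i : barycentric_points R K x -> active x = Some i -> on_facet i x.
Proof.
rewrite /active => xK; case: pickP => // j xj [<-].
exact: facet_weight_on_facet.
Qed.

Lemma track_in x t : barycentric_points R K x -> 0 <= t -> t <= 1 ->
  barycentric_points R K (track x t).
Proof.
move=> xK t0 t1; case E : (active x) => [i|]; rewrite /track E.
  have xi := activeP xK E.
  have [k kP] := interp_nonconstant xK xi t0 t1.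
  apply: (to_boundary_in (u1 := Some (e i k)) (u2 := None)) => //.
  - by move=> u; exact: interp_off.
  - exact: Some_cone.
  - exact: None_cone.
have [x0 x1 xS] := xK.
(* Without an active facet the trace of the support is in [T], so the segment to the apex stays in
   the cone. *)
have bT : base (supp x) \in T.
  move: xS; rewrite KE => /andP[_ /orP[//|/andP[_ /existsP[i /eqP bi]]]].
  move: E; rewrite /active; case: pickP => // /(_ i)/negbFE/eqP b0 _; exfalso.
  move/eqP: b0 => /prodf_eq0[k _ /eqP xk].
  have : e i k \in facet i by apply/imsetP; exists k.
  by rewrite -bi !inE xk eqxx.
split.
- by move=> u; exact: toward_apex_ge0.
- exact: sum_toward_apex.
rewrite KE; apply/andP; split.
  apply/negP => /eqP s0; have := sum_toward_apex t x1; rewrite big1 => [|u _].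
    by move/eqP; rewrite eq_sym oner_eq0.
  by apply/eqP; move/setP/(_ u): s0; rewrite !inE => /negbFE.
apply/orP; left; apply: (T_closed bT); apply/fintype.subsetP => v.
by rewrite !inE /= mulr0 addr0 mulf_eq0 negb_or => /andP[].
Qed.

Section Continuity.
Variables (X : topologicalType) (f : X -> option V -> R) (t : X -> R) (a : X).
Hypothesis cf : forall u, {for a, continuous (fun y => f y u)}.
Hypothesis ct : {for a, continuous t}.

Lemma continuous_at_facet_weight i : {for a, continuous (fun y => facet_weight i (f y))}.
Proof. by rewrite /facet_weight; cont_real. Qed.

Lemma continuous_at_squash i k : {for a, continuous (fun y => squash i (f y) ord0 k)}.
Proof.
have cb := @continuous_at_facet_weight i.
rewrite (_ : (fun y => _) = fun y => if k == ord0
  then 1 - 2 / center ^+ d.+1 * facet_weight i (f y)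
  else facet_weight i (f y) * (f y (Some (e i k)) - center)).
  by cont_real.
by apply: funext => y; rewrite mxE.
Qed.

Lemma continuous_at_spread i (y : X -> vec) u :
  (forall k, {for a, continuous (fun z => y z ord0 k)}) ->
  {for a, continuous (fun z => spread i (y z) u)}.
Proof.
move=> cy; case: u => [v|]; last exact: cy.
by rewrite /spread /sum_zero; cont_real.
Qed.

Lemma continuous_at_interp i u : {for a, continuous (fun z => interp i (f z) (t z) u)}.
Proof.
have cs := @continuous_at_spread i (fun z => squash i (f z)) u (@continuous_at_squash i).
by rewrite /interp; cont_real.
Qed.

Lemma continuous_at_to_boundary i u : \sum_v excess i (f a) v != 0 ->
  {for a, continuous (fun z => to_boundary i (f z) u)}.
Proof.
move=> D0; have cm := @continuous_at_min_on R _ X (cone_facet i) None f a cf.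
by rewrite /to_boundary /excess /low_value; cont_real.
Qed.

End Continuity.

Section HomotopyEquivalence.
Variable i0 : 'I_N.
Local Notation W := (sphere_wedge R d N).
Local Notation basepoint := (sphere_base R d).
Local Notation X := (realization R K).

Definition sphere_inclusion (i : 'I_N) : sphere R d -> W :=
  @wedge_lift _ _ (fun=> basepoint) i.

Lemma sphere_inclusion_base i j : sphere_inclusion i basepoint = sphere_inclusion j basepoint.
Proof. exact: (@wedge_liftE _ _ (fun=> basepoint) j basepoint i basepoint). Qed.

Lemma bary_in (x : X) : barycentric_points R K (bary_coord x).
Proof. exact: set_mem (valP x). Qed.

Definition to_wedge (x : X) : W :=
  if active (bary_coord x) is Some i
  then sphere_inclusion i (to_sphere (squash i (bary_coord x)))
  else sphere_inclusion i0 basepoint.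

Lemma to_wedge_only i x : only i (bary_coord x) ->
  to_wedge x = sphere_inclusion i (to_sphere (squash i (bary_coord x))).
Proof.
move=> xi; rewrite /to_wedge /active; case: pickP => [j /xi -> //|b0].
rewrite squash_pole ?to_sphere_pole; first exact: sphere_inclusion_base.
exact/eqP/(negbFE (b0 i)).
Qed.

Definition only_set i : set X := [set x | only i (bary_coord x)].

(** The weights are nonnegative, so lying in the interior of no other facet is an inequality for one
    continuous sum. *)
Lemma only_setE i :
  only_set i = [set x | \sum_(j | j != i) facet_weight j (bary_coord x) <= 0].
Proof.
apply/seteqP; split=> x /= xi.
  rewrite big1 // => j ji; apply/eqP; apply: contraNT ji => bj.
  by apply/eqP; exact: xi.
move=> j bj; apply/eqP; apply: contraNT bj => ji.
have b0 k : 0 <= facet_weight k (bary_coord x) by apply: facet_weight_ge0; exact: bary_coord_ge0.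
have : \sum_(j | j != i) facet_weight j (bary_coord x) == 0.
  by rewrite eq_le xi sumr_ge0.
by rewrite psumr_eq0 // => /allP/(_ j (mem_index_enum _)); rewrite ji.
Qed.

Lemma only_set_closed i : closed (only_set i).
Proof.
rewrite only_setE; apply: closed_le_fun => x; last exact: continuous_at_cst.
apply: continuous_at_sum => j _.
by apply: continuous_at_facet_weight => u; exact: bary_coord_continuous.
Qed.

Lemma only_set_cover (x : X) : exists i, only_set i x.
Proof.
case E : (active (bary_coord x)) => [i|].
  exists i => j bj; have xi := activeP (bary_in x) E.
  exact: on_facet_facet_weight xi bj.
by exists i0 => j bj; move: E; rewrite /active; case: pickP => // /(_ j); rewrite bj.
Qed.

Lemma to_wedge_continuous : continuous to_wedge.
Proof.
apply: (@closed_cover_continuous _ _ _ only_set _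
  (fun i x => sphere_inclusion i (to_sphere (squash i (bary_coord x))))).
- exact: only_set_closed.
- exact: only_set_cover.
- move=> i x _; apply: (@continuous_comp _ _ _ (fun x : X =>
    to_sphere (squash i (bary_coord x))) (sphere_inclusion i)); last first.
    exact: wedge_lift_continuous.
  apply: to_sphere_continuous => [z|k z]; first by apply: squash_neq0; exact: bary_in.
  by apply: continuous_at_squash => u; exact: bary_coord_continuous.
- by move=> i x; exact: to_wedge_only.
Qed.

Lemma boundary_in i (y : sphere R d) :
  barycentric_points R K (to_boundary i (spread i (val y))).
Proof.
have [k kP] := spread_nonconstant i (sphere_neq0 (set_mem (valP y))).
by apply: (to_boundary_in _ (Some_cone i k) (None_cone i) kP) => u; exact: spread_off.
Qed.

Definition sphere_map i (y : sphere R d) : X := realize (boundary_in i y).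

Lemma sphere_mapE i y :
  bary_coord (sphere_map i y) = to_boundary i (spread i (val y)).
Proof. by []. Qed.

Lemma sphere_map_continuous i : continuous (sphere_map i).
Proof.
apply: realization_continuous => u y.
apply: (@continuous_at_to_boundary _ (fun y : sphere R d => spread i (val y))).
  by move=> v; apply: continuous_at_spread => k; exact: sphere_coord_continuous.
have [k kP] := spread_nonconstant i (sphere_neq0 (set_mem (valP y))).
rewrite gt_eqF //; apply: (excess_sum_gt0 _ (Some_cone i k) (None_cone i) kP) => v vi.
by rewrite spread_off.
Qed.

Lemma sphere_map_base i u : bary_coord (sphere_map i basepoint) u = (u == None)%:R.
Proof.
rewrite sphere_mapE /= to_boundary_id ?spread_pole //.
- by move=> v; rewrite spread_pole.
- under eq_bigr do rewrite spread_pole.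
  by rewrite sum_option /= big1 ?addr0.
- by exists (Some (e i ord0)); [exact: Some_cone|rewrite spread_pole].
Qed.

Lemma sphere_map_agree i j : sphere_map i basepoint = sphere_map j basepoint.
Proof. by apply: bary_coord_inj; apply: funext => u; rewrite !sphere_map_base. Qed.

Definition from_wedge : W -> X := wedge_fun sphere_map.

Lemma from_wedge_inclusion i y : from_wedge (sphere_inclusion i y) = sphere_map i y.
Proof. by apply: wedge_lift_funE => ? ?; exact: sphere_map_agree. Qed.

Lemma from_wedge_continuous : continuous from_wedge.
Proof.
apply: wedge_fun_continuous; first exact: sphere_map_continuous.
by move=> ? ?; exact: sphere_map_agree.
Qed.

(** The normalization in [to_sphere] disappears because [to_boundary] ignores positive factors. *)
Lemma from_to_wedge x : bary_coord (from_wedge (to_wedge x)) = track (bary_coord x) 1.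
Proof.
apply: funext => u; have xK := bary_in x.
rewrite /to_wedge /track; case: (active _) => [i|]; rewrite from_wedge_inclusion; last first.
  by rewrite sphere_map_base subrr mul0r add0r mul1r.
have s0 := squash_neq0 i xK; rewrite sphere_mapE to_sphereE // /normalize.
rewrite (_ : spread i _ = fun v => (Num.sqrt (\sum_k squash i (bary_coord x) ord0 k ^+ 2))^-1
    * spread i (squash i (bary_coord x)) v); last first.
  by apply: funext => v; rewrite spread_scale.
rewrite to_boundary_scale; last by rewrite invr_gt0 sqrtr_gt0 sum_sqr_gt0.
congr to_boundary; apply: funext => v.
by rewrite /interp subrr mul0r add0r mul1r.
Qed.

Lemma track0 x : barycentric_points R K x -> track x 0 = x.
Proof.
move=> xK; apply: funext => u; have [x0 x1 _] := xK.
rewrite /track; case E : (active x) => [i|]; last first.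
  by rewrite subr0 mul1r mul0r addr0.
rewrite (_ : interp i x 0 = x); last first.
  by apply: funext => v; rewrite /interp subr0 mul1r mul0r addr0.
apply: to_boundary_id => //; exists None; first exact: None_cone.
by have [] := activeP xK E.
Qed.

Lemma from_to_wedge_homotopic : homotopic R (from_wedge \o to_wedge) idfun.
Proof.
have c0 (t : R) : 0 <= 1 - clamp t by rewrite subr_ge0 clamp_le1.
have c1 (t : R) : 1 - clamp t <= 1 by rewrite gerBl clamp_ge0.
apply/homotopic_global.
exists (fun z => realize (track_in (bary_in z.1) (c0 z.2) (c1 z.2))); split; last 2 first.
- move=> x; apply: bary_coord_inj; rewrite realizeK /= from_to_wedge.
  by rewrite clamp0 subr0.
- by move=> x; apply: bary_coord_inj; rewrite realizeK /= clamp1 subrr track0 //; exact: bary_in.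
have cx u (z : X * R) : {for z, continuous (fun y : X * R => bary_coord y.1 u)}.
  apply: (@continuous_comp _ _ _ fst (fun x : X => bary_coord x u)); first exact: cvg_fst.
  exact: bary_coord_continuous.
have ct (z : X * R) : {for z, continuous (fun y : X * R => 1 - clamp y.2)}.
  cont_real; apply: (@continuous_comp _ _ _ snd (@clamp R)); first exact: cvg_snd.
  exact: clamp_continuous.
apply: realization_continuous => u.
apply: (@closed_cover_continuous _ _ _ (fun i => [set z : X * R | only_set i z.1]) _
  (fun i z => to_boundary i (interp i (bary_coord z.1) (1 - clamp z.2)) u)).
- move=> i; apply: (@closed_comp _ _ fst); last exact: only_set_closed.
  by move=> z _; exact: cvg_fst.
- by move=> z; exact: only_set_cover.
- move=> i z _.
  apply: (@continuous_at_to_boundary _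
    (fun z : X * R => interp i (bary_coord z.1) (1 - clamp z.2))).
    move=> v; apply: (@continuous_at_interp _ (fun z : X * R => bary_coord z.1)
      (fun z : X * R => 1 - clamp z.2)); [move=> w; exact: cx|exact: ct].
  by rewrite gt_eqF // excess_interp_gt0 //; exact: bary_in.
- by move=> i z zi; rewrite realizeK; apply: track_only => //; exact: bary_in.
Qed.

Lemma sphere_map_only i y : only i (bary_coord (sphere_map i y)).
Proof.
move=> j bj; apply: facet_subE; apply: fintype.subset_trans (facet_weight_facet_sub bj) _.
apply/fintype.subsetP => v; rewrite !inE; apply: contraR => vi.
have vc : Some v \notin cone_facet i by rewrite inE.
by rewrite sphere_mapE /to_boundary /excess (negbTE vc) subr0 spread_off // mul0r.
Qed.

(* The composite sphere self-map never sends a point to its antipode. *)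
Lemma squash_boundary_neq0 i (y : sphere R d) (t : R) : 0 <= t -> t <= 1 ->
  (1 - t) *: squash i (bary_coord (sphere_map i y)) + t *: val y != 0.
Proof.
move=> t0 t1; apply/eqP => /rowP eq0.
have eqk k : (1 - t) * squash i (bary_coord (sphere_map i y)) ord0 k
    + t * val y ord0 k = 0 by have := eq0 k; rewrite !mxE.
have y0 := sphere_neq0 (set_mem (valP y)).
have xK := bary_in (sphere_map i y).
move: xK eqk; set x := bary_coord _; set yy := val y => xK eqk.
pose D := \sum_u excess i (spread i yy) u.
have D0 : 0 < D.
  have [k kP] := spread_nonconstant i y0.
  apply: (excess_sum_gt0 _ (Some_cone i k) (None_cone i) kP) => v vi.
  by rewrite spread_off.
have xE u : x u = excess i (spread i yy) u / D by [].
(* If x is not interior to the facet then its image is the pole, so y could only be a negative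
   multiple of the pole; but that vector is sent to the barycenter of the facet. *)
have [bi|bi] := eqVneq (facet_weight i x) 0.
  have e0 := eqk ord0; have [k xk ki] := facet_weight_eq0 bi.
  have sk j : j != ord0 -> t * yy ord0 j = 0.
    move=> j0; have := eqk j; rewrite squash_pole // mxE (negbTE j0) andbF.
    by rewrite mulr0 add0r.
  move: e0; rewrite squash_pole // mxE !eqxx /= mulr1 => e0.
  have tN0 : t != 0 by apply/eqP => tE; move: e0; rewrite tE; lra.
  have yj j : j != ord0 -> yy ord0 j = 0.
    by move=> /sk/eqP; rewrite mulf_eq0 (negbTE tN0) => /eqP.
  have y00 : yy ord0 ord0 != 0.
    apply: contra_neq y0 => y00; apply/rowP => j; rewrite mxE.
    by have [->//|/yj] := eqVneq j ord0.
  have y0lt : yy ord0 ord0 < 0.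
    rewrite lt_neqAle y00 leNgt; apply/negP => ypos.
    have : 0 < t * yy ord0 ord0 by rewrite mulr_gt0 // lt_def tN0.
    by move=> pos; lra.
  have zk j : spread i yy (Some (e i j)) = 0.
    rewrite spread_facet /sum_zero; case: eqVneq => [_|/yj //].
    by rewrite big1 ?oppr0 // => l /yj.
  have mE : low_value i (spread i yy) = yy ord0 ord0.
    apply: min_on_eq; first exact: None_cone.
      by move=> u /cone_facetP[->//|[j ->]]; rewrite zk ltW.
    by exists None => //; exact: None_cone.
  move/eqP: xk; rewrite xE mulf_eq0 invr_eq0 (gt_eqF D0) orbF.
  by rewrite /excess ki zk mE sub0r oppr_eq0 (negbTE y00).
have xi := facet_weight_on_facet xK bi; have [xN _] := xi.
have mE : low_value i (spread i yy) = yy ord0 ord0.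
  move/eqP: xN; rewrite xE mulf_eq0 invr_eq0 (gt_eqF D0) orbF.
  by rewrite /excess None_cone subr_eq0 => /eqP/esym.
(* The apex attains the minimum, and the facet values of [spread] sum to zero. *)
have DE : D = - (d.+1%:R * yy ord0 ord0).
  rewrite /D (@sum_cone_facet i); last first.
    by move=> u ui; rewrite /excess (negbTE ui) spread_off // subr0.
  rewrite /excess None_cone mE subrr add0r.
  under eq_bigr do rewrite Some_cone spread_facet.
  rewrite big_split /= sum_sum_zero add0r sumrN sumr_const card_ord.
  by rewrite mulr_natl.
have y0lt : yy ord0 ord0 < 0.
  by move: D0; rewrite DE oppr_gt0 pmulr_rlt0 // ltr0n.
have xk k : x (Some (e i k)) - center = sum_zero yy k / D.
  rewrite xE /excess Some_cone spread_facet mE mulrBl.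
  have -> : yy ord0 ord0 / D = - center; last by rewrite opprK addrK.
  rewrite DE invrN mulrN invfM mulrCA mulfV ?mulr1 //.
  by rewrite lt_eqF.
have p0 : 0 < facet_weight i x.
  by rewrite lt_def bi facet_weight_ge0 //; exact: bary_coord_ge0.
(* Away from coordinate 0 the squashed vector is a positive multiple of y, so a vanishing
   combination forces y to vanish there. *)
have yk k : k != ord0 -> yy ord0 k = 0.
  move=> k0; have := eqk k; rewrite mxE (negbTE k0) xk /sum_zero (negbTE k0).
  have -> : (1 - t) * (facet_weight i x * (yy ord0 k / D)) + t * yy ord0 k =
    ((1 - t) * (facet_weight i x / D) + t) * yy ord0 k by ring.
  have q0 : 0 < facet_weight i x / D by exact: divr_gt0.
  move/eqP; rewrite mulf_eq0 => /orP[|/eqP //].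
  have [->|tN1] := eqVneq t 1; first by rewrite subrr mul0r add0r oner_eq0.
  have : 0 < (1 - t) * (facet_weight i x / D).
    by rewrite mulr_gt0 // subr_gt0 lt_neqAle tN1.
  by move=> pos; rewrite gt_eqF // ltr_wpDr.
(* Hence x is the barycenter, whose image has first coordinate -1; that of y is negative as well, so
   no combination is zero. *)
have := eqk ord0; rewrite squash_barycenter //; last first.
  by move=> k k0; apply/eqP; rewrite -subr_eq0 xk /sum_zero (negbTE k0) yk // mul0r.
have ty : t * yy ord0 ord0 <= 0 by rewrite mulr_ge0_le0 // ltW.
move=> h; have t1E : t = 1 by lra.
by move: h; rewrite t1E; lra.
Qed.

Lemma to_from_wedge_homotopic : homotopic R (to_wedge \o from_wedge) idfun.
Proof.
pose k i (t : R) (y : sphere R d) := to_sphere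
  ((1 - clamp t) *: squash i (bary_coord (sphere_map i y)) + clamp t *: val y).
(* The base point is fixed at all times, so the homotopies of the single spheres glue. *)
have kb i t : k i t basepoint = basepoint.
  rewrite /k squash_pole; last first.
    by rewrite /facet_weight (bigD1 ord0) //= sphere_map_base mul0r.
  by rewrite -scalerDl subrK scale1r to_sphere_pole.
apply/homotopic_global.
pose H t : W -> W := wedge_fun (fun i y => sphere_inclusion i (k i t y)).
have HE t i y : H t (sphere_inclusion i y) = sphere_inclusion i (k i t y).
  apply: (@wedge_lift_funE _ _ (fun=> basepoint) _
    (fun i y => sphere_inclusion i (k i t y))) => a b.
  by rewrite !kb; exact: sphere_inclusion_base.
have WE w : exists i y, w = sphere_inclusion i y.
  have : [set: W] w by [].
  by rewrite -wedgeTE => -[i _ [y _ <-]]; exists i, y.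
exists (fun z => H z.2 z.1); split; last 2 first.
- move=> w; have [i [y ->]] := WE w; rewrite /= HE from_wedge_inclusion.
  rewrite (to_wedge_only (@sphere_map_only i y)) /k clamp0 subr0 scale1r scale0r.
  by rewrite addr0.
- move=> w; have [i [y ->]] := WE w; rewrite /= HE.
  by rewrite /k clamp1 subrr scale0r add0r scale1r to_sphereK.
(* Joint continuity after gluing rests on the finite number of spheres and on closed base points. *)
have cH : continuous (uncurry (fun t : R => H t)).
  apply: (@wedge_fun_joint_continuous _ _ (fun=> basepoint) _ _
    (fun i t y => sphere_inclusion i (k i t y))).
  - exact: finite_finset.
  - move=> i; rewrite (_ : [set basepoint] = val @^-1` [set pole R d]); last first.
      apply/seteqP; split=> y /= => [->//|yp]; exact: val_inj.
    apply: (@closed_comp _ _ (@set_val _ (sphere R d))).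
      by move=> y _; exact: initial_continuous.
    exact/accessible_closed_set1/hausdorff_accessible/norm_hausdorff.
  - by move=> t a b; rewrite !kb; exact: sphere_inclusion_base.
  move=> i; pose ki (z : R * sphere R d) := to_sphere
    ((1 - clamp z.1) *: squash i (bary_coord (sphere_map i z.2)) + clamp z.1 *: val z.2).
  rewrite (_ : uncurry _ = sphere_inclusion i \o ki); last first.
    by apply: funext => -[].
  move=> z; apply: continuous_comp; last exact: wedge_lift_continuous.
  apply: to_sphere_continuous => [{}z|j {}z].
    by apply: squash_boundary_neq0; [exact: clamp_ge0|exact: clamp_le1].
  have ct : {for z, continuous (fun z : R * sphere R d => clamp z.1)}.
    by apply: (@continuous_comp _ _ _ fst (@clamp R)); [exact: cvg_fst|exact: clamp_continuous].
  have cs : {for z, continuous (fun z : R * sphere R d =>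
      squash i (bary_coord (sphere_map i z.2)) ord0 j)}.
    apply: (@continuous_at_squash _ (fun z : R * sphere R d => bary_coord (sphere_map i z.2))) => u.
    apply: (@continuous_comp _ _ _ snd (fun y => bary_coord (sphere_map i y) u)).
      exact: cvg_snd.
    apply: (@continuous_comp _ _ _ (sphere_map i) (fun x : X => bary_coord x u)).
      exact: sphere_map_continuous.
    exact: bary_coord_continuous.
  have cy : {for z, continuous (fun z : R * sphere R d => val z.2 ord0 j)}.
    apply: (@continuous_comp _ _ _ snd (fun y : sphere R d => val y ord0 j)).
      exact: cvg_snd.
    exact: sphere_coord_continuous.
  rewrite (_ : (fun x : R * sphere R d => _) = fun z : R * sphere R d =>
     (1 - clamp z.1) * squash i (bary_coord (sphere_map i z.2)) ord0 j
     + clamp z.1 * val z.2 ord0 j); first by cont_real.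
  by apply: funext => x; rewrite !mxE.
move=> z; apply: (@continuous_comp _ _ _ (fun z : W * R => (z.2, z.1))
  (uncurry (fun t : R => H t))); last exact: cH.
by apply: (@continuous_at_pair _ _ _ snd fst); [exact: cvg_snd|exact: cvg_fst].
Qed.

Lemma cone_wedge_homotopy_equivalent : homotopy_equivalent R X W.
Proof.
exists to_wedge, from_wedge; split.
- exact: to_wedge_continuous.
- exact: from_wedge_continuous.
- exact: from_to_wedge_homotopic.
- exact: to_from_wedge_homotopic.
Qed.

End HomotopyEquivalence.

End ConeWedge.

(** * Passing from a complex with two matchings to a cone with facets *)

Section CriticalCells.
Variables (R : realType) (V : finType) (K : simplicial_complex V).

Local Notation plain s := (finset.imset (@Some V) (mem (s : {set V}))).

Lemma base_plain (s : {set V}) : base (plain s) = s.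
Proof.
by apply/setP => v; rewrite inE mem_imset // => ? ? [].
Qed.

Lemma None_plain (s : {set V}) : None \notin plain s.
Proof. by apply/negP => /imsetP[]. Qed.

Lemma base_apex (s : {set V}) : base (None |: plain s) = s.
Proof.
by apply/setP => v; rewrite !inE /= mem_imset // => ? ? [].
Qed.

Lemma baseU1 v (s : {set option V}) : base (Some v |: s) = v |: base s.
Proof. by apply/setP => u; rewrite !inE. Qed.

Lemma baseS (s t : {set option V}) : s \subset t -> base s \subset base t.
Proof.
by move=> /fintype.subsetP st; apply/fintype.subsetP => v; rewrite !inE => /st.
Qed.

Lemma base_inj (s t : {set option V}) :
  (None \in s) = (None \in t) -> base s = base t -> s = t.
Proof.
move=> N /setP b; apply/setP => -[v|] //.
by have := b v; rewrite !inE.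
Qed.

Lemma base_eq0 (s : {set option V}) :
  s != finset.set0 -> None \notin s -> base s != finset.set0.
Proof.
move=> /set0Pn[[v vs _|Ns]]; last by rewrite Ns.
by apply/set0Pn; exists v; rewrite inE.
Qed.

Variables (d N : nat) (e : 'I_N -> 'I_d.+1 -> V) (i0 : 'I_N).
Variables (J : finType) (P : {set J}) (low : J -> {set V}) (w : J -> V) (rk : J -> nat).
Variables (Q : finType) (PQ : {set Q}) (lowQ : Q -> {set V}) (wQ : Q -> V)
  (rkQ : Q -> nat).
Local Notation up j := (w j |: low j).
Local Notation upQ q := (wQ q |: lowQ q).

(** The subcomplex T. The empty set is among its members, so that the apex alone is a simplex of
    [coned]. *)
Definition matched : {set {set V}} :=
  [set t : {set V} | [exists j in P, (t == low j) || (t == up j)]]%SET.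

Hypothesis matched_closed : forall s t : {set V}, s \in matched -> t \subset s -> t \in matched.
Hypothesis wlow : {in P, forall j, w j \notin low j}.
Hypothesis uplow : {in P &, forall i j, up i != low j}.
Hypothesis acyclic : {in P &, forall i j, i != j -> low i \subset up j -> (rk i < rk j)%N}.
Hypothesis wlowQ : {in PQ, forall j, wQ j \notin lowQ j}.
Hypothesis uplowQ : {in PQ &, forall i j, upQ i != lowQ j}.
Hypothesis acyclicQ :
  {in PQ &, forall i j, i != j -> lowQ i \subset upQ j -> (rkQ i < rkQ j)%N}.
Hypothesis lowQ_matched : {in PQ, forall q, lowQ q \notin matched}.
Hypothesis lowQ_facet : {in PQ, forall q i, lowQ q != facet e i}.
Hypothesis e_inj : forall i, injective (e i).
Hypothesis facet_inj : injective (facet e).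
Hypothesis facet_matched : forall i, facet e i \notin matched.
Hypothesis facet_proper : forall i (t : {set V}), t \proper facet e i -> t \in matched.
Hypothesis KE : forall s : {set V}, s != finset.set0 -> (s \in simplices K) =
  [|| s \in matched, [exists i, s == facet e i]
    | [exists q in PQ, (s == lowQ q) || (s == upQ q)]].

Definition ext_simplices : {set {set option V}} :=
  [set s : {set option V} | (None \notin s) && (base s \in simplices K)]%SET.

Lemma ext_simplices_neq0 : finset.set0 \notin ext_simplices.
Proof.
rewrite inE (_ : base finset.set0 = finset.set0) ?(negbTE (simplices_neq0 K)) ?andbF //.
by apply/setP => v; rewrite !inE.
Qed.

Lemma ext_simplices_closed (s t : {set option V}) : s \in ext_simplices -> t != finset.set0 ->
  t \subset s -> t \in ext_simplices.
Proof.
rewrite !inE => /andP[Ns bK] t0 ts.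
have Nt : None \notin t by apply: contra Ns; exact: (fintype.subsetP ts).
by rewrite Nt (simplices_closed bK) ?baseS // base_eq0.
Qed.

Definition ext := SimplicialComplex ext_simplices_neq0 ext_simplices_closed.

Definition coned_simplices : {set {set option V}} :=
  [set s : {set option V} | (s != finset.set0) &&
    ((base s \in matched) || (None \notin s) && (base s \in simplices K))]%SET.

Lemma coned_simplices_neq0 : finset.set0 \notin coned_simplices.
Proof. by rewrite inE eqxx. Qed.

Lemma coned_simplices_closed (s t : {set option V}) : s \in coned_simplices -> t != finset.set0 ->
  t \subset s -> t \in coned_simplices.
Proof.
rewrite inE => /andP[_ h] t0 ts; rewrite inE t0 /=; apply/orP.
case/orP: h => [bT|/andP[Ns bK]]; first by left; exact: matched_closed bT (baseS ts).
have Nt : None \notin t by apply: contra Ns; exact: (fintype.subsetP ts).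
by right; rewrite Nt (simplices_closed bK) ?baseS // base_eq0.
Qed.

Definition coned := SimplicialComplex coned_simplices_neq0 coned_simplices_closed.

Definition reduced_simplices : {set {set option V}} :=
  [set s : {set option V} | (s != finset.set0) && ((base s \in matched) ||
     (None \notin s) && [exists i, base s == facet e i])]%SET.

Lemma reduced_simplices_neq0 : finset.set0 \notin reduced_simplices.
Proof. by rewrite inE eqxx. Qed.

Lemma reduced_simplices_closed (s t : {set option V}) : s \in reduced_simplices -> t != finset.set0 ->
  t \subset s -> t \in reduced_simplices.
Proof.
rewrite inE => /andP[_ h] t0 ts; rewrite inE t0 /=; apply/orP.
case/orP: h => [bT|/andP[Ns /existsP[i /eqP bi]]].
  by left; exact: matched_closed bT (baseS ts).
have Nt : None \notin t by apply: contra Ns; exact: (fintype.subsetP ts).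
have := baseS ts; rewrite bi => bti.
have [bE|bE] := eqVneq (base t) (facet e i).
  by right; rewrite Nt; apply/existsP; exists i; rewrite bE.
by left; apply: (@facet_proper i); rewrite finset.properEneq bE.
Qed.

Definition reduced := SimplicialComplex reduced_simplices_neq0 reduced_simplices_closed.

(** The cells containing the apex are its joins with the members of T, the apex itself coming from
    the empty set. The matching of T pairs all of them, with unchanged ranks. *)
Lemma coned_ext : homotopy_equivalent R (realization R coned) (realization R ext).
Proof.
have upE j : Some (w j) |: (None |: plain (low j)) = None |: plain (up j).
  apply: base_inj; first by rewrite !inE.
  by rewrite baseU1 !base_apex.
apply: (@matching_homotopy_equivalent R _ J ext (fun j => None |: plain (low j))
  (fun j => Some (w j)) rk P).
- by move=> j _; apply/set0Pn; exists None; rewrite !inE.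
- move=> j jP; rewrite !inE /= mem_imset; first exact: wlow.
  by move=> ? ? [].
- by move=> j _; rewrite inE !inE eqxx.
- move=> i j iP jP; rewrite upE; apply/eqP => E.
  have := congr1 (@base V) E; rewrite !base_apex => /eqP; apply/negP; exact: uplow.
- move=> i j iP jP ij; rewrite upE => /baseS; rewrite !base_apex; exact: acyclic.
have reE t : (t \in simplices coned) = (t != finset.set0) &&
    ((base t \in matched) || (None \notin t) && (base t \in simplices K)) by rewrite inE.
move=> t; rewrite reE [t \in simplices ext]inE; apply/idP/idP.
  move=> /andP[t0 h]; have [Nt|Nt] := boolP (None \in t); last first.
    apply/orP; left; move: h; rewrite Nt /=.
    by case/orP=> [bT|//]; rewrite KE ?bT // base_eq0.
  rewrite Nt orbF inE in h; case/exists_inP: h => j jP tj.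
  apply/orP; right; apply/exists_inP; exists j => //; rewrite upE.
  case/orP: tj => /eqP tj; apply/orP; [left|right]; apply/eqP/base_inj;
    by rewrite ?base_apex // Nt !inE.
case/orP => [/andP[Nt bK]|/exists_inP[j jP tj]].
  rewrite Nt bK orbT andbT; apply/negP => /eqP t0; move: bK; rewrite t0.
  by have := ext_simplices_neq0; rewrite inE inE /= => /negbTE ->.
rewrite upE in tj; apply/andP; split.
  by apply/set0Pn; exists None; case/orP: tj => /eqP ->; rewrite !inE.
apply/orP; left; rewrite inE; apply/exists_inP; exists j => //.
by case/orP: tj => /eqP ->; rewrite base_apex eqxx ?orbT.
Qed.

(** The pairs of [PQ] avoid the apex; without them the cone over T and the critical facets
    remain. *)
Lemma coned_reduced : homotopy_equivalent R (realization R coned) (realization R reduced).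
Proof.
have upE q : Some (wQ q) |: plain (lowQ q) = plain (upQ q).
  apply: base_inj; first by rewrite !inE /= !(negbTE (None_plain _)).
  by rewrite baseU1 !base_plain.
(* The empty set is in T, being a proper subset of the facet of index [i0]. *)
have lowQ0 : {in PQ, forall q, lowQ q != finset.set0}.
  move=> q qP; apply: contraNneq (lowQ_matched qP) => ->.
  apply: (@facet_proper i0); rewrite finset.proper0; apply/set0Pn.
  by exists (e i0 ord0); apply/imsetP; exists ord0.
have plainK (s : {set V}) : s != finset.set0 -> plain s != finset.set0.
  by move=> /set0Pn[v vs]; apply/set0Pn; exists (Some v); apply/imsetP; exists v.
apply: (@matching_homotopy_equivalent R _ Q reduced (fun q => plain (lowQ q))
  (fun q => Some (wQ q)) rkQ PQ).
- by move=> q qP; apply: plainK; exact: lowQ0.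
- move=> j jP; rewrite mem_imset; first exact: wlowQ.
  by move=> ? ? [].
- move=> q qP; rewrite inE base_plain (negbTE (lowQ_matched qP)) None_plain /= andbC.
  apply/negP => /andP[/existsP[i fi] _]; move: fi; apply/negP; exact: lowQ_facet.
- move=> i j iP jP; rewrite upE; apply/eqP => E.
  have := congr1 (@base V) E; rewrite !base_plain => /eqP; apply/negP; exact: uplowQ.
- move=> i j iP jP ij; rewrite upE => /baseS; rewrite !base_plain; exact: acyclicQ.
have reE t : (t \in simplices coned) = (t != finset.set0) &&
    ((base t \in matched) || (None \notin t) && (base t \in simplices K)) by rewrite inE.
move=> t; rewrite reE [t \in simplices reduced]inE; apply/idP/idP.
  move=> /andP[t0 h]; rewrite t0 /=.
  case/orP: h => [-> //|/andP[Nt]]; rewrite KE ?base_eq0 //.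
  rewrite Nt /= => /or3P[->//|->|/exists_inP[q qP tq]]; first by rewrite orbT.
  apply/orP; right; apply/exists_inP; exists q => //; rewrite upE.
  case/orP: tq => /eqP tq; apply/orP; [left|right]; apply/eqP/base_inj;
    by rewrite ?base_plain // (negbTE Nt) (negbTE (None_plain _)).
case/orP => [/andP[t0]|/exists_inP[q qP tq]].
  rewrite t0 /= => /orP[->//|/andP[Nt bi]].
  by rewrite Nt /= KE ?base_eq0 // bi !orbT.
rewrite upE in tq; have q0 := lowQ0 q qP.
have uq0 : upQ q != finset.set0 by apply/set0Pn; exists (wQ q); rewrite !inE eqxx.
have bt : base t \in simplices K.
  by case/orP: tq => /eqP ->; rewrite base_plain KE //; apply/or3P; apply: Or33;
    apply/exists_inP; exists q; rewrite ?eqxx ?orbT.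
rewrite bt andbT; apply/andP; split.
  by case/orP: tq => /eqP ->; exact: plainK.
by apply/orP; right; case/orP: tq => /eqP ->; exact: None_plain.
Qed.

Lemma critical_cells_homotopy_equivalent :
  homotopy_equivalent R (realization R K) (sphere_wedge R d N).
Proof.
apply: homotopy_equivalent_trans
  (@extra_vertex_homotopy_equivalent R V K ext _) _.
  by move=> s; rewrite inE.
apply: homotopy_equivalent_trans (homotopy_equivalent_sym coned_ext) _.
apply: homotopy_equivalent_trans coned_reduced _.
apply: (@cone_wedge_homotopy_equivalent R V d N matched e reduced) => //.
by move=> s; rewrite inE.
Qed.

End CriticalCells.

(** * Graphs with large domination number *)

Section Edges.
Variable m : nat.
Local Notation n := m.+2.
Implicit Types (x y z t : 'I_n) (e f g : edge n).

Lemma pair_card_subproof x y : x != y -> #|[set x; y]%SET| == 2%N.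
Proof. by rewrite cards2 => ->. Qed.

Definition edge01 : edge n :=
  exist _ [set ord0; ord_max]%SET (@pair_card_subproof ord0 ord_max isT).

(* Meaningful only for distinct [x] and [y]. *)
Definition E x y : edge n := insubd edge01 [set x; y]%SET.

Lemma E_val x y : x <> y -> val (E x y) = [set x; y]%SET.
Proof.
move=> xy; rewrite val_insubd pair_card_subproof //.
exact/eqP.
Qed.

Lemma E_sym x y : E x y = E y x.
Proof. by rewrite /E finset.setUC. Qed.

Lemma edgeP e : exists x y, (x < y)%N /\ e = E x y.
Proof.
have /cards2P[x [y [xy eE]]] := valP e.
have [lt|gt|xy'] := ltngtP x y.
- by exists x, y; split=> //; apply: val_inj; rewrite E_val //; exact/eqP.
- exists y, x; split=> //; apply: val_inj; rewrite E_val; last first.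
    by apply/eqP; rewrite eq_sym.
  by rewrite finset.setUC.
- by move/val_inj: xy' xy => ->; rewrite eqxx.
Qed.

Lemma E_inj x y z t : E x y = E z t -> x <> y -> z <> t ->
  x = z /\ y = t \/ x = t /\ y = z.
Proof.
move=> EE xy zt; have : val (E x y) = val (E z t) by rewrite EE.
rewrite !E_val // => /setP xyzt {EE}.
have := xyzt x; have := xyzt y; have := xyzt z; have := xyzt t => {xyzt}.
rewrite !inE !eqxx ?orbT /= => h1 h2 h3 h4.
have {}h1 : (t == x) || (t == y) by rewrite h1.
have {}h2 : (z == x) || (z == y) by rewrite h2.
have {}h3 : (y == z) || (y == t) by rewrite -h3.
have {}h4 : (x == z) || (x == t) by rewrite -h4.
move: h1 h2 h3 h4 => /orP[]/eqP ? /orP[]/eqP ? /orP[]/eqP ? /orP[]/eqP ?;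
  by [congruence|left; split; congruence|right; split; congruence].
Qed.

Lemma neq_nat x y : x <> y -> x <> y :> nat.
Proof. by move=> xy /val_inj. Qed.

Lemma nat_neq x y : x <> y :> nat -> x <> y.
Proof. by move=> xy h; apply: xy; rewrite h. Qed.

Lemma lt_neq x y : (x < y)%N -> x <> y.
Proof. by move=> xy h; move: xy; rewrite h ltnn. Qed.

(** End points are natural numbers so that [lia] can compare edges; the smaller one is the sum of
    both minus the larger. *)
Definition hi e : nat := \max_(i in val e) i.
Definition lo e : nat := \sum_(i in val e) i - hi e.

Lemma hiE x y : x <> y -> hi (E x y) = maxn x y.
Proof.
move=> xy; rewrite /hi E_val // big_setU1 ?big_set1 // inE.
exact/eqP.
Qed.

Lemma loE x y : x <> y -> lo (E x y) = minn x y.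
Proof.
move=> xy; rewrite /lo hiE // E_val // big_setU1 ?big_set1 /=; first lia.
by rewrite inE; exact/eqP.
Qed.

Lemma lo_lt_hi e : (lo e < hi e)%N.
Proof.
have [x [y [xy ->]]] := edgeP e; have ne := lt_neq xy.
rewrite hiE // loE //; lia.
Qed.

Lemma hi_lt e : (hi e < n)%N.
Proof.
have [x [y [xy ->]]] := edgeP e; have ne := lt_neq xy.
have := ltn_ord x; have := ltn_ord y; rewrite hiE //; lia.
Qed.

Lemma edge_eq e f : lo e = lo f -> hi e = hi f -> e = f.
Proof.
have [x [y [xy ->]]] := edgeP e; have [z [t [zt ->]]] := edgeP f.
have ne := lt_neq xy; have ne' := lt_neq zt.
rewrite !hiE // !loE // => h1 h2; congr E; apply: val_inj => /=; lia.
Qed.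

Definition V_ (i : nat) : 'I_n := inord i.

Lemma V_K i : (i < n)%N -> V_ i = i :> nat.
Proof. exact: inordK. Qed.

End Edges.

Section Domination.
Variable m : nat.
Local Notation n := m.+2.
Implicit Types (a b c x y z u v : 'I_n) (s : graph n).

(** The vertices a, b, c are to be left out of a dominating set; a', b', c' stand for their
    neighbours in it and may coincide. *)
Definition spread_out a a' b b' c c' : Prop :=
  [/\ a <> b, a <> c & b <> c] /\
  [/\ [/\ a' <> a, a' <> b & a' <> c],
      [/\ b' <> a, b' <> b & b' <> c] &
      [/\ c' <> a, c' <> b & c' <> c]].

Definition tame s := forall a a' b b' c c', E a a' \in s -> E b b' \in s ->
  E c c' \in s -> spread_out a a' b b' c c' -> False.

Lemma adjacent_E s x y : x <> y -> adjacent_in s x y = (E x y \in s).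
Proof.
move=> xy; apply/exists_inP/idP => [[e es /eqP eE]|xys].
  by rewrite (_ : E x y = e) //; apply: val_inj; rewrite E_val.
by exists (E x y) => //; rewrite E_val.
Qed.

(* [tame] says that no dominating set misses three vertices [a], [b], [c]. *)
Lemma domination_tame s : (m <= domination_number s)%N <-> tame s.
Proof.
split=> [ms a a' b b' c c' eaa ebb ecc [[ab ac bc] [[aa1 aa2 aa3] [bb1 bb2 bb3] [cc1 cc2 cc3]]]|ts].
  (* This set has m - 1 elements, and the primed vertices show that it dominates. *)
  pose D := (~: [set a; b; c])%SET.
  have nn (i j : 'I_n) : i <> j -> (i == j) = false by move=> h; exact/eqP.
  have cD : (#|D| < m)%N.
    have := cardsC [set a; b; c]%SET; rewrite card_ord -/D => h.
    have : #|[set a; b; c]%SET| = 3.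
      by rewrite finset.setUC cardsU1 cards2 !inE ![c == _]eq_sym !nn.
    by move=> h3; rewrite h3 in h; lia.
  have domD : dominates D s.
    apply/forall_inP => v; rewrite !inE negbK -orbA.
    have mD u : u <> a -> u <> b -> u <> c -> u \in D.
      by move=> h1 h2 h3; rewrite !inE !nn.
    case/or3P => /eqP ->; apply/exists_inP.
    - by exists a'; [exact: mD|rewrite adjacent_E //; exact/nesym].
    - by exists b'; [exact: mD|rewrite adjacent_E //; exact/nesym].
    - by exists c'; [exact: mD|rewrite adjacent_E //; exact/nesym].
  move: ms; rewrite /domination_number; case: arg_minnP => [|D' _ /(_ D domD)].
    exact: dominates_setT.
  by move=> h1 /leq_trans/(_ h1); rewrite leqNgt cD.
rewrite /domination_number; case: arg_minnP => [|D domD _]; first exact: dominates_setT.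
rewrite leqNgt; apply/negP => Dm.
(* A set with fewer than m of the m + 2 vertices leaves out at least three. *)
have /card_gt2P[a [b [c [[aD bD cD] [ab bc ca]]]]] : (2 < #|~: D|)%N.
  by have := cardsC D; rewrite card_ord; lia.
have nb u : u \in (~: D)%SET -> exists2 u', u' \in D & adjacent_in s u u'.
  by rewrite inE => uD; have /exists_inP[u' u'D uu'] := forall_inP domD u uD; exists u'.
have [a' a'D aa'] := nb a aD; have [b' b'D bb'] := nb b bD.
have [c' c'D cc'] := nb c cD.
have ne u v : u \in (~: D)%SET -> v \in D -> v <> u.
  by rewrite inE => uD vD vu; move: uD; rewrite -vu vD.
have ne' u v : u != v -> u <> v by move/eqP.
rewrite adjacent_E in aa'; last by apply/nesym/ne.
rewrite adjacent_E in bb'; last by apply/nesym/ne.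
rewrite adjacent_E in cc'; last by apply/nesym/ne.
apply: (ts a a' b b' c c') => //; split.
  by split; [exact: ne'|apply/nesym/ne'|exact: ne'].
by split; split; apply: ne.
Qed.

End Domination.

Ltac split_cases :=
  repeat match goal with
  | H : _ /\ _ |- _ => destruct H
  | H : [/\ _, _ & _] |- _ => destruct H
  | H : [/\ _, _, _ & _] |- _ => destruct H
  | H : _ \/ _ |- _ => destruct H; try congruence
  | H : [\/ _, _ | _] |- _ => destruct H; try congruence
  | H : [\/ _, _, _ | _] |- _ => destruct H; try congruence
  end.

Ltac by_neq :=
  unfold spread_out;
  repeat match goal with
  | |- _ /\ _ => split
  | |- [/\ _, _ & _] => split
  end; congruence.

(** * Triangles, paths and 4-cycles in tame graphs *)

Section TameGraphs.
Variable m : nat.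
Local Notation n := m.+2.
Implicit Types (x y z t u v : 'I_n) (s : graph n) (e f g h : edge n).

Definition distinct3 x y z : Prop := [/\ x <> y, x <> z & y <> z].

Definition distinct4 x y z t : Prop :=
  [/\ distinct3 x y z, x <> t, y <> t & z <> t].

Definition has_triangle s : Prop := exists x y z,
  distinct3 x y z /\ [/\ E x y \in s, E y z \in s & E z x \in s].

Definition has_path s : Prop := exists x y z t,
  distinct4 x y z t /\ [/\ E x y \in s, E y z \in s & E z t \in s].

(** In the forbidden pattern each edge contains exactly one of a, b, c, so its three edges
    differ. *)
Lemma tame_small s : (#|s| <= 2)%N -> tame s.
Proof.
move=> s2 a a' b b' c c' ea eb ec H.
suff : (2 < #|s|)%N by rewrite ltnNge s2.
unfold spread_out in H; apply/card_gt2P; exists (E a a'), (E b b'), (E c c').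
split_cases; split=> //; split; apply/eqP => h; have := E_inj h;
  move=> [|||]; try congruence; intros; split_cases; congruence.
Qed.

(** The vertices a, b, c would exhaust the triangle and leave no place for a'. *)
Lemma tame_triangle s x y z : distinct3 x y z ->
  (forall e, e \in s -> [\/ e = E x y, e = E y z | e = E z x]) -> tame s.
Proof.
move=> D sE a a' b b' c c' /sE ea /sE eb /sE ec H.
have vert (u v : 'I_n) : [\/ E u v = E x y, E u v = E y z | E u v = E z x] ->
  u <> v -> (u = x \/ u = y \/ u = z) /\ (v = x \/ v = y \/ v = z).
  case: D => xy xz yz huv uv.
  have res p q : E u v = E p q -> p <> q -> u = p /\ v = q \/ u = q /\ v = p.
    by move=> h; exact: E_inj h uv.
  by case: huv => /res h; have [] := h ltac:(congruence); move=> [-> ->]; tauto.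
have := vert a a' ea; have := vert b b' eb; have := vert c c' ec.
clear - H; unfold spread_out in H; split_cases; intros.
have A1 : a <> a' by congruence.
have A2 : b <> b' by congruence.
have A3 : c <> c' by congruence.
repeat match goal with H : ?x <> ?x' -> _ |- _ =>
  first [specialize (H A1) | specialize (H A2) | specialize (H A3)] end.
split_cases.
Qed.

(** If a, b, c are three of the four vertices then a', b', c' are all the fourth, which has at most
    two neighbours. *)
Lemma tame_cycle s x y z t : distinct4 x y z t ->
  (forall e, e \in s -> [\/ e = E x y, e = E y z, e = E z t | e = E t x]) -> tame s.
Proof.
move=> D sE a a' b b' c c' /sE ea /sE eb /sE ec H.
have vert (u v : 'I_n) : [\/ E u v = E x y, E u v = E y z, E u v = E z t | E u v = E t x] ->
  u <> v ->
  ((u = x \/ u = z) /\ (v = y \/ v = t)) \/ ((v = x \/ v = z) /\ (u = y \/ u = t)).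
  case: D => -[xy xz yz] xt yt zt huv uv.
  have res p q : E u v = E p q -> p <> q -> u = p /\ v = q \/ u = q /\ v = p.
    by move=> h; exact: E_inj h uv.
  by case: huv => /res h; have [] := h ltac:(congruence); move=> [-> ->]; tauto.
unfold spread_out, distinct4, distinct3 in *.
have := vert a a' ea; have := vert b b' eb; have := vert c c' ec.
clear - H D; intros A3 A2 A1; split_cases.
have {}A1 := A1 ltac:(congruence).
have {}A2 := A2 ltac:(congruence).
have {}A3 := A3 ltac:(congruence).
split_cases.
Qed.

(** A third edge at x makes a claw, and an edge disjoint from the path a, x, b is excluded too. The
    edge from a to b closes a triangle; any other one prolongs the path. *)
Lemma tame_two_adjacent s x a b h : tame s -> E x a \in s -> E x b \in s -> h \in s ->
  h <> E x a -> h <> E x b -> distinct3 x a b -> has_triangle s \/ has_path s.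
Proof.
have [c [d [/lt_neq cd ->]]] := edgeP h.
move=> ts xas xbs cds n1 n2 [xa xb ab].
have one c' d' : E c' d' \in s -> E c' d' <> E x a -> E c' d' <> E x b ->
    c' <> d' -> c' = x \/ (c' = a \/ c' = b) /\ d' <> x ->
    has_triangle s \/ has_path s.
  move=> cds' m1 m2 cd' h1.
  have [db|db] := pselect (d' = b).
    have c'a : c' = a by case: h1 => [?|[[|]]]; congruence.
    subst; left; exists x, a, b; do 2!split=> //.
    by rewrite E_sym.
  have [da|da] := pselect (d' = a).
    have c'a : c' = b by case: h1 => [?|[[|]]]; congruence.
    subst; left; exists x, a, b; split; first by split.
    by split=> //; rewrite E_sym.
  case: h1 => [c'x|[[c'a|c'b] dx]]; subst c'.
  - by exfalso; apply: (ts a x b x d' x); rewrite ?[E _ x]E_sym //;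
      by_neq.
  - right; exists d', a, x, b; split; last by split; rewrite // E_sym.
    by split; first split; congruence.
  - right; exists d', b, x, a; split; last by split; rewrite // E_sym.
    by split; first split; congruence.
have dcs : E d c \in s by rewrite E_sym.
have m1 : E d c <> E x a by rewrite E_sym.
have m2 : E d c <> E x b by rewrite E_sym.
have oc := one c d cds n1 n2 cd; have od := one d c dcs m1 m2 (nesym cd).
have [cx|cx] := pselect (c = x); first by apply: oc; left.
have [dx|dx] := pselect (d = x); first by apply: od; left.
have [ca|ca] := pselect (c = a); first by apply: oc; right; split=> //; left.
have [cb|cb] := pselect (c = b); first by apply: oc; right; split=> //; right.
have [da|da] := pselect (d = a); first by apply: od; right; split=> //; left.
have [db|db] := pselect (d = b); first by apply: od; right; split=> //; right.
exfalso; apply: (ts a x b x c d); rewrite ?[E _ x]E_sym //.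
by by_neq.
Qed.

Lemma adjacent_or_disjoint e f : e <> f ->
  (exists x a b, [/\ e = E x a, f = E x b & distinct3 x a b]) \/
  (exists a b c d, [/\ e = E a b, f = E c d & distinct4 a b c d]).
Proof.
have [a [b [/lt_neq ab ->]]] := edgeP e; have [c [d [/lt_neq cd ->]]] := edgeP f => ne.
have [ac|ac] := pselect (a = c).
  subst c; left; exists a, b, d; split=> //.
  by split=> //; congruence.
have [ad|ad] := pselect (a = d).
  subst d; left; exists a, b, c; split=> //; first exact: E_sym.
  have bc : b <> c by move=> bc; apply: ne; rewrite bc E_sym.
  by split; congruence.
have [bc|bc] := pselect (b = c).
  subst c; left; exists b, a, d; split=> //; first exact: E_sym.
  have ad' : a <> d by move=> ad'; apply: ne; rewrite ad' E_sym.
  by split; congruence.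
have [bd|bd] := pselect (b = d).
  subst d; left; exists b, a, c; split; rewrite 1?E_sym //.
  by split; congruence.
by right; exists a, b, c, d.
Qed.

(** Three pairwise disjoint edges are the forbidden pattern, so two of any three edges share a
    vertex. *)
Lemma tame_three s : tame s -> (2 < #|s|)%N -> has_triangle s \/ has_path s.
Proof.
move=> ts /card_gt2P[e [f [g [[es fs gs] [/eqP ef /eqP fg /eqP ge]]]]].
have adj p q r : p \in s -> q \in s -> r \in s -> r <> p -> r <> q ->
  (exists x a b, [/\ p = E x a, q = E x b & distinct3 x a b]) ->
  has_triangle s \/ has_path s.
  move=> ps qs rs pq qr [x [a [b [pE qE d3]]]].
  subst p q; exact: tame_two_adjacent ts ps qs rs pq qr d3.
have [h|[a [b [c [d [eE fE [[ab ac bc] ad bd cd]]]]]]] := adjacent_or_disjoint ef.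
  exact: adj es fs gs ge (nesym fg) h.
have [h|[c1 [d1 [p [q [fE' gE [[cd1 c1p d1p] c1q d1q pq]]]]]]] := adjacent_or_disjoint fg.
  exact: adj fs gs es ef (nesym ge) h.
have [h|[p1 [q1 [a1 [b1 [gE' eE' [[h1 h2 h3] h4 h5 h6]]]]]]] := adjacent_or_disjoint ge.
  exact: adj gs es fs fg (nesym ef) h.
exfalso; apply: (ts a b c d p q); rewrite -?eE -?fE -?gE //.
have E1 : E c d = E c1 d1 by rewrite -fE.
have E2 : E p q = E p1 q1 by rewrite -gE.
have E3 : E a b = E a1 b1 by rewrite -eE.
have := E_inj E1 cd cd1; have := E_inj E2 pq h1; have := E_inj E3 ab h6.
clear - ab ac bc ad bd cd cd1 c1p d1p c1q d1q pq h1 h2 h3 h4 h5 h6.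
by move=> A B C; unfold spread_out; split_cases; by_neq.
Qed.

Section Positions.
Variables (s : graph n) (ts : tame s).

Lemma no_star a b c u : distinct3 a b c -> u <> a -> u <> b -> u <> c ->
  E b a \in s -> E c a \in s -> E u a \in s -> False.
Proof.
move=> [ab ac bc] ua ub uc ba ca uas; apply: (ts ba ca uas).
by by_neq.
Qed.

Lemma no_far_edge a b c u v : distinct3 a b c -> u <> v ->
  u <> a -> u <> b -> u <> c -> v <> a -> v <> b -> v <> c ->
  E a b \in s -> E c b \in s -> E u v \in s -> False.
Proof.
move=> [ab ac bc] uv h1 h2 h3 h4 h5 h6 h7 h8 h9; apply: (ts h7 h8 h9).
by by_neq.
Qed.

(** A further edge either meets the triangle in one vertex and makes a claw, or misses it and is
    excluded by [no_far_edge]. *)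
Lemma tame_triangle_only x y z : distinct3 x y z ->
  E x y \in s -> E y z \in s -> E z x \in s ->
  s = [set E x y; E y z; E z x]%SET.
Proof.
move=> D xys yzs zxs; apply/setP => e; rewrite !inE; apply/idP/idP; last first.
  by case/orP => [/orP[]|] /eqP ->.
have [u [v [/lt_neq uv ->]]] := edgeP e => es; apply: contraT => ne; exfalso.
have [n1 n2 n3] : [/\ E u v <> E x y, E u v <> E y z & E u v <> E z x].
  by move: ne; rewrite !negb_or => /andP[/andP[/eqP ? /eqP ?] /eqP ?].
have m1 : E v u <> E x y by rewrite E_sym.
have m2 : E v u <> E y z by rewrite E_sym.
have m3 : E v u <> E z x by rewrite E_sym.
have yxs : E y x \in s by rewrite E_sym.
have zys : E z y \in s by rewrite E_sym.
have xzs : E x z \in s by rewrite E_sym.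
have vus : E v u \in s by rewrite E_sym.
have [xy xz yz] := D.
have Dx : distinct3 x y z by split.
have Dy : distinct3 y x z by split; congruence.
have Dz : distinct3 z x y by split; congruence.
have sx := @no_star x y z ^~ Dx; have sy := @no_star y x z ^~ Dy.
have sz := @no_star z x y ^~ Dz; have far := @no_far_edge x y z u v Dx uv.
have [ux|ux] := pselect (u = x); [|have [uy|uy] := pselect (u = y);
  [|have [uz|uz] := pselect (u = z)]];
  (have [vx|vx] := pselect (v = x); [|have [vy|vy] := pselect (v = y);
  [|have [vz|vz] := pselect (v = z)]]);
  subst; try congruence; eauto.
Qed.

(** A new edge at an inner vertex, chords included, makes a claw. An edge from an end to a new
    vertex is excluded by [tip], an edge disjoint from the path by [no_far_edge]. *)
Lemma tame_path_sub x y z t h : distinct4 x y z t ->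
  E x y \in s -> E y z \in s -> E z t \in s -> h \in s ->
  [\/ h = E x y, h = E y z, h = E z t | h = E t x].
Proof.
move=> [[xy xz yz] xt yt zt] xys yzs zts.
have [u [v [/lt_neq uv ->]]] := edgeP h => es.
have [?|n1] := pselect (E u v = E x y); first by constructor 1.
have [?|n2] := pselect (E u v = E y z); first by constructor 2.
have [?|n3] := pselect (E u v = E z t); first by constructor 3.
have [?|n4] := pselect (E u v = E t x); first by constructor 4.
exfalso.
have yxs : E y x \in s by rewrite E_sym.
have zys : E z y \in s by rewrite E_sym.
have tzs : E t z \in s by rewrite E_sym.
have vus : E v u \in s by rewrite E_sym.
have m1 : E v u <> E x y by rewrite E_sym.
have m2 : E v u <> E y z by rewrite E_sym.
have m3 : E v u <> E z t by rewrite E_sym.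
have m4 : E v u <> E t x by rewrite E_sym.
have tip a b c d w : distinct4 a b c d -> w <> a -> w <> b -> w <> c -> w <> d ->
    E b a \in s -> E d c \in s -> E w a \in s -> False.
  move=> [[ab ac bc] ad bd cd] wa wb wc wd ba dc was; apply: (ts was ba dc).
  by by_neq.
have Dy : distinct3 y x z by split; congruence.
have Dz : distinct3 z y t by split; congruence.
have Dxyz : distinct3 x y z by split.
have Dx4 : distinct4 x y z t by split.
have Dt4 : distinct4 t z y x by split; first split; congruence.
have sy := @no_star y x z ^~ Dy; have sz := @no_star z y t ^~ Dz.
have tx := @tip x y z t ^~ Dx4; have tt := @tip t z y x ^~ Dt4.
have far := @no_far_edge x y z u v Dxyz uv.
have [ux|ux] := pselect (u = x); [|have [uy|uy] := pselect (u = y);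
  [|have [uz|uz] := pselect (u = z); [|have [ut|ut] := pselect (u = t)]]];
  (have [vx|vx] := pselect (v = x); [|have [vy|vy] := pselect (v = y);
  [|have [vz|vz] := pselect (v = z); [|have [vt|vt] := pselect (v = t)]]]);
  subst; try congruence; eauto.
Qed.

End Positions.

End TameGraphs.

(** * The contractible subcomplex *)

Section TreeMatching.
Variable m : nat.
Local Notation n := m.+2.
Implicit Types (e f g : edge n).

(* In the link of the edge {i, k} with i < k, restricted to the vertices below
   k, the matched paths form a tree rooted at the edge {i, root i}. *)
Definition root (i : nat) : nat := (i == 0)%N.

Lemma rootP i : (i = 0 /\ root i = 1 \/ 0 < i /\ root i = 0)%N.
Proof. by case: i => [|i]; [left|right]. Qed.

(** A pair of edges is always written with f below e, so that e carries the largest vertex k of the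
    pair. *)
Definition below e f : bool :=
  (hi f < hi e)%N || (hi f == hi e) && (lo f < lo e)%N.

Definition stem e f : bool :=
  (lo f == minn (lo e) (root (lo e))) && (hi f == maxn (lo e) (root (lo e))).

(** Let e = {i, k} with i < k and r = [root i]. The value is the parent of f in the tree whose root
    is the stem {i, r}: the parent of {j, k} is {i, j}, that of {i, j} is {j, r}, that of {r, j} is
    {i, r}, and that of {a, b} with a < b, missing i, r and k, is {i, b}. In the first case e, f and
    the parent form a triangle, in the others a path starting with k, i. *)
Definition third e f : nat * nat :=
  if hi f == hi e then (lo e, lo f)
  else if lo f == lo e then (hi f, root (lo e))
  else if hi f == lo e then (lo f, root (lo e))
  else if (lo f == root (lo e)) || (hi f == root (lo e)) then (lo e, root (lo e))
  else (lo e, hi f).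

(** Codes for the lower cells of the matching: the empty set, single edges, and pairs of edges. *)
Definition cell := option (edge n * option (edge n)).

Definition lower_cells : {set cell} := [set j : cell | match j with
  | None => true
  | Some (e, None) => (1 < hi e)%N
  | Some (e, Some f) => below e f && ~~ stem e f end]%SET.

Definition low_cell (j : cell) : {set edge n} := match j with
  | None => finset.set0
  | Some (e, None) => [set e]%SET
  | Some (e, Some f) => [set e; f]%SET end.

Definition partner (j : cell) : edge n := match j with
  | None => E (V_ m 0) (V_ m 1)
  | Some (e, None) => E (V_ m (lo e)) (V_ m (root (lo e)))
  | Some (e, Some f) => E (V_ m (third e f).1) (V_ m (third e f).2) end.

(** One layer for each largest vertex. Within it the values 1 to 4 increase from a parent to its
    children, and 0 belongs to the single edge, which is matched with its stem; five values per
    layer explain the factor 5. *)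
Definition rank (j : cell) : nat := match j with
  | None => 0
  | Some (e, None) => 5 * hi e
  | Some (e, Some f) => 5 * hi e +
    (if hi f == hi e then 4
     else if (lo f == lo e) || (hi f == lo e) then 2
     else if (lo f == root (lo e)) || (hi f == root (lo e)) then 1
     else 3) end.

Lemma edge_V a b : (a < n)%N -> (b < n)%N -> a <> b ->
  hi (E (V_ m a) (V_ m b)) = maxn a b /\ lo (E (V_ m a) (V_ m b)) = minn a b.
Proof.
move=> an bn ab; have ne : V_ m a <> V_ m b.
  by move=> /(congr1 (@nat_of_ord _)); rewrite !V_K.
by rewrite hiE // loE // !V_K.
Qed.

Lemma edge01E : hi (E (V_ m 0) (V_ m 1)) = 1%N /\ lo (E (V_ m 0) (V_ m 1)) = 0%N.
Proof. by have [-> ->] := @edge_V 0 1 isT isT (O_S 0). Qed.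

Lemma stemE e : (1 < hi e)%N ->
  hi (partner (Some (e, None))) = maxn (lo e) (root (lo e)) /\
  lo (partner (Some (e, None))) = minn (lo e) (root (lo e)).
Proof.
move=> h; have l := lo_lt_hi e; have h' := hi_lt e.
by apply: edge_V; have := rootP (lo e); lia.
Qed.

Definition stem_of e f := partner (Some (e, Some f)).

(** The cases of [third] in terms of end points, a form in which [lia] can combine two of them. In
    the notation used there, f is {j, k}, {i, j}, {r, j}, or misses i, r and k. *)
Lemma partnerP e f : below e f -> ~~ stem e f ->
  [\/ [/\ hi f = hi e, lo f < lo e, hi (stem_of e f) = lo e, lo (stem_of e f) = lo f
        & rank (Some (e, Some f)) = 5 * hi e + 4],
      hi f < hi e /\ exists j, [/\ j <> root (lo e), j <> lo e, lo f = minn (lo e) j,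
         hi f = maxn (lo e) j & [/\ hi (stem_of e f) = maxn j (root (lo e)),
           lo (stem_of e f) = minn j (root (lo e))
         & rank (Some (e, Some f)) = 5 * hi e + 2]],
      hi f < hi e /\ exists j, [/\ j <> root (lo e), j <> lo e,
         lo f = minn (root (lo e)) j,
         hi f = maxn (root (lo e)) j & [/\ hi (stem_of e f) = maxn (lo e) (root (lo e)),
           lo (stem_of e f) = minn (lo e) (root (lo e))
         & rank (Some (e, Some f)) = 5 * hi e + 1]]
   | hi f < hi e /\ [/\ lo f <> lo e, hi f <> lo e, lo f <> root (lo e), hi f <> root (lo e)
       & [/\ hi (stem_of e f) = maxn (lo e) (hi f),
          lo (stem_of e f) = minn (lo e) (hi f)
         & rank (Some (e, Some f)) = 5 * hi e + 3]]]%N.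
Proof.
rewrite /stem_of /below /stem /partner /third /rank => bef nst.
have r := rootP (lo e); have l := lo_lt_hi e; have h := hi_lt e.
have lf := lo_lt_hi f; have hf := hi_lt f.
have [hh|hh] := eqVneq (hi f) (hi e).
  have ll : (lo f < lo e)%N by lia.
  constructor 1; have [|||-> ->] := @edge_V (lo e) (lo f); [lia..|].
  by split=> //; lia.
have hlt : (hi f < hi e)%N by lia.
have [ll|ll] := eqVneq (lo f) (lo e).
  constructor 2; split=> //; exists (hi f).
  have hr : hi f <> root (lo e) by lia.
  have [|||-> ->] /= := @edge_V (hi f) (root (lo e)); [lia..|].
  by do 2?split=> //; lia.
have [hl|hl] := eqVneq (hi f) (lo e).
  constructor 2; split=> //; exists (lo f).
  have hr : lo f <> root (lo e) by lia.
  have [|||-> ->] /= := @edge_V (lo f) (root (lo e)); [lia..|].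
  by do 2?split=> //; lia.
have [lr|lr] := eqVneq (lo f) (root (lo e)).
  constructor 3; split=> //; exists (hi f).
  have [|||-> ->] /= := @edge_V (lo e) (root (lo e)); [lia..|].
  by do 2?split=> //; lia.
have [hr|hr] := eqVneq (hi f) (root (lo e)).
  constructor 3; split=> //; exists (lo f).
  have [|||-> ->] /= := @edge_V (lo e) (root (lo e)); [lia..|].
  by do 2?split=> //; lia.
constructor 4; split=> //.
have [|||-> ->] /= := @edge_V (lo e) (hi f); [lia..|].
by do 2?split=> //; lia.
Qed.

Lemma edge_neq e f : lo e <> lo f \/ hi e <> hi f -> e != f.
Proof. by move=> h; apply/eqP => ef; rewrite ef in h; lia. Qed.

Lemma below_neq e f : below e f -> e <> f.
Proof. by rewrite /below => bef ef; move: bef; rewrite ef; lia. Qed.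

Lemma below_total e f : e <> f -> below e f \/ below f e.
Proof.
move=> ef; have ne : lo e <> lo f \/ hi e <> hi f.
  have [l|l] := eqVneq (lo e) (lo f); last by left; exact/eqP.
  have [h|h] := eqVneq (hi e) (hi f); last by right; exact/eqP.
  by case: ef; exact: edge_eq.
by rewrite /below; lia.
Qed.

Lemma below_hi e f : below e f -> (hi f <= hi e)%N /\ (1 < hi e)%N.
Proof.
have l := lo_lt_hi e; have lf := lo_lt_hi f.
by rewrite /below; lia.
Qed.

Lemma stem_partner e f : (1 < hi e)%N -> stem e f = (f == partner (Some (e, None))).
Proof.
move=> h; have [hp lp] := stemE h; apply/idP/eqP => [/andP[/eqP l /eqP h']|->].
  by apply: edge_eq; rewrite ?hp ?lp.
by rewrite /stem hp lp !eqxx.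
Qed.

Lemma partner_notin : {in lower_cells, forall j, partner j \notin low_cell j}.
Proof.
case=> [[e [f|]]|]; rewrite !inE //=.
- move=> /andP[bef nst]; rewrite negb_or -/(stem_of e f).
  have [h1 h2] := below_hi bef; have le := lo_lt_hi e; have r := rootP (lo e).
  have lf := lo_lt_hi f.
  have P : (lo (stem_of e f) <> lo e \/ hi (stem_of e f) <> hi e) /\
           (lo (stem_of e f) <> lo f \/ hi (stem_of e f) <> hi f).
    have [] := partnerP bef nst.
    - by move=> [h3 h4 h5 h6 _]; lia.
    - by move=> [h3 [j [h4 h5 h6 h7 [h8 h9 _]]]]; lia.
    - by move=> [h3 [j [h4 h5 h6 h7 [h8 h9 _]]]]; lia.
    - by move=> [h3 [h4 h5 h6 h7 [h8 h9 _]]]; lia.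
  by case: P => P1 P2; apply/andP; split; exact: edge_neq.
- move=> h; apply: edge_neq; have [h1 h2] := stemE h.
  have := lo_lt_hi e; have := rootP (lo e).
  by move: h1 h2 => /= -> ->; lia.
Qed.

Lemma rank_pair e f : below e f -> ~~ stem e f ->
  [/\ hi (stem_of e f) <= hi e, 5 * hi e < rank (Some (e, Some f))
    & rank (Some (e, Some f)) <= 5 * hi e + 4]%N.
Proof.
move=> bef nst; have l := lo_lt_hi e; have r := rootP (lo e).
have [h1 h2] := below_hi bef.
have [] := partnerP bef nst.
- by move=> [h3 h4 h5 h6 ->]; split; lia.
- by move=> [h3 [j [h4 h5 h6 h7 [h8 h9 ->]]]]; split; lia.
- by move=> [h3 [j [h4 h5 h6 h7 [h8 h9 ->]]]]; split; lia.
- by move=> [h3 [h4 h5 h6 h7 [h8 h9 ->]]]; split; lia.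
Qed.

Lemma partner_single e : (1 < hi e)%N -> (hi (partner (Some (e, None))) < hi e)%N.
Proof.
by move=> h; have [-> _] := stemE h; have := lo_lt_hi e; have := rootP (lo e); lia.
Qed.

(** The parent never contains the largest vertex, so as the top edge of a pair it puts the pair in
    an earlier layer. The pair of e' and the parent has a smaller value in the tree of e'. The pair
    of f' and the parent stays in the layer only for a triangle, and then has a value below 4. *)
Lemma rank_partner_pair e f e' f' : below e f -> ~~ stem e f ->
  below e' f' -> ~~ stem e' f' ->
  (e = e' /\ f = stem_of e' f') \/ (e = stem_of e' f' /\ f = e') \/
  (e = f' /\ f = stem_of e' f') \/ (e = stem_of e' f' /\ f = f') ->
  (rank (Some (e, Some f)) < rank (Some (e', Some f')))%N.
Proof.
move=> bef nst bef' nst' H.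
have l := lo_lt_hi e; have lf := lo_lt_hi f; have l' := lo_lt_hi e'.
have lf' := lo_lt_hi f'.
have r := rootP (lo e); have r' := rootP (lo e').
have [h1 h2 h3] := rank_pair bef' nst'; have [_ g2 g3] := rank_pair bef nst.
have [k1 k2] := below_hi bef; have [k1' k2'] := below_hi bef'.
have nst0 : ~ (lo f = minn (lo e) (root (lo e)) /\ hi f = maxn (lo e) (root (lo e))).
  by move=> [E1 E2]; move: nst; rewrite /stem E1 E2 !eqxx.
(* A smaller largest vertex means an earlier layer; what follows concerns pairs in the same
   layer. *)
have [lt|ge] := ltnP (hi e) (hi e'); first by lia.
have bef0 : (hi f < hi e \/ hi f = hi e /\ lo f < lo e)%N.
  by move: bef; rewrite /below; lia.
case: H => [[E1 E2]|[[E1 E2]|[[E1 E2]|[E1 E2]]]]; first last.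
- have [e1 e2] : hi e = hi (stem_of e' f') /\ lo e = lo (stem_of e' f') by rewrite E1.
  have [e3 e4] : hi f = hi f' /\ lo f = lo f' by rewrite E2.
  clear - e1 e2 e3 e4 bef0 ge h1 bef' nst' r' k1' l l' lf lf'.
  have [] := partnerP bef' nst'.
  + by move=> [h3 h4 h5 h6 _]; lia.
  + by move=> [h3 [j [h4 h5 h6 h7 [h8 h9 _]]]]; lia.
  + by move=> [h3 [j [h4 h5 h6 h7 [h8 h9 _]]]]; lia.
  + by move=> [h3 [h4 h5 h6 h7 [h8 h9 _]]]; lia.
- have [e1 e2] : hi e = hi f' /\ lo e = lo f' by rewrite E1.
  have [e3 e4] : hi f = hi (stem_of e' f') /\ lo f = lo (stem_of e' f') by rewrite E2.
  have p := partnerP bef nst; have p' := partnerP bef' nst'.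
  clear - e1 e2 e3 e4 bef0 ge h1 p p' r r' k1' l l' lf lf' nst0.
  case: p' => [[h3 h4 h5 h6 ->]|[h3 [j [h4 h5 h6 h7 [h8 h9 _]]]]|[h3 [j [h4 h5 h6 h7 [h8 h9 _]]]]|[h3 [h4 h5 h6 h7 [h8 h9 _]]]]; try lia.
  case: p => [[q3 q4 q5 q6 ->]|[q3 [j [q4 q5 q6 q7 [q8 q9 ->]]]]|[q3 [j [q4 q5 q6 q7 [q8 q9 ->]]]]|[q3 [q4 q5 q6 q7 [q8 q9 ->]]]]; lia.
- have [e1 e2] : hi e = hi (stem_of e' f') /\ lo e = lo (stem_of e' f') by rewrite E1.
  have [e3 e4] : hi f = hi e' /\ lo f = lo e' by rewrite E2.
  clear - e1 e2 e3 e4 bef0 ge h1 bef' nst' r' k1' l l' lf lf'.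
  have [] := partnerP bef' nst'.
  + by move=> [h3 h4 h5 h6 _]; lia.
  + by move=> [h3 [j [h4 h5 h6 h7 [h8 h9 _]]]]; lia.
  + by move=> [h3 [j [h4 h5 h6 h7 [h8 h9 _]]]]; lia.
  + by move=> [h3 [h4 h5 h6 h7 [h8 h9 _]]]; lia.
subst e'.
have [e3 e4] : hi f = hi (stem_of e f') /\ lo f = lo (stem_of e f') by rewrite E2.
have p := partnerP bef nst; have p' := partnerP bef' nst'.
clear - e3 e4 bef0 ge h1 p p' r k1' l lf lf' nst0.
case: p' => [[h3 h4 h5 h6 ->]|[h3 [j [h4 h5 h6 h7 [h8 h9 ->]]]]|[h3 [j [h4 h5 h6 h7 [h8 h9 ->]]]]|[h3 [h4 h5 h6 h7 [h8 h9 ->]]]];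
case: p => [[q3 q4 q5 q6 ->]|[q3 [i [q4 q5 q6 q7 [q8 q9 ->]]]]|[q3 [i [q4 q5 q6 q7 [q8 q9 ->]]]]|[q3 [q4 q5 q6 q7 [q8 q9 ->]]]]; lia.
Qed.

End TreeMatching.

Section TreeComplex.
Variable m : nat.
Local Notation n := m.+2.
Implicit Types (e f g : edge n).
Local Notation lower_cells := (lower_cells m).
Local Notation up_cell j := (partner j |: low_cell j).
Local Notation tree := (matched lower_cells (@low_cell m) (@partner m)).

Lemma lower_single e : (Some (e, None) \in lower_cells) = (1 < hi e)%N.
Proof. by rewrite inE. Qed.

Lemma lower_pair e f : (Some (e, Some f) \in lower_cells) = below e f && ~~ stem e f.
Proof. by rewrite inE. Qed.

Lemma partner_hi e o : Some (e, o) \in lower_cells -> (hi (partner (Some (e, o))) <= hi e)%N.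
Proof.
case: o => [f|]; first by rewrite lower_pair => /andP[bef nst]; have [] := rank_pair bef nst.
by rewrite lower_single => h; apply/ltnW/partner_single.
Qed.

Lemma acyclic_cells : {in lower_cells &, forall i j, i != j ->
  low_cell i \subset up_cell j -> (rank i < rank j)%N}.
Proof.
move=> [[e [f|]]|] [[e' o']|] // iP jP ij; last first.
- move=> _; have le := lo_lt_hi e'; case: o' jP ij => [f'|] /=; last by lia.
  by rewrite lower_pair => /andP[bef nst] _; have [] := rank_pair bef nst; rewrite /=; lia.
- rewrite /= finset.setU0 finset.sub1set inE => /eqP eE.
  move: iP; rewrite lower_single eE /=.
  by have [-> _] := edge01E m.
- move: iP; rewrite lower_single /= finset.sub1set => he.
  have ph := partner_hi jP; rewrite !inE => h.
  have {h} [|[ee|hlt]] : e = e' \/ (hi e < hi e')%N \/ (o' <> None /\ (hi e <= hi e')%N).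
  + have [->|ne] := eqVneq e e'; first by left.
    right; case: o' jP ij ph h => [f'|] jP ij ph /= h.
      right; split=> //; move: jP; rewrite lower_pair => /andP[bef nst].
      have [h1 _] := below_hi bef.
      by move: h; rewrite !inE (negbTE ne) /= => /orP[] /eqP ->.
    left; move: h; rewrite !inE (negbTE ne) orbF => /eqP ->.
    by apply: partner_single; rewrite -lower_single.
  + move=> ee; subst e'; case: o' jP ij {ph} => [f'|] jP ij; last by rewrite eqxx in ij.
    by move: jP; rewrite lower_pair => /andP[bef nst]; have [] := rank_pair bef nst.
  + case: o' jP {ij ph} => [f'|] jP; last by rewrite /=; lia.
    move: jP; rewrite lower_pair => /andP[bef nst]; have [_ r1 _] := rank_pair bef nst.
    by move: r1 => /=; lia.
  + case: hlt; case: o' jP {ij ph} => [f'|] // jP _ hlt.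
    move: jP; rewrite lower_pair => /andP[bef nst]; have [_ r1 _] := rank_pair bef nst.
    by move: r1 => /=; lia.
- move: iP; rewrite lower_pair => /andP[bef nst].
  rewrite /= finset.setU0 => /subset_leq_card; rewrite cards1 cards2.
  by have := below_neq bef => /eqP ->.
- move: iP; rewrite lower_pair => /andP[bef nst].
  move=> /fintype.subsetP sub; have := sub e; have := sub f; rewrite !inE !eqxx ?orbT.
  move=> /(_ isT) fin /(_ isT) ein {sub}.
  case: o' jP ij fin ein => [f'|] jP ij /=; rewrite !inE => fin ein; last first.
    exfalso; move: jP; rewrite lower_single => h'; have ps := partner_single h'.
    have [k1 k2] := below_hi bef; have ne := below_neq bef.
    have sp := stem_partner f h'; rewrite /= in sp ps.
    case/orP: ein => /eqP eE; case/orP: fin => /eqP fE.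
    - by apply: ne; rewrite eE fE.
    - by move: k1; rewrite eE fE; lia.
    - by move: nst; rewrite eE sp fE eqxx.
    - by apply: ne; rewrite eE fE.
  move: jP; rewrite lower_pair => /andP[bef' nst'].
  have ne := below_neq bef.
  have [[ee ff]|nee] := pselect (e = e' /\ f = f'); first by rewrite ee ff eqxx in ij.
  apply: rank_partner_pair => //.
  have contra : ~ (e = f' /\ f = e').
    by move=> [h1 h2]; move: bef bef'; rewrite h1 h2 /below; clear; lia.
  move: fin ein => /or3P[] /eqP fE /or3P[] /eqP eE; rewrite /stem_of; tauto || (exfalso; congruence).
Qed.

(** By cardinality only two coincidences are possible. They are ruled out because {0, 1} is not a
    lower cell and a lower pair never consists of an edge and its stem. *)
Lemma up_cell_neq : {in lower_cells &, forall i j, up_cell i != low_cell j}.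
Proof.
move=> i j iP jP; apply/eqP => EE.
have c1 : (#|up_cell i| = #|low_cell i|.+1)%N by rewrite cardsU1 partner_notin.
have cj : #|low_cell i|.+1 = #|low_cell j| by rewrite -c1 EE.
have c2 o e f : Some (e, Some f) \in lower_cells -> #|low_cell (Some (e, Some f))| = o -> o = 2%N.
  by rewrite lower_pair => /andP[/below_neq/eqP ef _] <-; rewrite /= cards2 ef.
case: i iP EE cj {c1} => [[e [f|]]|] iP EE.
- rewrite (c2 _ _ _ iP erefl); case: j jP EE => [[e' [f'|]]|] jP EE.
  + by rewrite (c2 _ _ _ jP erefl).
  + by rewrite /= cards1.
  + by rewrite /= cards0.
- rewrite /= cards1; case: j jP EE => [[e' [f'|]]|] jP EE; rewrite /= ?cards1 ?cards0 // => _.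
  move: jP iP; rewrite lower_pair lower_single => /andP[bef nst] h.
  have ps := partner_single h; have sp := stem_partner _ h.
  have [k1 k2] := below_hi bef; have ne := below_neq bef.
  have : e' \in up_cell (Some (e, None)) by rewrite EE !inE eqxx.
  have : f' \in up_cell (Some (e, None)) by rewrite EE !inE eqxx orbT.
  rewrite !inE => /orP[] /eqP fE /orP[] /eqP eE.
  + by apply: ne; rewrite eE fE.
  + by move: nst; rewrite eE sp fE eqxx.
  + by move: ps k1; rewrite eE fE /=; lia.
  + by apply: ne; rewrite eE fE.
- rewrite /= cards0; case: j jP EE => [[e' [f'|]]|] jP EE; rewrite /= ?cards0 //.
  + by rewrite -/(low_cell (Some (e', Some f'))) (c2 _ _ _ jP erefl).
  + move=> _; move: jP; rewrite lower_single.
    have : E (V_ m 0) (V_ m 1) \in low_cell (Some (e', None)).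
      by rewrite -EE /= !inE eqxx.
    rewrite /= inE => /eqP <-.
    by have [-> _] := edge01E m.
Qed.

(** T contains the whole 1-skeleton: a pair of edges is a lower cell, or, if f is the stem of e, the
    upper cell of e. *)
Lemma small_tree (t : {set edge n}) : (#|t| <= 2)%N -> t \in tree.
Proof.
move=> t2; rewrite inE.
have : #|t| = 0%N \/ #|t| = 1%N \/ #|t| = 2%N by lia.
case=> [/eqP|[/eqP|/eqP]].
- rewrite cards_eq0 => /eqP ->; apply/exists_inP; exists None; first by rewrite inE.
  by rewrite eqxx.
- move=> /cards1P[e ->]; have [h|h] := ltnP 1 (hi e).
    by apply/exists_inP; exists (Some (e, None)); rewrite ?lower_single // eqxx.
  apply/exists_inP; exists None; first by rewrite inE.
  apply/orP; right; rewrite /= finset.setU0; apply/eqP; congr finset.set1.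
  have [h1 h2] := edge01E m; have l := lo_lt_hi e.
  by apply: edge_eq; rewrite ?h1 ?h2; lia.
move=> /cards2P[x [y [xy tE]]].
have {xy tE} [e [f [bef ->]]] : exists e f, below e f /\ t = [set e; f]%SET.
  have [b|b] := below_total (elimN eqP xy); first by exists x, y.
  by exists y, x; rewrite finset.setUC.
have [st|nst] := boolP (stem e f); last first.
  apply/exists_inP; exists (Some (e, Some f)); first by rewrite lower_pair bef.
  by rewrite eqxx.
have [_ h] := below_hi bef.
apply/exists_inP; exists (Some (e, None)); first by rewrite lower_single.
apply/orP; right; apply/eqP; move: st; rewrite stem_partner // => /eqP ->.
by rewrite finset.setUC.
Qed.

Lemma tree_card (s : {set edge n}) : s \in tree -> (#|s| <= 3)%N.
Proof.
have l2 j : (#|low_cell j| <= 2)%N.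
  by case: j => [[e [f|]]|] /=; rewrite ?cards2 ?cards1 ?cards0 //; case: (_ == _).
rewrite inE => /exists_inP[j jP /orP[] /eqP ->]; first by apply: leqW; exact: l2.
rewrite cardsU1; case: (_ \notin _); first exact: l2.
by apply: leqW; exact: l2.
Qed.

(** Proper faces have at most two edges. *)
Lemma tree_closed (s t : {set edge n}) : s \in tree -> t \subset s -> t \in tree.
Proof.
move=> sT ts; have [->//|ne] := eqVneq t s.
apply: small_tree; have s3 := tree_card sT.
have : (#|t| < #|s|)%N by apply: proper_card; rewrite finset.properEneq ne.
by lia.
Qed.

Lemma tree_three (s : {set edge n}) : s \in tree -> (2 < #|s|)%N ->
  exists e f, [/\ below e f, ~~ stem e f & s = stem_of e f |: [set e; f]%SET].
Proof.
rewrite inE => /exists_inP[[[e [f|]]|] jP /orP[] /eqP ->] /=; rewrite ?cards2 ?cards1 ?cards0 //.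
- by case: (_ == _).
- by move: jP; rewrite lower_pair => /andP[bef nst] _; exists e, f.
- by case: (_ == _).
- by rewrite finset.setU0 cards1.
Qed.

End TreeComplex.

(** * Three-edge paths inside and outside T *)

Section Paths.
Variable m : nat.
Local Notation n := m.+2.
Implicit Types (e f g : edge n) (x y z t : 'I_n).
Local Notation tree := (matched (lower_cells m) (@low_cell m) (@partner m)).

Definition path_edges x y z t : {set edge n} := [set E x y; E y z; E z t]%SET.

Definition cycle_edges x y z t : {set edge n} := E t x |: path_edges x y z t.

(* Every path on four vertices has exactly one orientation with its largest
   vertex in the first half. *)
Definition oriented x y z t : bool :=
  [&& [&& x != y, x != z & y != z], [&& x != t, y != t & z != t] &
      (maxn z t < maxn x y)%N].

Lemma oriented_distinct x y z t : oriented x y z t -> distinct4 x y z t.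
Proof.
by move=> /and3P[/and3P[/eqP ? /eqP ? /eqP ?] /and3P[/eqP ? /eqP ? /eqP ?] _].
Qed.

Lemma orientedE x y z t : distinct4 x y z t -> oriented x y z t = (maxn z t < maxn x y)%N.
Proof.
by move=> [[/eqP xy /eqP xz /eqP yz] /eqP xt /eqP yt /eqP zt]; rewrite /oriented xy xz yz xt yt zt.
Qed.

Lemma distinct4_nat x y z t : distinct4 x y z t ->
  [/\ x <> y :> nat, x <> z :> nat & y <> z :> nat] /\
  [/\ x <> t :> nat, y <> t :> nat & z <> t :> nat].
Proof. by move=> [[h1 h2 h3] h4 h5 h6]; split; split; exact: neq_nat. Qed.

Lemma path_edges_rev x y z t : path_edges x y z t = path_edges t z y x.
Proof.
apply/setP => e; rewrite !inE [E t z]E_sym [E z y]E_sym [E y x]E_sym.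
by case: (e == E x y); case: (e == E y z); case: (e == E z t).
Qed.

Lemma cycle_edges_rot x y z t : cycle_edges x y z t = cycle_edges y z t x.
Proof.
apply/setP => e; rewrite !inE.
by case: (e == E t x); case: (e == E x y); case: (e == E y z); case: (e == E z t).
Qed.

Lemma cycle_edges_rev x y z t : cycle_edges x y z t = cycle_edges z y x t.
Proof.
apply/setP => e; rewrite !inE [E z y]E_sym [E y x]E_sym [E x t]E_sym [E t z]E_sym.
by case: (e == E t x); case: (e == E x y); case: (e == E y z); case: (e == E z t).
Qed.

Lemma path_edges_sub x y z t x' y' z' t' : distinct4 x y z t -> distinct4 x' y' z' t' ->
  path_edges x y z t \subset path_edges x' y' z' t' ->
  [/\ x = x', y = y', z = z' & t = t'] \/ [/\ x = t', y = z', z = y' & t = x'].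
Proof.
move=> [[xy xz yz] xt yt zt] [[xy' xz' yz'] xt' yt' zt'] /fintype.subsetP sub.
have res u v : u <> v -> E u v \in path_edges x y z t ->
  ((u = x' /\ v = y') \/ (u = y' /\ v = x')) \/
  ((u = y' /\ v = z') \/ (u = z' /\ v = y')) \/
  ((u = z' /\ v = t') \/ (u = t' /\ v = z')).
  move=> uv /sub; rewrite !inE => /orP[/orP[]|] /eqP h.
  - by left; exact: (E_inj h uv xy').
  - by right; left; exact: (E_inj h uv yz').
  - by right; right; exact: (E_inj h uv zt').
have := res _ _ xy; have := res _ _ yz; have := res _ _ zt.
rewrite !inE !eqxx ?orbT => /(_ isT) h1 /(_ isT) h2 /(_ isT) h3.
clear - h1 h2 h3 xy xz yz xt yt zt xy' xz' yz' xt' yt' zt'.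
by split_cases; first [left; split; congruence | right; split; congruence].
Qed.

Lemma oriented_inj x y z t x' y' z' t' : oriented x y z t -> oriented x' y' z' t' ->
  path_edges x y z t \subset path_edges x' y' z' t' ->
  (x, y, z, t) = (x', y', z', t').
Proof.
move=> o o' sub; have d := oriented_distinct o; have d' := oriented_distinct o'.
have [[-> -> -> ->] //|[ex ey ez et]] := path_edges_sub d d' sub.
by move: o o'; rewrite !orientedE // ex ey ez et; lia.
Qed.

(** A 4-cycle contains only one path whose second vertex is the largest and whose first is its
    smaller neighbour. So the pairs of a path and its cycle do not interact. *)
Lemma path_in_cycle x y z t x' y' z' t' : distinct4 x y z t -> distinct4 x' y' z' t' ->
  (maxn z t < y)%N -> (x < z)%N -> (maxn z' t' < y')%N -> (x' < z')%N ->
  path_edges x y z t \subset cycle_edges x' y' z' t' ->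
  (x, y, z, t) = (x', y', z', t').
Proof.
move=> [[xy xz yz] xt yt zt] [[xy' xz' yz'] xt' yt' zt'] my xz0 my' xz0' /fintype.subsetP sub.
have res u v : u <> v -> E u v \in path_edges x y z t ->
  ((u = x' /\ v = y') \/ (u = y' /\ v = x')) \/
  ((u = y' /\ v = z') \/ (u = z' /\ v = y')) \/
  ((u = z' /\ v = t') \/ (u = t' /\ v = z')) \/
  ((u = t' /\ v = x') \/ (u = x' /\ v = t')).
  move=> uv /sub; rewrite !inE => /orP[|/orP[/orP[]|]] /eqP h.
  - by right; right; right; exact: (E_inj h uv (nesym xt')).
  - by left; exact: (E_inj h uv xy').
  - by right; left; exact: (E_inj h uv yz').
  - by right; right; left; exact: (E_inj h uv zt').
have := res _ _ xy; have := res _ _ yz; have := res _ _ zt.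
rewrite !inE !eqxx ?orbT => /(_ isT) h1 /(_ isT) h2 /(_ isT) h3.
clear - h1 h2 h3 xy xz yz xt yt zt xy' xz' yz' xt' yt' zt' my xz0 my' xz0'.
split_cases; subst; first [congruence | exfalso; lia].
Qed.

Lemma E_neq x y z t : x <> y -> z <> t -> (x <> z /\ x <> t) \/ (y <> z /\ y <> t) ->
  E x y != E z t.
Proof.
move=> xy zt H; apply/eqP => /E_inj/(_ xy zt) h; clear - H h; by split_cases; congruence.
Qed.

Lemma card_path_edges x y z t : distinct4 x y z t -> #|path_edges x y z t| = 3.
Proof.
move=> [[xy xz yz] xt yt zt]; rewrite /path_edges finset.setUC cardsU1 cards2 !inE.
have h1 : E z t != E x y by apply: E_neq => //; left; split; congruence.
have h2 : E z t != E y z by apply: E_neq => //; right; split; congruence.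
have h3 : E x y != E y z by apply: E_neq => //; left; split; congruence.
by rewrite (negbTE h1) (negbTE h2) h3.
Qed.

Lemma closing_notin x y z t : distinct4 x y z t -> E t x \notin path_edges x y z t.
Proof.
move=> [[xy xz yz] xt yt zt]; rewrite !inE !negb_or.
have tx := nesym xt.
have h1 : E t x != E x y by apply: E_neq => //; left; split; congruence.
have h2 : E t x != E y z by apply: E_neq => //; left; split; congruence.
have h3 : E t x != E z t by apply: E_neq => //; right; split; congruence.
by rewrite h1 h2 h3.
Qed.

Lemma tree_path_three x y z t : distinct4 x y z t -> path_edges x y z t \in tree ->
  exists e f, [/\ below e f, ~~ stem e f,
    e \in path_edges x y z t, f \in path_edges x y z t & stem_of e f \in path_edges x y z t] /\
    forall g, g \in path_edges x y z t -> [\/ g = e, g = f | g = stem_of e f].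
Proof.
move=> d pT; have [] := tree_three pT; first by rewrite card_path_edges.
move=> e [f [bef nst pE]]; exists e, f; rewrite pE !inE !eqxx !orbT; split=> // g.
by rewrite !inE => /or3P[] /eqP ->; [constructor 3|constructor 1|constructor 2].
Qed.

Lemma path_edgesP x y z t g : g \in path_edges x y z t ->
  [\/ g = E x y, g = E y z | g = E z t].
Proof.
by rewrite !inE => /orP[/orP[]|] /eqP; [constructor 1|constructor 2|constructor 3].
Qed.

Lemma path_edges_mem x y z t :
  [/\ E x y \in path_edges x y z t, E y z \in path_edges x y z t
    & E z t \in path_edges x y z t].
Proof. by rewrite !inE !eqxx !orbT. Qed.

(** In a three-edge cell of T other than a triangle, only one edge contains the largest vertex; here
    two edges contain y. *)
Lemma middle_path_notin_tree x y z t : distinct4 x y z t ->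
  (maxn z t < y)%N -> (x < y)%N -> path_edges x y z t \notin tree.
Proof.
move=> d my xy0; apply/negP => /(tree_path_three d)[e [f [[bef nst ein fin win] all]]].
have [m1 m2 m3] := path_edges_mem x y z t.
have a1 := all _ m1; have a2 := all _ m2.
have [[n1 n2 n3] [n4 n5 n6]] := distinct4_nat d.
have [[xy xz yz] xt yt zt] := d.
have [h1 l1] : hi (E x y) = y /\ lo (E x y) = x.
  by rewrite hiE // loE //; clear - xy0; lia.
have [h2 l2] : hi (E y z) = y /\ lo (E y z) = z.
  by rewrite hiE // loE //; clear - my; lia.
have [h3 l3] : hi (E z t) = maxn z t /\ lo (E z t) = minn z t by rewrite hiE // loE.
have [hb _] := below_hi bef; have [hw _ _] := rank_pair bef nst.
have p := partnerP bef nst; rewrite /below in bef.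
have ee := path_edgesP ein; have ff := path_edgesP fin; have ww := path_edgesP win.
clear ein fin win all nst m1 m2 m3.
move: (stem_of e f) p ww a1 a2 hw => w p ww a1 a2 hw.
have {}ee : hi e = y /\ lo e = x \/ hi e = y /\ lo e = z \/
    hi e = maxn z t /\ lo e = minn z t.
  by case: ee => ->; [left|right; left|right; right].
have {}ff : hi f = y /\ lo f = x \/ hi f = y /\ lo f = z \/
    hi f = maxn z t /\ lo f = minn z t.
  by case: ff => ->; [left|right; left|right; right].
have {}ww : hi w = y /\ lo w = x \/ hi w = y /\ lo w = z \/
    hi w = maxn z t /\ lo w = minn z t.
  by case: ww => ->; [left|right; left|right; right].
have {}a1 : hi e = y /\ lo e = x \/ hi f = y /\ lo f = x \/ hi w = y /\ lo w = x.
  by case: a1 => <-; [left|right; left|right; right].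
have {}a2 : hi e = y /\ lo e = z \/ hi f = y /\ lo f = z \/ hi w = y /\ lo w = z.
  by case: a2 => <-; [left|right; left|right; right].
have le := lo_lt_hi e; have r := rootP (lo e).
clear h1 l1 h2 l2 h3 l3 d xy xz yz xt yt zt.
have he : hi e = y by clear - a1 ee ff ww hb hw my; lia.
have two : hi f = y \/ hi w = y by clear - a1 a2 n2; lia.
case: p => [[q1 q2 q3 q4 _]|[q1 [j [q2 q3 q4 q5 [q6 q7 _]]]]|[q1 [j [q2 q3 q4 q5 [q6 q7 _]]]]|[q1 [q2 q3 q4 q5 [q6 q7 _]]]].
- have hwlt : (hi w < y)%N by clear - q3 le he; lia.
  clear - a1 a2 hwlt ww q1 q2 q3 q4 he n1 n2 n3 n4 n5 n6 my xy0; lia.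
- by clear - two q1 q2 q3 q4 q5 q6 q7 he r le; lia.
- by clear - two q1 q2 q3 q4 q5 q6 q7 he r le; lia.
- by clear - two q1 q2 q3 q4 q5 q6 q7 he r le; lia.
Qed.

Definition rt (y : 'I_n) : 'I_n := V_ m (root y).

Lemma rtE y : rt y = root y :> nat.
Proof. by rewrite /rt V_K //; have [[_ ->]|[_ ->]] := rootP y. Qed.

Lemma rt_neq y : rt y <> y.
Proof. by apply: nat_neq; rewrite rtE; have := rootP y; clear; lia. Qed.

(** [partnerP] with vertices in place of numbers, when f misses the largest vertex x and the
    triangle case disappears. *)
Lemma partner_end x y f : (y < x)%N -> below (E x y) f -> ~~ stem (E x y) f ->
  (hi f < x)%N ->
  [\/ exists j, [/\ j <> rt y, j <> y, f = E y j & stem_of (E x y) f = E j (rt y)],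
      exists j, [/\ j <> rt y, j <> y, f = E (rt y) j & stem_of (E x y) f = E y (rt y)]
    | exists a b : 'I_n, [/\ (a < b)%N, f = E a b, [/\ a <> y, b <> y, a <> rt y & b <> rt y]
        & stem_of (E x y) f = E y b]].
Proof.
move=> yx bef nst fx; have p := partnerP bef nst.
have [h1 l1] : hi (E x y) = x /\ lo (E x y) = y.
  by rewrite hiE ?loE //; [clear - yx|apply/nesym/lt_neq..]; lia.
have hx := ltn_ord x; have l := lo_lt_hi f.
rewrite h1 l1 in p; move: (stem_of _ f) p => w p; rewrite -(rtE y) in p.
have ry := @rt_neq y.
have V j : (j < n)%N -> exists2 j' : 'I_n, j' = j :> nat & True.
  by move=> jn; exists (V_ m j); rewrite ?V_K.
case: p => [[q1 _ _ _ _]|[q1 [j [q2 q3 q4 q5 [q6 q7 _]]]]|[q1 [j [q2 q3 q4 q5 [q6 q7 _]]]]|[q1 [q2 q3 q4 q5 [q6 q7 _]]]].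
- by rewrite q1 ltnn in fx.
- have [j' jj _] := V j ltac:(clear - q5 fx hx; lia); subst j.
  have jr : j' <> rt y by exact: nat_neq.
  have jy : j' <> y by exact: nat_neq.
  constructor 1; exists j'; split=> //.
    by apply: edge_eq; rewrite ?hiE ?loE ?q4 ?q5 //; exact: nesym.
  by apply: edge_eq; rewrite ?hiE ?loE ?q6 ?q7.
- have [j' jj _] := V j ltac:(clear - q5 fx hx; lia); subst j.
  have jr : j' <> rt y by apply: nat_neq; move: l; rewrite q4 q5; clear; lia.
  have jy : j' <> y by exact: nat_neq.
  constructor 2; exists j'; split=> //.
    by apply: edge_eq; rewrite ?hiE ?loE ?q4 ?q5 //; exact: nesym.
  by apply: edge_eq; rewrite ?hiE ?loE ?q6 ?q7 //; exact: nesym.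
- have [a aa _] := V (lo f) ltac:(clear - l fx hx; lia).
  have [b bb _] := V (hi f) ltac:(clear - l fx hx; lia).
  rewrite -aa -bb in q2 q3 q4 q5 q6 q7 l.
  constructor 3; exists a, b; split=> //.
  + have ab := lt_neq l; apply: edge_eq; rewrite ?hiE ?loE // -?aa -?bb; clear - l; lia.
  + by split; exact: nat_neq.
  + have yb : y <> b by apply: nesym; exact: nat_neq.
    by apply: edge_eq; rewrite ?hiE ?loE ?q6 ?q7.
Qed.

(** With x largest and r = [rt y], the paths from x through y in T are x, y, j, r and x, y, r, j and
    x, y, b, a with a < b. *)
Lemma end_path_notin_tree x y z t : distinct4 x y z t ->
  (maxn y (maxn z t) < x)%N -> (z < t)%N -> z <> rt y -> t <> rt y ->
  path_edges x y z t \notin tree.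
Proof.
move=> d my zt0 zr tr; apply/negP => /(tree_path_three d)[e [f [[bef nst ein fin win] all]]].
have [m1 m2 m3] := path_edges_mem x y z t.
have a1 := all _ m1.
have [[xy xz yz] xt yt zt] := d.
have [h1 l1] : hi (E x y) = x /\ lo (E x y) = y.
  by rewrite hiE // loE //; clear - my; lia.
have h2 : hi (E y z) = maxn y z by rewrite hiE.
have h3 : hi (E z t) = t by rewrite hiE //; clear - zt0; lia.
have [hb _] := below_hi bef; have [hw _ _] := rank_pair bef nst.
have ee : e = E x y.
  have [//|ee|ee] := path_edgesP ein; exfalso; case: a1 => a; move: h1; rewrite a;
    rewrite ?ee ?h2 ?h3 in hb hw *; clear - hb hw my; lia.
subst e; have ne := below_neq bef; have nw : E x y <> stem_of (E x y) f.
  have : Some (E x y, Some f) \in lower_cells m by rewrite lower_pair bef nst.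
  by move/partner_notin; rewrite !inE negb_or => /andP[/eqP/nesym].
have ff : f = E y z \/ f = E z t.
  by have [h|h|h] := path_edgesP fin; [case: ne|left|right].
have ww : stem_of (E x y) f = E y z \/ stem_of (E x y) f = E z t.
  by have [h|h|h] := path_edgesP win; [case: nw|left|right].
have fx : (hi f < x)%N by case: ff => ->; rewrite ?h2 ?h3; clear - my; lia.
have yx : (y < x)%N by clear - my; lia.
have ry := @rt_neq y.
have p := partner_end yx bef nst fx; move: (stem_of _ f) ww p => w ww p.
clear bef nst ein fin win all a1 hb hw h1 l1 h2 h3 ne nw fx yx m1 m2 m3 d my.
have res u v : w = E u v -> u <> v ->
  ((u = y /\ v = z) \/ (u = z /\ v = y)) \/ ((u = z /\ v = t) \/ (u = t /\ v = z)).
  by move=> wE uv; case: ww; rewrite wE => h; [left|right]; exact: E_inj h uv _.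
have resf u v : f = E u v -> u <> v ->
  ((u = y /\ v = z) \/ (u = z /\ v = y)) \/ ((u = z /\ v = t) \/ (u = t /\ v = z)).
  by move=> fE uv; case: ff; rewrite fE => h; [left|right]; exact: E_inj h uv _.
case: p => [[j [jr jy /resf f1 /res w1]]|[j [jr jy /resf f1 /res w1]]|[a [b [ab /resf f1 [h1 h2 h3 h4] /res w1]]]].
- have {}f1 := f1 (nesym jy); have {}w1 := w1 jr; clear - f1 w1 xy xz yz xt yt zt zr tr ry jr jy.
  by split_cases; congruence.
- have {}w1 := w1 (nesym ry); clear - w1 xy xz yz xt yt zt zr tr ry jr jy.
  by split_cases; congruence.
- have {}f1 := f1 (lt_neq ab); have {}w1 := w1 (nesym h2).
  have [bz|bt] := pselect (b = z).
    have az : a <> t by move=> aE; move: ab zt0; rewrite aE bz; clear; lia.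
    by clear - f1 w1 xy xz yz xt yt zt zr tr ry bz az h1 h2; split_cases; congruence.
  by clear - f1 w1 xy xz yz xt yt zt zr tr ry bt h1 h2; split_cases; congruence.
Qed.

Lemma tree_mem e f g : below e f -> ~~ stem e f -> stem_of e f = g ->
  g |: [set e; f]%SET \in tree.
Proof.
move=> bef nst <-; rewrite inE; apply/exists_inP; exists (Some (e, Some f)).
  by rewrite lower_pair bef nst.
by rewrite eqxx orbT.
Qed.

Lemma end_path_in_tree x y z t : distinct4 x y z t ->
  (maxn y (maxn z t) < x)%N -> [\/ (t < z)%N, z = rt y | t = rt y] ->
  path_edges x y z t \in tree.
Proof.
move=> d my cond; have [[xy xz yz] xt yt zt] := d.
have ry := @rt_neq y.
have yx : (y < x)%N by clear - my; lia.
have mem (f g : edge n) : (hi f < x)%N -> f <> E y (rt y) ->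
   (below (E x y) f -> ~~ stem (E x y) f -> stem_of (E x y) f = g) ->
   g |: [set E x y; f]%SET \in tree.
  move=> fx fs gE; have hE : hi (E x y) = x by rewrite hiE //; clear - yx; lia.
  have lE : lo (E x y) = y by rewrite loE //; clear - yx; lia.
  have bef : below (E x y) f by rewrite /below hE fx.
  have nst : ~~ stem (E x y) f.
    apply/negP => /andP[/eqP l /eqP h]; apply: fs.
    by apply: edge_eq; rewrite ?hiE ?loE ?l ?h ?lE ?rtE //; exact: nesym.
  by apply: tree_mem => //; exact: gE.
(* If t is the root then [E y z] has parent [E z t]; otherwise [E z t] has parent [E y z]. *)
have [tr|tr] := pselect (t = rt y).
  have -> : path_edges x y z t = E z t |: [set E x y; E y z]%SET by rewrite finset.setUC.
  have fx : (hi (E y z) < x)%N by rewrite hiE //; clear - my; lia.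
  have nr : z <> rt y by congruence.
  apply: mem => // [/E_inj/(_ yz (nesym ry))|bef nst]; first by move=> h; split_cases.
  have p := partner_end yx bef nst fx.
  case: p => [[j [jr jy /E_inj/(_ yz (nesym jy)) f1 ->]]|[j [jr jy /E_inj/(_ yz (nesym jr)) f1 ->]]|[a [b [/lt_neq ab /E_inj/(_ yz ab) f1 [h1 h2 h3 h4] ->]]]].
  - by have -> : j = z; [clear - f1 yz; split_cases; congruence|rewrite tr].
  - by exfalso; clear - f1 nr ry; split_cases; congruence.
  - by exfalso; clear - f1 h1 h2 yz; split_cases; congruence.
have -> : path_edges x y z t = E y z |: [set E x y; E z t]%SET.
  apply/setP => g; rewrite !inE.
  by case: (g == E x y); case: (g == E y z); case: (g == E z t).
have fx : (hi (E z t) < x)%N by rewrite hiE //; clear - my; lia.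
apply: mem => // [/E_inj/(_ zt (nesym ry)) h|bef nst].
  by clear - h yz yt; split_cases; congruence.
have p := partner_end yx bef nst fx.
case: p => [[j [jr jy /E_inj/(_ zt (nesym jy)) f1 ->]]|[j [jr jy /E_inj/(_ zt (nesym jr)) f1 ->]]|[a [b [ab /E_inj/(_ zt (lt_neq ab)) f1 [h1 h2 h3 h4] ->]]]].
- by exfalso; clear - f1 yz yt; split_cases; congruence.
- by have -> : rt y = z; [clear - f1 tr; split_cases; congruence|].
- have -> // : b = z; case: f1 => [[za tb]|[zb ta] //]; exfalso.
  case: cond => [tz|zr|//]; last by apply: h3; rewrite -za.
  by move: ab; rewrite -za -tb; clear - tz; lia.
Qed.

(** For b < a < c the edge {b, c} has parent {a, b} in the tree of {a, c}. *)
Lemma triangle_in_tree x y z : distinct3 x y z ->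
  [set E x y; E y z; E z x]%SET \in tree.
Proof.
have main (a b c : 'I_n) : (b < a)%N -> (a < c)%N -> [set E a c; E b c; E a b]%SET \in tree.
  move=> ba ac; have ne1 := lt_neq ac; have ne3 := nesym (lt_neq ba).
  have ne2 : b <> c by apply: lt_neq; exact: ltn_trans ba ac.
  have [h1 l1] : hi (E a c) = c /\ lo (E a c) = a.
    by rewrite hiE // loE //; clear - ba ac; lia.
  have [h2 l2] : hi (E b c) = c /\ lo (E b c) = b.
    by rewrite hiE // loE //; clear - ba ac; lia.
  have bef : below (E a c) (E b c) by rewrite /below h1 l1 h2 l2 eqxx ba orbT.
  have r := rootP a.
  have nst : ~~ stem (E a c) (E b c).
    by rewrite /stem l1 h2 l2; clear - r ba ac; lia.
  rewrite finset.setUC; apply: tree_mem => //; have p := partnerP bef nst.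
  rewrite !h1 !l1 !h2 !l2 in p; case: p => [[_ _ q3 q4 _]|[]|[]|[]]; last 3 first.
  - by rewrite ltnn.
  - by rewrite ltnn.
  - by rewrite ltnn.
  by apply: edge_eq; [rewrite q4 (loE ne3)|rewrite q3 (hiE ne3)]; clear - ba; lia.
move=> [xy xz yz].
have nxy := neq_nat xy; have nxz := neq_nat xz; have nyz := neq_nat yz.
have sw a b c : [set E a b; E b c; E c a]%SET = [set E a c; E b c; E a b]%SET.
  apply/setP => e; rewrite !inE [E c a]E_sym.
  by case: (e == E a c); case: (e == E b c); case: (e == E a b).
(* The transpositions [s1] and [s2] sort the three vertices. *)
have s1 a b c : [set E a c; E b c; E a b]%SET = [set E b c; E a c; E b a]%SET.
  apply/setP => e; rewrite !inE [E b a]E_sym.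
  by case: (e == E a c); case: (e == E b c); case: (e == E a b).
have s2 a b c : [set E a c; E b c; E a b]%SET = [set E a b; E c b; E a c]%SET.
  apply/setP => e; rewrite !inE [E c b]E_sym.
  by case: (e == E a c); case: (e == E b c); case: (e == E a b).
rewrite sw.
clear xy xz yz; have [l1|l1] := ltnP x y; have [l2|l2] := ltnP y z;
  have [l3|l3] := ltnP x z;
  by [exfalso; lia | apply: main; lia | rewrite s1; apply: main; lia
     | rewrite s2; apply: main; lia | rewrite s1 s2; apply: main; lia
     | rewrite s2 s1; apply: main; lia | rewrite s1 s2 s1; apply: main; lia].
Qed.

End Paths.

(** * Members of T, critical paths and paths matched with 4-cycles *)

Section Classification.
Variable m : nat.
Local Notation n := m.+2.
Implicit Types (e f g : edge n) (x y z t : 'I_n) (s : graph n).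
Local Notation tree := (matched (lower_cells m) (@low_cell m) (@partner m)).

(** The three-edge paths outside T that are not matched with a 4-cycle. In the last branch x is the
    largest vertex and the condition says that the path is outside T. *)
Definition critical x y z t : bool := oriented x y z t &&
  (if (x < y)%N then (z < x)%N else [&& (z < t)%N, z != rt y & t != rt y]).

(** The free face of a 4-cycle: y is its largest vertex, and the deleted edge joins the smaller
    neighbour x of y to the vertex t opposite y. *)
Definition square x y z t : bool := [&& oriented x y z t, (x < y)%N & (x < z)%N].

Lemma tame_path x y z t : distinct4 x y z t -> tame (path_edges x y z t).
Proof.
move=> d; apply: (tame_cycle d) => e /path_edgesP[] ->; by constructor.
Qed.

Lemma tame_cycle_edges x y z t : distinct4 x y z t -> tame (cycle_edges x y z t).
Proof.
move=> d; apply: (tame_cycle d) => e; rewrite finset.in_setU1 => /orP[/eqP ->|].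
  by constructor 4.
by move=> /path_edgesP[] ->; constructor.
Qed.

(** With three edges, the cell is a triangle if both edges of the lower pair contain the largest
    vertex, and a path by [partner_end] otherwise. *)
Lemma tame_tree s : s \in tree -> tame s.
Proof.
move=> sT; have [s2|s3] := leqP #|s| 2; first exact: tame_small.
have [e [f [bef nst sE]]] := tree_three sT s3.
have [y [x [yx eE]]] := edgeP e.
have [k1 k2] := below_hi bef.
rewrite E_sym in eE; subst e.
have xy : x <> y by apply: nesym; exact: lt_neq.
have [h1 l1] : hi (E x y) = x /\ lo (E x y) = y.
  by rewrite hiE // loE //; clear - yx; lia.
have [hf|hf] := eqVneq (hi f) x.
  have p := partnerP bef nst; rewrite h1 l1 hf in p.
  case: p => [[_ q2 q3 q4 _]|[]|[]|[]]; rewrite ?ltnn //.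
  have [a [b [/lt_neq ab fE]]] := edgeP f; have lf := lo_lt_hi f.
  have [c fE'] : exists c, f = E x c /\ (c < y)%N.
    have hx := ltn_ord x; exists (V_ m (lo f)).
    have lK : V_ m (lo f) = lo f :> nat by rewrite V_K //; clear - q2 yx hx; lia.
    have ne : x <> V_ m (lo f) by apply: nat_neq; rewrite lK; clear - q2 yx; lia.
    split; last by rewrite lK.
    by apply: edge_eq; rewrite ?hiE ?loE // lK ?hf; clear - q2 yx; lia.
  have [{}fE cy] := fE'.
  have yc : y <> c by apply: nesym; exact: lt_neq.
  have xc : x <> c by apply: nat_neq; clear - cy yx; lia.
  have wE : stem_of (E x y) f = E y c.
    have lc : lo f = c by rewrite fE loE //; clear - cy yx; lia.
    apply: edge_eq; first by rewrite q4 lc loE //; clear - cy; lia.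
    by rewrite q3 hiE //; clear - cy; lia.
  have d : distinct3 x y c by split.
  apply: (tame_triangle d) => g; rewrite sE wE fE !inE => /or3P[] /eqP ->.
  - by constructor 2.
  - by constructor 1.
  - by rewrite E_sym; constructor 3.
have fx : (hi f < x)%N by rewrite ltn_neqAle hf -h1.
have rx : rt y <> x by apply: nat_neq; rewrite rtE; move: k2; rewrite h1;
  have := rootP y; clear; lia.
have ry := @rt_neq m y.
have path x1 x2 x3 x4 : distinct4 x1 x2 x3 x4 -> s = path_edges x1 x2 x3 x4 -> tame s.
  by move=> d ->; exact: tame_path.
case: (partner_end yx bef nst fx) => [[j [jr jy fE wE]]|[j [jr jy fE wE]]|[a [b [ab fE [h3 h4 h5 h6] wE]]]].
- have jx : j <> x.
    apply: nat_neq; move: fx; rewrite fE hiE //; last exact: nesym.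
    by clear; lia.
  apply: (path x y j (rt y)); first by split; [split|..]; congruence.
  rewrite sE wE fE; apply/setP => g; rewrite !inE.
  by case: (g == E x y); case: (g == E y j); case: (g == E j (rt y)).
- have jx : j <> x.
    apply: nat_neq; move: fx; rewrite fE hiE //; last exact: nesym.
    by clear; lia.
  apply: (path x y (rt y) j); first by split; [split|..]; congruence.
  rewrite sE wE fE; apply/setP => g; rewrite !inE.
  by case: (g == E x y); case: (g == E y (rt y)); case: (g == E (rt y) j).
- have bx : b <> x.
    by apply: nat_neq; move: fx; rewrite fE hiE //; [clear; lia|exact: lt_neq].
  have ax : a <> x by apply: nat_neq; move: fx; rewrite fE hiE //; [clear; lia|exact: lt_neq].
  have nab := lt_neq ab.
  apply: (path x y b a); first by split; [split|..]; congruence.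
  rewrite sE wE fE [E a b]E_sym; apply/setP => g; rewrite !inE.
  by case: (g == E x y); case: (g == E y b); case: (g == E b a).
Qed.

Lemma squareP x y z t : distinct4 x y z t ->
  (x < y)%N -> (z < y)%N -> (t < y)%N ->
  square x y z t \/ square z y x t.
Proof.
move=> d xy zy ty; have d' : distinct4 z y x t.
  by move: d => [[h1 h2 h3] h4 h5 h6]; split; [split|..]; congruence.
have [_ xz] : x <> y :> nat /\ x <> z :> nat.
  by have [[]] := distinct4_nat d.
rewrite /square !orientedE // xy zy; have [xz0|zx0] := ltnP x z; [left|right].
  by clear - xy zy ty; lia.
by clear - xy zy ty zx0 xz; lia.
Qed.

(** Rotations bring the largest vertex to the second place, and a reversal then puts its smaller
    neighbour first. *)
Lemma cycle_square x y z t : distinct4 x y z t ->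
  exists x' y' z' t', square x' y' z' t' /\ cycle_edges x y z t = cycle_edges x' y' z' t'.
Proof.
have main x1 y1 z1 t1 : distinct4 x1 y1 z1 t1 ->
    (x1 < y1)%N -> (z1 < y1)%N -> (t1 < y1)%N ->
    exists x' y' z' t', square x' y' z' t' /\
      cycle_edges x1 y1 z1 t1 = cycle_edges x' y' z' t'.
  move=> d h1 h2 h3; have [sq|sq] := squareP d h1 h2 h3.
    by exists x1, y1, z1, t1.
  by exists z1, y1, x1, t1; rewrite cycle_edges_rev.
move=> d; have [[n1 n2 n3] [n4 n5 n6]] := distinct4_nat d.
have rot x1 y1 z1 t1 : distinct4 x1 y1 z1 t1 -> distinct4 y1 z1 t1 x1.
  by move=> [[h1 h2 h3] h4 h5 h6]; split; [split|..]; congruence.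
have d1 := rot _ _ _ _ d; have d2 := rot _ _ _ _ d1; have d3 := rot _ _ _ _ d2.
have [[a1 a2 a3]|[[a1 a2 a3]|[[a1 a2 a3]|[a1 a2 a3]]]] :
  [/\ x < y, z < y & t < y]%N \/ [/\ y < z, t < z & x < z]%N \/
  [/\ z < t, x < t & y < t]%N \/ [/\ t < x, y < x & z < x]%N.
  have [xy|xy] := ltnP x y; have [zt|zt] := ltnP z t.
  - have [yt|yt] := ltnP y t; first by right; right; left; split; clear - xy zt yt; lia.
    by left; split; clear - xy zt yt n5; lia.
  - have [yz|yz] := ltnP y z; first by right; left; split; clear - xy zt yz n6; lia.
    by left; split; clear - xy zt yz n3; lia.
  - have [xt|xt] := ltnP x t; first by right; right; left; split; clear - xy zt xt; lia.
    by right; right; right; split; clear - xy zt xt n1 n4; lia.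
  - have [xz|xz] := ltnP x z; first by right; left; split; clear - xy zt xz n6; lia.
    by right; right; right; split; clear - xy zt xz n1 n2; lia.
- exact: main.
- by rewrite cycle_edges_rot; exact: main.
- by rewrite 2!cycle_edges_rot; exact: main.
- by rewrite 3!cycle_edges_rot; exact: main.
Qed.

(** A tame graph with more than two edges is a triangle, which is in T, or contains a path to which
    only the closing edge can be added. *)
Lemma tame_classification s : tame s <-> [\/ s \in tree,
  exists x y z t, critical x y z t /\ s = path_edges x y z t |
  exists x y z t, square x y z t /\ (s = path_edges x y z t \/ s = cycle_edges x y z t)].
Proof.
split=> [ts|[|[x [y [z [t [c ->]]]]]|[x [y [z [t [c sE]]]]]]]; last 3 first.
- exact: tame_tree.
- by case/andP: c => /oriented_distinct d _; exact: tame_path.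
- case/and3P: c => /oriented_distinct d _ _.
  by case: sE => ->; [exact: tame_path|exact: tame_cycle_edges].
have [s2|s3] := leqP #|s| 2; first by constructor 1; exact: small_tree.
have [[x [y [z [d [s1 s2 s4]]]]]|[x [y [z [t [d [s1 s2 s4]]]]]]] := tame_three ts s3.
  by constructor 1; rewrite (tame_triangle_only ts d s1 s2 s4); exact: triangle_in_tree.
have sub h : h \in s -> [\/ h = E x y, h = E y z, h = E z t | h = E t x].
  exact: tame_path_sub.
have ps : path_edges x y z t \subset s.
  by apply/fintype.subsetP => g /path_edgesP[] ->.
have [txs|txs] := boolP (E t x \in s).
  have [x' [y' [z' [t' [sq cE]]]]] := cycle_square d.
  constructor 3; exists x', y', z', t'; split=> //; right; rewrite -cE.
  apply/eqP; rewrite finset.eqEsubset; apply/andP; split.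
    by apply/fintype.subsetP => g /sub[] ->; rewrite !inE eqxx ?orbT.
  by rewrite finset.subUset finset.sub1set txs.
have sE : s = path_edges x y z t.
  apply/eqP; rewrite finset.eqEsubset ps andbT; apply/fintype.subsetP => g gs.
  have [gE|gE|gE|gE] := sub g gs; rewrite gE !inE ?eqxx ?orbT //.
  by move: txs; rewrite -gE gs.
clear sub ps txs ts s3 s1 s2 s4.
have [x1 [y1 [z1 [t1 [ori sE1]]]]] : exists x1 y1 z1 t1,
    oriented x1 y1 z1 t1 /\ s = path_edges x1 y1 z1 t1.
  have [lt|ge] := ltnP (maxn z t) (maxn x y).
    by exists x, y, z, t; rewrite orientedE.
  exists t, z, y, x; rewrite -path_edges_rev orientedE; last first.
    by move: d => [[h1 h2 h3] h4 h5 h6]; split; [split|..]; congruence.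
  have [[n1 n2 n3] [n4 n5 n6]] := distinct4_nat d.
  by split=> //; clear - n1 n2 n3 n4 n5 n6 ge; lia.
clear d sE; have d := oriented_distinct ori; have [[n1 n2 n3] [n4 n5 n6]] := distinct4_nat d.
have o' := ori; rewrite orientedE // in o'.
have [xy|yx] := ltnP x1 y1.
  have [zx|xz] := ltnP z1 x1.
    constructor 2; exists x1, y1, z1, t1; split=> //.
    by rewrite /critical ori xy zx.
  constructor 3; exists x1, y1, z1, t1; split; last by left.
  by rewrite /square ori xy /= ltn_neqAle xz andbT; apply/eqP.
have [c|c] := boolP [&& (z1 < t1)%N, z1 != rt y1 & t1 != rt y1].
  constructor 2; exists x1, y1, z1, t1; split=> //.
  by rewrite /critical ori ltnNge yx.
constructor 1; rewrite sE1; apply: end_path_in_tree => //.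
  by clear - o' yx n1; lia.
move: c; rewrite !negb_and !negbK => /or3P[zt|/eqP zr|/eqP tr].
- by constructor 1; clear - zt n6; lia.
- by constructor 2.
- by constructor 3.
Qed.

End Classification.

(** * The wedge indexed by critical paths *)

Section DominationWedge.
Variables (R : realType) (m : nat).
Local Notation n := m.+2.
Local Notation tree := (matched (lower_cells m) (@low_cell m) (@partner m)).

Definition quad := ('I_n * 'I_n * 'I_n * 'I_n)%type.

Definition quad_path (q : quad) : {set edge n} :=
  path_edges q.1.1.1 q.1.1.2 q.1.2 q.2.

Definition critical_quads : {set quad} :=
  [set q : quad | critical q.1.1.1 q.1.1.2 q.1.2 q.2]%SET.

Definition square_quads : {set quad} :=
  [set q : quad | square q.1.1.1 q.1.1.2 q.1.2 q.2]%SET.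

Definition closing (q : quad) : edge n := E q.2 q.1.1.1.

Definition quad_edge (q : quad) (k : 'I_3) : edge n :=
  if k == 0%N :> nat then E q.1.1.1 q.1.1.2
  else if k == 1%N :> nat then E q.1.1.2 q.1.2 else E q.1.2 q.2.

Definition critical_edge (i : 'I_(#|critical_quads|)) := quad_edge (enum_val i).

Lemma critical_quads_oriented q : q \in critical_quads ->
  oriented q.1.1.1 q.1.1.2 q.1.2 q.2.
Proof. by rewrite inE => /andP[]. Qed.

Lemma square_quads_oriented q : q \in square_quads ->
  oriented q.1.1.1 q.1.1.2 q.1.2 q.2.
Proof. by rewrite inE => /and3P[]. Qed.

Lemma facet_critical i : facet critical_edge i = quad_path (enum_val i).
Proof.
apply/setP => g; apply/imsetP/idP => [[k _ ->]|].
  have [m1 m2 m3] := path_edges_mem (enum_val i).1.1.1 (enum_val i).1.1.2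
    (enum_val i).1.2 (enum_val i).2.
  by rewrite /critical_edge /quad_edge; case: ifP => _ //; case: ifP.
move=> /path_edgesP[] ->.
- by exists (@Ordinal 3 0 isT).
- by exists (@Ordinal 3 1 isT).
- by exists (@Ordinal 3 2 isT).
Qed.

Lemma critical_edge_inj i : injective (critical_edge i).
Proof.
have d := oriented_distinct (critical_quads_oriented (enum_valP i)).
have /imset_injP : #|facet critical_edge i| == #|'I_3|.
  by rewrite facet_critical card_path_edges // card_ord.
by move=> inj k l; exact: inj.
Qed.

Lemma quad_path_inj q q' : oriented q.1.1.1 q.1.1.2 q.1.2 q.2 ->
  oriented q'.1.1.1 q'.1.1.2 q'.1.2 q'.2 -> quad_path q = quad_path q' -> q = q'.
Proof.
case: q => [[[x y] z] t]; case: q' => [[[x' y'] z'] t'] /= h h' qq.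
by apply: oriented_inj h h' _; rewrite -/(quad_path (x, y, z, t)) qq.
Qed.

Lemma oriented_notin_tree x y z t : oriented x y z t ->
  (x < y)%N || [&& (z < t)%N, z != rt y & t != rt y] ->
  path_edges x y z t \notin tree.
Proof.
move=> ori h; have d := oriented_distinct ori; rewrite orientedE // in ori.
have [[n1 n2 n3] [n4 n5 n6]] := distinct4_nat d.
have [xy|yx] := ltnP x y.
  by apply: middle_path_notin_tree => //; clear - xy ori; lia.
move: h; rewrite ltnNge yx /= => /and3P[zt /eqP zr /eqP tr].
by apply: end_path_notin_tree => //; clear - yx ori n1; lia.
Qed.

Lemma critical_notin_tree q : q \in critical_quads -> quad_path q \notin tree.
Proof.
rewrite inE => /andP[ori h]; apply: oriented_notin_tree => //.
by move: h; case: ifP.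
Qed.

Lemma square_notin_tree q : q \in square_quads -> quad_path q \notin tree.
Proof.
by rewrite inE => /and3P[ori h _]; apply: oriented_notin_tree; rewrite ?h.
Qed.

Lemma square_max q : q \in square_quads ->
  (maxn q.1.2 q.2 < q.1.1.2)%N /\ (q.1.1.1 < q.1.2)%N.
Proof.
case: q => [[[x y] z] t] qq; have /= ori := square_quads_oriented qq.
have d := oriented_distinct ori; rewrite (orientedE d) in ori.
by move: qq; rewrite inE /= => /and3P[_ h1 h2]; split=> //; clear - h1 ori; lia.
Qed.

Lemma domination_complexE (s : {set edge n}) : s != finset.set0 ->
  (s \in simplices (domination_complex n m)) =
  [|| s \in tree, [exists i, s == facet critical_edge i]
    | [exists q in square_quads, (s == quad_path q) || (s == closing q |: quad_path q)]].
Proof.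
move=> s0; have -> : (s \in simplices (domination_complex n m)) =
    (m <= domination_number s)%N by rewrite inE card_gt0 s0.
apply/idP/idP => [/domination_tame/tame_classification[->//|h|h]|h].
- move: h => [x [y [z [t [c ->]]]]]; apply/or3P; constructor 2; apply/existsP.
  have qc : (x, y, z, t) \in critical_quads by rewrite inE.
  exists (enum_rank_in qc (x, y, z, t)).
  by rewrite facet_critical enum_rankK_in.
- move: h => [x [y [z [t [c sE]]]]]; apply/or3P; constructor 3; apply/exists_inP.
  exists (x, y, z, t); first by rewrite inE.
  by apply/orP; case: sE => ->; [left|right].
apply/domination_tame/tame_classification; case/or3P: h => [h|/existsP[i /eqP ->]|].
- by constructor 1.
- constructor 2; have := enum_valP i; rewrite inE => c.
  by do 4!eexists; split; [exact: c|exact: facet_critical].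
case/exists_inP => q; rewrite inE => qs qE; constructor 3.
do 4!eexists; split; first exact: qs.
by case/orP: qE => /eqP ->; [left|right].
Qed.

Lemma domination_complex_wedge (i0 : 'I_(#|critical_quads|)) :
  homotopy_equivalent R (realization R (domination_complex n m))
    (sphere_wedge R 2 #|critical_quads|).
Proof.
have closeN (q : quad) : oriented q.1.1.1 q.1.1.2 q.1.2 q.2 -> closing q \notin quad_path q.
  by move=> /oriented_distinct; exact: closing_notin.
refine (@critical_cells_homotopy_equivalent R _ (domination_complex n m) 2 #|critical_quads|
  critical_edge i0 _ (lower_cells m) (@low_cell m) (@partner m) (@rank m)
  _ square_quads quad_path closing (fun=> 0%N) _ _ _ _ _ _ _ _ _ _ _ _ _ _).
- exact: tree_closed.
- exact: partner_notin.
- exact: up_cell_neq.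
- exact: acyclic_cells.
- by move=> q qq; apply: closeN; exact: square_quads_oriented.
- move=> q q' qq qq'; apply/eqP => /(congr1 (fun s : {set edge n} => #|s|)).
  have o1 := square_quads_oriented qq; have o2 := square_quads_oriented qq'.
  by rewrite cardsU1 closeN // !card_path_edges //; exact: oriented_distinct.
(* No path of one pair lies in the cycle of another, so the constant rank is admissible. *)
- move=> q q' qq qq' ne sub; exfalso; move/eqP: ne; apply.
  have o1 := oriented_distinct (square_quads_oriented qq).
  have o2 := oriented_distinct (square_quads_oriented qq').
  have [h1 h2] := square_max qq; have [h3 h4] := square_max qq'.
  case: q {qq} o1 h1 h2 sub => [[[x y] z] t] o1 h1 h2 sub.
  case: q' {qq'} o2 h3 h4 sub => [[[x' y'] z'] t'] o2 h3 h4 sub.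
  exact: path_in_cycle o1 o2 h1 h2 h3 h4 sub.
- by move=> q; exact: square_notin_tree.
(* Equal paths have equal quadruples, but a square has x < y and x < z, whereas a critical quadruple
   with x < y has z < x. *)
- move=> q qq i; rewrite facet_critical; apply/eqP => qE.
  have ic := enum_valP i.
  have qi := quad_path_inj (square_quads_oriented qq) (critical_quads_oriented ic) qE.
  move: qq ic; rewrite -qi !inE /critical => /and3P[_ xy xz] /andP[_].
  by rewrite xy ltnNge (ltnW xz).
- exact: critical_edge_inj.
- move=> i j; rewrite !facet_critical => ij; apply: enum_val_inj.
  by apply: quad_path_inj ij; apply: critical_quads_oriented; exact: enum_valP.
- by move=> i; rewrite facet_critical; apply: critical_notin_tree; exact: enum_valP.
- move=> i t ti; apply: small_tree.
  have := proper_card ti; rewrite facet_critical card_path_edges //.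
  by apply: oriented_distinct; apply: critical_quads_oriented; exact: enum_valP.
exact: domination_complexE.
Qed.

End DominationWedge.

(** * The number of spheres *)

Section Counting.
Local Open Scope nat_scope.

Lemma sum_below (n y : nat) (F : nat -> nat) : y <= n ->
  \sum_(i < n) (i < y) * F i = \sum_(i < y) F i.
Proof.
move=> yn; rewrite (big_ord_widen n F yn) [RHS]big_mkcond /=.
by apply: eq_bigr => i _; case: (i < y); rewrite ?mul1n ?mul0n.
Qed.

Lemma sum_eq_nat (n a : nat) : \sum_(i < n) ((i : nat) == a) = (a < n).
Proof.
elim: n => [|n IH]; first by rewrite big_ord0.
rewrite big_ord_recr /= IH; lia.
Qed.

Definition avoid (a b i : nat) : nat := (i != a) && (i != b).

(** The case n = 1 serves largest vertex 1 with a = 0 and root b = 1, where the truncated difference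
    is still the right count. *)
Lemma sum_avoid (n a b : nat) : a < n -> a <> b -> b < n \/ n = 1 ->
  \sum_(i < n) avoid a b i = n - 2.
Proof.
move=> an ab bn.
have : \sum_(i < n) (avoid a b i + (((i : nat) == a) + ((i : nat) == b))) = n.
  rewrite -[RHS]card_ord -sum1_card.
  by apply: eq_bigr => i _; rewrite /avoid; lia.
rewrite !big_split /= !sum_eq_nat an; lia.
Qed.

(* For the indicator [S] of a set of k elements the first sum is 'C(k, 2). *)
Lemma sum_pairs (n : nat) (S : nat -> nat) : (forall i, S i <= 1) ->
  2 * (\sum_(t < n) S t * \sum_(z < t) S z) + \sum_(i < n) S i
  = (\sum_(i < n) S i) ^ 2.
Proof.
move=> S1; elim: n => [|n IH]; first by rewrite !big_ord0.
rewrite !big_ord_recr /=; move: IH.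
set p := \sum_(t < n) _; set c := \sum_(i < n) S i => IH.
have : S n = 0 \/ S n = 1 by have := S1 n; lia.
by case=> ->; nia.
Qed.

Lemma sum_ord_double (n : nat) : 2 * \sum_(i < n) i + n = n ^ 2.
Proof.
elim: n => [|n IH]; first by rewrite big_ord0.
by rewrite big_ord_recr /=; move: IH; set s := \sum_(i < n) _; nia.
Qed.

(** The first summand counts paths with inner largest vertex y, the second those with largest vertex
    x at the end. The factors are nested so that the variables can be summed one at a time. *)
Lemma critical_split (m : nat) (x y z t : 'I_m.+2) : critical x y z t =
  (x < y) * ((z < x) * ((t < y) * avoid x z t)) +
  (y < x) * ((t < x) * (avoid y (root y) t * ((z < t) * avoid y (root y) z))) :> nat.
Proof.
rewrite /critical /oriented /avoid -!(inj_eq val_inj) /= !rtE.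
move: (x : nat) (y : nat) (z : nat) (t : nat) => {}x {}y {}z {}t.
have [xy|yx|->] := ltngtP x y; last by rewrite /= ?andbF.
- rewrite mul1n mul0n addn0 gtn_max.
  have [zx|xz] := ltnP z x; last by rewrite !(mul0n, muln0, andbF).
  rewrite mul1n andbT (ltn_trans zx xy) /=.
  have [ty|yt] := ltnP t y; last by rewrite !(mul0n, muln0, andbF).
  rewrite mul1n andbT (gtn_eqF zx) (gtn_eqF (ltn_trans zx xy)) (gtn_eqF ty) /=.
  by rewrite [t == x]eq_sym [t == z]eq_sym.
rewrite mul0n mul1n add0n gtn_max.
have [zt|tz] := ltnP z t; last by rewrite !(mul0n, muln0, andbF).
have [tx|xt] := ltnP t x; last by rewrite !(mul0n, muln0, andbF).
rewrite (ltn_trans zt tx) (gtn_eqF (ltn_trans zt tx)) (gtn_eqF tx) (ltn_eqF zt) /=.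
rewrite !mul1n !andbT mulnb [t == y]eq_sym [z == y]eq_sym.
by case: (y == z); case: (y == t); case: (z == _); case: (t == _).
Qed.

(** For each x below y there are x choices of z and then y - 2 choices of t. *)
Lemma sum_middle (n y : nat) : y < n ->
  \sum_(x < n) \sum_(z < n) \sum_(t < n) (x < y) * ((z < x) * ((t < y) * avoid x z t))
  = (\sum_(x < y) x) * (y - 2).
Proof.
move=> yn; rewrite -(@sum_below n y id (ltnW yn)) big_distrl /=.
apply: eq_bigr => x _; have [xy|_] := ltnP x y; last first.
  by rewrite big1 // => z _; rewrite big1.
rewrite mul1n -[in RHS](card_ord x) -sum1_card big_distrl /= mul1n.
rewrite -(@sum_below n x (fun=> y - 2)); last by lia.
apply: eq_bigr => z _; have [zx|_] := ltnP z x; last first.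
  by rewrite big1.
rewrite mul1n -(@sum_avoid y x z) //; [|by lia|by left; lia].
rewrite -(@sum_below n y (avoid x z)); last by lia.
by apply: eq_bigr => t _; rewrite !mul1n.
Qed.

(** For each y below x, the pair z < t is chosen among the x - 2 vertices below x other than y and
    [root y]; the factor 2 avoids a division. *)
Lemma sum_end (n x : nat) : x < n ->
  2 * \sum_(y < n) \sum_(z < n) \sum_(t < n) (y < x) * ((t < x) *
    (avoid y (root y) t * ((z < t) * avoid y (root y) z)))
  = x * ((x - 2) ^ 2 - (x - 2)).
Proof.
move=> xn; set c := (x - 2) ^ 2 - (x - 2); rewrite big_distrr /=.
rewrite -[in RHS](card_ord x) -sum1_card big_distrl /=.
rewrite -(@sum_below n x (fun=> 1 * _)); last by lia.
apply: eq_bigr => y _; have [yx|_] := ltnP y x; last first.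
  by rewrite big1 ?muln0 // => z _; rewrite big1.
rewrite !mul1n exchange_big /=.
have r := rootP y; set S := avoid y (root y).
have cnt : \sum_(i < x) S i = x - 2 by apply: sum_avoid => //; lia.
have S1 i : S i <= 1 by rewrite /S /avoid; lia.
have := sum_pairs x S1; rewrite cnt.
suff -> : \sum_(t < n) \sum_(z < n) 1 * ((t < x) * (S t * ((z < t) * S z))) =
  \sum_(t < x) S t * \sum_(z < t) S z by rewrite /c; lia.
rewrite -(@sum_below n x (fun t => S t * \sum_(z < t) S z)); last by lia.
apply: eq_bigr => t _; rewrite -(@sum_below n t S); last by have := ltn_ord t; lia.
by rewrite !big_distrr /=; apply: eq_bigr => z _; rewrite mul1n.
Qed.

Lemma card_critical_quads (m : nat) :
  #|critical_quads m| = \sum_(k < m) k ^ 2 * (k + 2).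
Proof.
pose I := 'I_m.+2.
have -> : #|critical_quads m| =
    \sum_(x : I) \sum_(y : I) \sum_(z : I) \sum_(t : I) critical x y z t.
  rewrite (pair_bigA _ (fun x y : I => \sum_(z : I) \sum_(t : I) critical x y z t)) /=.
  rewrite (pair_bigA _ (fun (p : I * I) (z : I) =>
    \sum_(t : I) critical p.1 p.2 z t)) /=.
  rewrite (pair_bigA _ (fun (p : I * I * I) (t : I) =>
    (critical p.1.1 p.1.2 p.2 t : nat))) /=.
  by rewrite -sum1_card big_mkcond; apply: eq_bigr => q _; rewrite inE; case: critical.
pose M (x y z t : nat) := (x < y) * ((z < x) * ((t < y) * avoid x z t)).
pose D (x y z t : nat) := (y < x) * ((t < x) *
  (avoid y (root y) t * ((z < t) * avoid y (root y) z))).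
have -> : \sum_(x : I) \sum_(y : I) \sum_(z : I) \sum_(t : I) critical x y z t =
    \sum_(x : I) \sum_(y : I) \sum_(z : I) \sum_(t : I) M x y z t +
    \sum_(x : I) \sum_(y : I) \sum_(z : I) \sum_(t : I) D x y z t.
  do 4!(rewrite -big_split /=; apply: eq_bigr => ? _).
  exact: critical_split.
(* In the first sum the largest vertex is y, so it is made the outer index; both sums then run over
   layers. *)
rewrite [X in X + _]exchange_big -big_split /=.
have layer (x : I) : \sum_(i : I) \sum_(z : I) \sum_(t : I) M i x z t +
    \sum_(y : I) \sum_(z : I) \sum_(t : I) D x y z t = (x - 2) ^ 2 * x.
  have xn : x < m.+2 := ltn_ord x.
  rewrite (sum_middle xn); have := sum_end xn.
  rewrite -/(D _ _ _ _); set d := \sum_(y : I) _ => dE.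
  have := sum_ord_double x; set s := \sum_(i < x) i => sE.
  suff : 2 * (s * (x - 2) + d) = 2 * ((x - 2) ^ 2 * x) by lia.
  rewrite mulnDr dE mulnA; clear - sE.
  have -> : 2 * s = x ^ 2 - x by lia.
  have [x2|x2] := leqP (x : nat) 1; first by have -> : x - 2 = 0; [lia|rewrite !muln0].
  have [k ->] : exists k, (x : nat) = k + 2 by exists (x - 2); lia.
  rewrite addnK; have -> : (k + 2) ^ 2 - (k + 2) = (k + 2) * (k + 1) by nia.
  have [k0|k0] := posnP k; first by rewrite k0.
  have -> : k ^ 2 - k = k * (k - 1) by nia.
  have [l ->] : exists l, k = l + 1 by exists (k - 1); lia.
  by rewrite addnK; ring.
under eq_bigr do rewrite layer.
(* The layers 0 and 1 are empty; the others are shifted by 2. *)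
rewrite !big_ord_recl /= !muln0 !add0n.
by apply: eq_bigr => k _; rewrite /bump /=; congr (_ ^ 2 * _); lia.
Qed.

End Counting.

(** For n = m + 2 the last factor equals 3 n^2 - 7 n - 2. *)
Lemma sum_closed_form (m : nat) : (\sum_(k < m) k ^ 2 * (k + 2))%N%:R =
  12%:R^-1 * m%:R * (m%:R - 1) * (3%:R * m%:R ^+ 2 + 5%:R * m%:R - 4%:R) :> rat.
Proof.
elim: m => [|m IH]; first by rewrite big_ord0 mulr0 !mul0r.
rewrite big_ord_recr /= natrD IH natrM natrX natrD -addn1 natrD.
by field.
Qed.

Theorem theorem1p1 (R : realType) (n : nat) (n_ge4 : (4 <= n)%N) :
  exists N : nat,
    N%:R = 12%:R^-1 * (n%:R - 2%:R) * (n%:R - 3%:R)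
             * (3%:R * n%:R ^+ 2 - 7%:R * n%:R - 2%:R) :> rat
    /\ homotopy_equivalent R (realization R (domination_complex n (n - 2)))
         (sphere_wedge R 2 N).
Proof.
case: n n_ge4 => [|[|m]] // m2; exists #|critical_quads m|; split.
  rewrite card_critical_quads sum_closed_form -addn2 natrD.
  by field.
(* The term k = 1 equals 3 and occurs because m is at least 2; it supplies the index on which the
   wedge maps rely. *)
have N0 : (0 < #|critical_quads m|)%N.
  rewrite card_critical_quads; case: m m2 => [|[|m]] // _.
  by rewrite !big_ord_recl /= addnCA.
have -> : (m.+2 - 2 = m)%N by rewrite -addn2 addnK.
exact: domination_complex_wedge (Ordinal N0).
Qed.
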